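(* Let $X,Y,Z=[X,Y]$ be the left-invariant vector fields on $SU(2)$ described in the context, and let $T$ be either the sub-Laplacian $T=\mathcal L_{sub}=X^2+Y^2$ or the heat-type operator $T=Z-\mathcal L_{sub}=Z-X^2-Y^2$. Then there exists $C>0$ and, for every $N>0$, there exists $C_N>0$ such that $$\|u\|_{L^{1,\infty}(SU(2))}\le C\,\|Tu\|_{W^{1,-\frac14}(SU(2))}+C_N\,\|u\|_{W^{1,-N}(SU(2))}$$ for every distribution $u\in\mathscr D'(SU(2))$ for which the right-hand side is finite.
   Context: $SU(2)\cong\mathbb S^3$ with normalized Haar measure (the measure of a set $E$ is $|E|$). $X,Y,Z=[X,Y]=XY-YX$ are three left-invariant vector fields forming a basis of $\mathfrak{su}(2)$, orthonormal with respect to an inner product proportional to the negative of the Killing form. $\mathcal L=-X^2-Y^2-Z^2$ is the positive Laplacian and $J^\beta=(1+\mathcal L)^{\beta/2}$ is the Bessel potential of order $\beta\in\mathbb R$. $\mathscr D'(SU(2))=(C^\infty(SU(2)))'$ is the space of distributions. For $1\le p\le\infty$ and $\beta\in\mathbb R$, $W^{p,\beta}(SU(2))$ is the space of distributions $u$ with $\|u\|_{W^{p,\beta}}=\|J^\beta u\|_{L^p}<\infty$. $L^{1,\infty}$ is weak $L^1$, with $\|f\|_{L^{1,\infty}}=\sup_{\alpha>0}\alpha\,|\{x:|f(x)|>\alpha\}|$. *)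

(* Defs.v *)
From HB Require Import structures.
From mathcomp Require Import all_boot all_order all_algebra.
From mathcomp Require Import complex.
From mathcomp Require Import all_classical all_reals all_analysis.
From mathcomp Require Import ring lra.

Set Implicit Arguments.
Unset Strict Implicit.
Unset Printing Implicit Defensive.

Import Order.TTheory GRing.Theory Num.Theory.
Import numFieldNormedType.Exports.

Local Open Scope classical_set_scope.
Local Open Scope complex_scope.
Local Open Scope sesquilinear_scope.
Local Open Scope ring_scope.

Section SU2.
Variable R : realType.

Record SU2 := MkSU2 {
  SU2_mx :> 'M[R[i]]_2;
  _ : (SU2_mx \is unitarymx) && (\det SU2_mx == 1) }.

HB.instance Definition _ := [isSub for SU2_mx].
HB.instance Definition _ := [Choice of SU2 by <:].

Lemma SU2_one_subproof :
  ((1%:M : 'M[R[i]]_2) \is unitarymx) && (\det (1%:M : 'M[R[i]]_2) == 1).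
Proof.
rewrite det1 eqxx andbT; apply/unitarymxP.
by rewrite mul1mx trmx1 map_mx1.
Qed.

Definition SU2_one := MkSU2 SU2_one_subproof.

Lemma SU2_mul_subproof (g h : SU2) :
  (g *m h \is unitarymx) && (\det (g *m h) == 1).
Proof.
case: g h => g /= /andP[gu /eqP gd] [h /= /andP[hu /eqP hd]].
by rewrite det_mulmx gd hd mulr1 eqxx andbT mul_unitarymx.
Qed.

Definition SU2_mul (g h : SU2) := MkSU2 (SU2_mul_subproof g h).

HB.instance Definition _ := isPointed.Build SU2 SU2_one.
(* R[i]^o is R[i] with its metric topology; SU2 has the subspace topology of
   'M[R[i]]_2 and its Borel sigma-algebra. *)
HB.instance Definition _ := Topological.copy SU2
  (initial_topology (SU2_mx : SU2 -> 'M[R[i]^o]_2)).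
HB.instance Definition _ := Measurable.copy SU2
  (g_sigma_algebraType (@open SU2)).
End SU2.

Section su2.
Variable R : realType.
Local Notation M2 := 'M[R[i]]_2.

Record su2 := MkSu2 {
  su2_mx :> M2;
  _ : (su2_mx^t* == - su2_mx) && (\tr su2_mx == 0) }.

Lemma su2P (A : su2) : (A : M2)^t* = - (A : M2) /\ \tr A = 0.
Proof. by case: A => A /= /andP[/eqP -> /eqP ->]. Qed.

Lemma su2_scale_subproof (t : R) (A : su2) :
  ((t%:C *: (A : M2))^t* == - (t%:C *: (A : M2)))
    && (\tr (t%:C *: (A : M2)) == 0).
Proof.
have [AN A0] := su2P A; rewrite mxtraceZ A0 mulr0 eqxx andbT.
rewrite linearZ /= map_mxZ AN scalerN.
by apply/eqP; congr (- (_ *: _)); exact: conjc_real.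
Qed.

Definition su2_scale (t : R) (A : su2) := MkSu2 (su2_scale_subproof t A).

Lemma su2_bracket_subproof (A B : su2) :
  ((A *m B - B *m A)^t* == - (A *m B - B *m A))
    && (\tr (A *m B - B *m A) == 0).
Proof.
have [AN A0] := su2P A; have [BN B0] := su2P B.
rewrite [\tr _]raddfB /= (mxtrace_mulC (A : M2)) subrr eqxx andbT.
rewrite [X in map_mx _ X]raddfB /= !trmx_mul map_mxB !map_mxM /= AN BN.
by rewrite !mulmxN !mulNmx !opprK opprB.
Qed.

Definition su2_bracket (A B : su2) := MkSu2 (su2_bracket_subproof A B).

Definition expmx (A : M2) : M2 :=
  lim (series (fun n => (n`!%:R)^-1 *: (A ^+ n : 'M[R[i]^o]_2)) @ \oo).

Let mx2P (A B : M2) : A 0 0 = B 0 0 -> A 0 1 = B 0 1 ->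
  A 1 0 = B 1 0 -> A 1 1 = B 1 1 -> A = B.
Proof.
move=> a b c d; apply/matrixP; case=> -[|[|//]] i; case=> -[|[|//]] j.
- by rewrite (_ : Ordinal i = 0) 1?(_ : Ordinal j = 0) //; apply: val_inj.
- by rewrite (_ : Ordinal i = 0) 1?(_ : Ordinal j = 1) //; apply: val_inj.
- by rewrite (_ : Ordinal i = 1) 1?(_ : Ordinal j = 0) //; apply: val_inj.
- by rewrite (_ : Ordinal i = 1) 1?(_ : Ordinal j = 1) //; apply: val_inj.
Qed.

Let det2 (A : M2) : \det A = A 0 0 * A 1 1 - A 0 1 * A 1 0.
Proof.
rewrite (expand_det_row _ 0) !big_ord_recl big_ord0 addr0 /cofactor.
rewrite !det_mx11 !mxE /= expr0 expr1 mul1r mulN1r mulrN.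
by congr (A _ _ * A _ _ - A _ _ * A _ _); apply: val_inj.
Qed.

Let mul2 (A B : M2) i j : (A *m B) i j = A i 0 * B 0 j + A i 1 * B 1 j.
Proof.
rewrite !mxE !big_ord_recl big_ord0 addr0.
by congr (_ * _ + A _ _ * B _ _); apply: val_inj.
Qed.

Let su2_coord (A : su2) : exists y p q : R,
  [/\ A 0 0 = 0 +i* y, A 1 1 = 0 -i* y, A 0 1 = p +i* q & A 1 0 = - p +i* q].
Proof.
have [AN A0] := su2P A.
have E i j : (A j i)^* = - A i j by have /matrixP/(_ i j) := AN; rewrite !mxE.
have := E 0 0; have := E 0 1.
move: A0; rewrite /mxtrace !big_ord_recl big_ord0 addr0.
rewrite (_ : lift _ _ = 1); last exact: val_inj.
case: (A 0 0) => x y; case: (A 1 1) => x' y'; case: (A 0 1) => p q.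
case: (A 1 0) => p' q' /eqP; rewrite eq_complex /= => /andP[/eqP xx' /eqP yy'].
move=> /eqP + /eqP; rewrite !eq_complex /=.
move=> /andP[/eqP pp' /eqP qq'] /andP[/eqP xx _].
have x0 : x = 0 by lra.
exists y, p, q; split => //; congr (_ +i* _); lra.
Qed.

(* By Cayley-Hamilton A ^+ 2 = - det A on su(2), with det A = th ^+ 2 >= 0. *)
Let su2_exp_cvg (A : M2) (th : R) : A *m A = - (th ^+ 2)%:C *: (1%:M : M2) ->
  (th = 0 -> A = 0 :> M2) ->
  expmx A = (cos th)%:C *: 1%:M + (sin th / th)%:C *: (A : M2).
Proof.
move=> AA A0.
have powA n : (n`!%:R)^-1 *: (A ^+ n : M2) =
  (cos_coeff th n)%:C *: 1%:M + (sin_coeff th n / th)%:C *: (A : M2).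
  have even k : (A ^+ k.*2 : M2) = ((-1) ^+ k * th ^+ k.*2)%:C *: 1%:M.
    elim: k => [|k IH]; first by rewrite !expr0 mul1r scale1r.
    rewrite doubleS !exprS mulrA IH -[A * A]/(A *m A) AA.
    rewrite -[_ * _]/(_ *m _) -scalemxAl mul1mx scalerA; congr (_ *: _).
    rewrite -rmorphN -rmorphM; congr (_%:C); ring.
  have fV : (n`!%:R)^-1 = (n`!%:R^-1)%:C :> R[i].
    by rewrite fmorphV rmorph_nat.
  rewrite fV /cos_coeff /sin_coeff /=.
  have /orP[/eqP ->|/eqP ->] : (n == n./2.*2) || (n == n./2.*2.+1).
  - have := odd_double_half n; case: (odd n) => /= E; apply/orP.
      by right; rewrite -{1}E.
    by left; rewrite -{1}E.
  - rewrite even odd_double doubleK scalerA -rmorphM !mul0r scale0r addr0.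
    by congr (_%:C *: _); rewrite mul1r mulrC.
  - rewrite /= odd_double doubleK /= !mul0r scale0r add0r mul1r.
    rewrite exprS even -[_ * _]/(_ *m _) -scalemxAr mulmx1.
    have [th0|th0] := eqVneq th 0; first by rewrite A0 // !scaler0.
    rewrite scalerA -rmorphM; congr (_%:C *: _).
    by rewrite exprS; field; rewrite th0 pnatr_eq0 -lt0n fact_gt0.
have RC (u : R^nat) (l : R) : u @ \oo --> l ->
    (fun n => (u n)%:C : R[i]^o) @ \oo --> (l%:C : R[i]^o).
  move=> ul; apply/cvgrPdist_lt => e e0.
  have [er e0'] : e = (complex.Re e)%:C /\ 0 < complex.Re e.
    by move: e0; case: e => a b; rewrite ltcE /= => /andP[/eqP -> ->].
  move/cvgrPdist_lt : ul => /(_ (complex.Re e) e0'); apply: filterS => n.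
  by rewrite er -rmorphB normc_def /= expr0n addr0 sqrtr_sqr ltcR.
have cvgS : series (fun n => (n`!%:R)^-1 *: (A ^+ n : 'M[R[i]^o]_2)) @ \oo -->
    ((cos th)%:C *: 1%:M + (sin th / th)%:C *: A : 'M[R[i]^o]_2).
  rewrite (_ : series _ = fun n => (series (cos_coeff th) n)%:C *: 1%:M +
      (series (sin_coeff th) n / th)%:C *: (A : 'M[R[i]^o]_2)); last first.
    apply/funext => n; rewrite /series /= (eq_bigr _ (fun i _ => powA i)).
    by rewrite big_split /= -!scaler_suml mulr_suml !rmorph_sum.
  apply: cvgD; apply: cvgZr_tmp; apply: RC.
    by rewrite unlock; exact: is_cvg_series_cos_coeff.
  by apply: cvgMr_tmp; rewrite unlock; exact: is_cvg_series_sin_coeff.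
exact: (cvg_lim (@norm_hausdorff _ 'M[R[i]^o]_2) cvgS).
Qed.

Lemma su2_exp_subproof (A : su2) :
  (expmx A \is unitarymx) && (\det (expmx A) == 1).
Proof.
have [y [p [q [a d b c]]]] := su2_coord A.
pose th := Num.sqrt (y ^+ 2 + p ^+ 2 + q ^+ 2).
have th2 : th ^+ 2 = y ^+ 2 + p ^+ 2 + q ^+ 2.
  by rewrite sqr_sqrtr // !addr_ge0 ?sqr_ge0.
have AA : (A : M2) *m A = - (th ^+ 2)%:C *: (1%:M : M2).
  apply: mx2P; rewrite mul2 !mxE ?a ?d ?b ?c th2;
    apply/eqP; rewrite eq_complex /=; apply/andP; split; apply/eqP => /=; ring.
have A0 : th = 0 -> (A : M2) = 0.
  move=> th0; have : y ^+ 2 + p ^+ 2 + q ^+ 2 = 0 by rewrite -th2 th0 expr0n.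
  move/eqP; rewrite !paddr_eq0 ?addr_ge0 ?sqr_ge0 // !sqrf_eq0.
  move=> /andP[/andP[/eqP y0 /eqP p0] /eqP q0].
  by apply: mx2P; rewrite mxE ?a ?b ?c ?d ?y0 ?p0 ?q0 ?oppr0.
rewrite (su2_exp_cvg AA A0); set s := sin th / th; set u := cos th.
have us : u ^+ 2 + s ^+ 2 * (y ^+ 2 + p ^+ 2 + q ^+ 2) = 1.
  rewrite -th2 -exprMn -(cos2Dsin2 th) /s; congr (_ + _ ^+ 2).
  by have [->|th0] := eqVneq th 0; rewrite ?sin0 ?mul0r// divfK.
apply/andP; split.
  apply/unitarymxP; apply: mx2P; rewrite mul2 !mxE ?a ?d ?b ?c /=;
    apply/eqP; rewrite eq_complex /=; apply/andP; split; apply/eqP => /=;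
    by [ring | apply: etrans us; ring].
rewrite [X in X == 1]det2 !mxE ?a ?d ?b ?c eq_complex /=.
by apply/andP; split; apply/eqP => /=; [apply: etrans us|]; ring.
Qed.

Definition su2_exp (A : su2) : SU2 R := MkSU2 (su2_exp_subproof A).

End su2.

Section SU2_smooth.
Variable R : realType.
Local Notation C := R[i].

(* The curve t |-> g exp(t A), whose derivative at 0 defines the left-invariant
   vector field associated with A; with this convention the commutator of
   vector fields is su2_bracket. *)
Definition translate (A : su2 R) (g : SU2 R) (t : R) : SU2 R :=
  SU2_mul g (su2_exp (su2_scale t A)).

Definition lie_derive (A : su2 R) (f : SU2 R -> C) (g : SU2 R) : C :=
  derive1 (fun t => complex.Re (f (translate A g t))) 0
    +i* derive1 (fun t => complex.Im (f (translate A g t))) 0.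

Definition iter_lie (s : seq (su2 R)) (f : SU2 R -> C) : SU2 R -> C :=
  foldr lie_derive f s.

(* All iterated derivatives along left-invariant vector fields, which span the
   tangent space at each point, exist and are continuous. *)
Definition is_smooth (f : SU2 R -> C) : Prop := forall s : seq (su2 R),
  continuous (iter_lie s f : SU2 R -> C^o) /\
  forall A g,
    derivable (fun t => complex.Re (iter_lie s f (translate A g t))) 0 1 /\
    derivable (fun t => complex.Im (iter_lie s f (translate A g t))) 0 1.

Definition smooth_pred : {pred SU2 R -> C} := fun f => `[< is_smooth f >].

Let ReZ (a z : C) : complex.Re (a * z) =
  complex.Re a * complex.Re z - complex.Im a * complex.Im z.
Proof. by case: a z => ? ? []. Qed.
Let ImZ (a z : C) : complex.Im (a * z) =
  complex.Re a * complex.Im z + complex.Im a * complex.Re z.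
Proof. by case: a z => ? ? []. Qed.
Let ReD (x y : C) : complex.Re (x + y) = complex.Re x + complex.Re y.
Proof. by case: x y => ? ? []. Qed.
Let ImD (x y : C) : complex.Im (x + y) = complex.Im x + complex.Im y.
Proof. by case: x y => ? ? []. Qed.

Let derivable_comb (f f' h : R -> R) (a b : R) :
  derivable f 0 1 -> derivable f' 0 1 -> derivable h 0 1 ->
  derivable (fun t => a * f t + b * f' t + h t) 0 1 /\
  derive1 (fun t => a * f t + b * f' t + h t) 0 =
    a * derive1 f 0 + b * derive1 f' 0 + derive1 h 0.
Proof.
move=> df df' dh.
have -> : (fun t => a * f t + b * f' t + h t) = (a *: f + b *: f') + h.
  by apply/funext => t; rewrite !fctE.
have da : derivable (a *: f) 0 1 by exact: derivableZ.
have db : derivable (b *: f') 0 1 by exact: derivableZ.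
have dab : derivable (a *: f + b *: f') 0 1 by exact: derivableD.
split; first exact: derivableD.
rewrite !derive1E (deriveD dab dh) (deriveD da db).
by rewrite (deriveZ _ df) (deriveZ _ df').
Qed.

Lemma lie_derive_linear A (a : C) (f h : SU2 R -> C) g :
  derivable (fun t => complex.Re (f (translate A g t))) 0 1 ->
  derivable (fun t => complex.Im (f (translate A g t))) 0 1 ->
  derivable (fun t => complex.Re (h (translate A g t))) 0 1 ->
  derivable (fun t => complex.Im (h (translate A g t))) 0 1 ->
  [/\ derivable (fun t => complex.Re ((a *: f + h) (translate A g t))) 0 1,
      derivable (fun t => complex.Im ((a *: f + h) (translate A g t))) 0 1 &
      lie_derive A (a *: f + h) g = a * lie_derive A f g + lie_derive A h g].
Proof.
move=> fR fI hR hI.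
have ER : (fun t => complex.Re ((a *: f + h) (translate A g t))) =
  (fun t => complex.Re a * complex.Re (f (translate A g t))
    + (- complex.Im a) * complex.Im (f (translate A g t))
    + complex.Re (h (translate A g t))).
  by apply/funext => t; rewrite !fctE ReD ReZ mulNr.
have EI : (fun t => complex.Im ((a *: f + h) (translate A g t))) =
  (fun t => complex.Re a * complex.Im (f (translate A g t))
    + complex.Im a * complex.Re (f (translate A g t))
    + complex.Im (h (translate A g t))).
  by apply/funext => t; rewrite !fctE ImD ImZ.
have [dR eR] := derivable_comb (complex.Re a) (- complex.Im a) fR fI hR.
have [dI eI] := derivable_comb (complex.Re a) (complex.Im a) fI fR hI.
rewrite /lie_derive ER EI; split => //; rewrite eR eI.
by apply/eqP; rewrite eq_complex !(ReD, ImD, ReZ, ImZ) /= mulNr !eqxx.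
Qed.

Lemma iter_lie_linear s (a : C) (f h : SU2 R -> C) :
  is_smooth f -> is_smooth h ->
  iter_lie s (a *: f + h) = a *: iter_lie s f + iter_lie s h.
Proof.
move=> sf sh; elim: s => [//|A s /= ->]; apply/funext => g.
have [_ /(_ A g)[fR fI]] := sf s; have [_ /(_ A g)[hR hI]] := sh s.
by have [_ _] := lie_derive_linear a fR fI hR hI.
Qed.

Lemma iter_lie0 s : iter_lie s 0 = 0.
Proof.
elim: s => [//|A s /= ->]; apply/funext => g.
by rewrite /lie_derive !derive1_cst.
Qed.

Lemma smooth_submod_closed : submod_closed smooth_pred.
Proof.
split.
  apply/asboolP => s; rewrite iter_lie0; split; first exact: cst_continuous.
  by move=> A g; split; exact: derivable_cst.
move=> a f h /asboolP sf /asboolP sh; apply/asboolP => s.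
rewrite iter_lie_linear //; have [cf df] := sf s; have [ch dh] := sh s.
split.
  move=> g; apply: (@continuousD _ C^o); last exact: ch.
  by apply: (@continuousZl_tmp _ C^o); exact: cf.
move=> A g; have [fR fI] := df A g; have [hR hI] := dh A g.
by have [] := lie_derive_linear a fR fI hR hI.
Qed.

HB.instance Definition _ := GRing.isSubmodClosed.Build C (SU2 R -> C)
  smooth_pred smooth_submod_closed.

Record SU2_smooth := MkSmooth {
  smooth_fun :> SU2 R -> C;
  _ : smooth_fun \in smooth_pred }.

HB.instance Definition _ := [isSub for smooth_fun].
HB.instance Definition _ := [Choice of SU2_smooth by <:].
HB.instance Definition _ := [SubChoice_isSubLmodule of SU2_smooth by <:].

Lemma smoothP (f : SU2_smooth) : is_smooth f.
Proof. by case: f => f /= /asboolP. Qed.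

Lemma smooth_lie_subproof A (f : SU2_smooth) : lie_derive A f \in smooth_pred.
Proof.
apply/asboolP => s; rewrite (_ : iter_lie s _ = iter_lie (rcons s A) f).
  exact: smoothP.
by rewrite /iter_lie foldr_rcons.
Qed.

Definition smooth_lie (A : su2 R) (f : SU2_smooth) : SU2_smooth :=
  MkSmooth (smooth_lie_subproof A f).

Lemma smooth_lie_linear A : linear (smooth_lie A).
Proof.
move=> a f h; apply/val_inj/funext => g /=.
have [_ /(_ A g)[fR fI]] := smoothP f [::].
have [_ /(_ A g)[hR hI]] := smoothP h [::].
by have [_ _] := lie_derive_linear a fR fI hR hI.
Qed.

Definition smooth_seminorm (s : seq (su2 R)) (f : SU2_smooth) : \bar R :=
  ereal_sup [set (Normc.normc (iter_lie s f g))%:E | g in [set: SU2 R]].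

(* Continuity for the Frechet topology of C^oo(SU(2)), which is defined by the
   seminorms smooth_seminorm s. *)
Definition is_distribution (u : SU2_smooth -> C) : Prop :=
  scalar u /\
  exists (S : seq (seq (su2 R))) (K : R), 0 <= K /\ forall f : SU2_smooth,
    ((Normc.normc (u f))%:E <= K%:E * \sum_(s <- S) smooth_seminorm s f)%E.

Definition distribution_pred : {pred SU2_smooth -> C} :=
  fun u => `[< is_distribution u >].

Lemma smooth_seminorm_ge0 s f : (0 <= smooth_seminorm s f)%E.
Proof.
apply: (@le_trans _ _ (Normc.normc (iter_lie s f point))%:E).
  by rewrite lee_fin; case: iter_lie => a b /=; exact: sqrtr_ge0.
by apply: ereal_sup_ubound; exists point.
Qed.

Let normcE (z : C) : `|z| = (Normc.normc z)%:C. Proof. by []. Qed.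
Let normc_ge0 (z : C) : 0 <= Normc.normc z.
Proof. by case: z => a b; exact: sqrtr_ge0. Qed.

Let normcD (x y : C) :
  Normc.normc (x + y) <= Normc.normc x + Normc.normc y.
Proof. by have := ler_normD x y; rewrite !normcE -rmorphD lecR. Qed.

Lemma distribution_submod_closed : submod_closed distribution_pred.
Proof.
split.
  apply/asboolP; split; first by move=> a f h /=; rewrite mulr0 addr0.
  exists [::], 0; split => // f.
  by rewrite big_nil mule0 lee_fin Normc.normc0.
move=> a u v /asboolP[lu [S [K [K0 uS]]]] /asboolP[lv [S' [K' [K0' vS]]]].
apply/asboolP; split.
  have E (b x y z w : C) :
    a * (b * x + y) + (b * z + w) = b * (a * x + z) + (a * y + w) by ring.
  by move=> b f h; rewrite !fctE lu lv; exact: E.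
exists (S ++ S'), (Normc.normc a * K + K'); split.
  by rewrite addr_ge0 // mulr_ge0 // normc_ge0.
move=> f; rewrite big_cat /= !fctE.
set p := (\sum_(s <- S) _)%E; set q := (\sum_(s <- S') _)%E.
have p0 : (0 <= p)%E by apply: sume_ge0 => ? _; exact: smooth_seminorm_ge0.
have q0 : (0 <= q)%E by apply: sume_ge0 => ? _; exact: smooth_seminorm_ge0.
have aK : 0 <= Normc.normc a * K by rewrite mulr_ge0 // normc_ge0.
apply: (@le_trans _ _ ((Normc.normc (a * u f))%:E + (Normc.normc (v f))%:E)%E).
  by rewrite -EFinD lee_fin normcD.
rewrite EFinD ge0_muleDl ?lee_fin //; apply: leeD.
  rewrite Normc.normcM EFinM (@le_trans _ _ ((Normc.normc a * K)%:E * p)%E) //.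
    by rewrite EFinM -muleA lee_wpmul2l ?lee_fin ?normc_ge0 ?uS.
  by apply: lee_wpmul2l; rewrite ?lee_fin // leeDl.
apply: (le_trans (vS f)); apply: lee_wpmul2l; rewrite ?lee_fin //.
by rewrite leeDr.
Qed.

HB.instance Definition _ := GRing.isSubmodClosed.Build C (SU2_smooth -> C)
  distribution_pred distribution_submod_closed.

Record SU2_distribution := MkDistribution {
  distribution_fun :> SU2_smooth -> C;
  _ : distribution_fun \in distribution_pred }.

HB.instance Definition _ := [isSub for distribution_fun].
HB.instance Definition _ := [Choice of SU2_distribution by <:].
HB.instance Definition _ := [SubChoice_isSubLmodule of SU2_distribution by <:].

Lemma distributionP (u : SU2_distribution) : is_distribution u.
Proof. by case: u => u /= /asboolP. Qed.

(* Left-invariant vector fields are skew-symmetric for the Haar measure, so that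
   this extends smooth_lie to distributions. *)
Lemma distribution_lie_subproof A (u : SU2_distribution) :
  (fun f => - u (smooth_lie A f)) \in distribution_pred.
Proof.
have [lu [S [K [K0 uS]]]] := distributionP u; apply/asboolP; split.
  by move=> a f h; rewrite smooth_lie_linear lu opprD /= mulrN.
exists [seq rcons s A | s <- S], K; split => // f.
rewrite (_ : Normc.normc (- _) = Normc.normc (u (smooth_lie A f))); last first.
  by case: (u _) => a b /=; rewrite !sqrrN.
rewrite big_map; apply: (le_trans (uS _)).
rewrite le_eqVlt; apply/orP; left; apply/eqP; congr (_ * _)%E.
apply: eq_bigr => s _; rewrite /smooth_seminorm; congr ereal_sup.
by apply: eq_imagel => g _ /=; rewrite /iter_lie foldr_rcons.
Qed.

Definition distribution_lie (A : su2 R) (u : SU2_distribution) :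
    SU2_distribution :=
  MkDistribution (distribution_lie_subproof A u).
End SU2_smooth.

Section analysis.
Variable R : realType.
Local Notation C := R[i].

(* ad A \o ad B is traced over all 2 x 2 complex matrices, that is over the
   direct sum of the complexification of su(2) and the scalar matrices. The
   latter contribute 0, so this is the Killing form of su(2). *)
Definition killing (A B : su2 R) : C :=
  let ad (D : 'M[C]_2) (M : 'M[C]_2) := D *m M - M *m D in
  \tr (lin_mx (ad A \o ad B)).

(* An orthonormal triple is automatically a basis of the 3-dimensional
   space su(2). *)
Definition su2_frame (X Y Z : su2 R) : Prop :=
  Z = su2_bracket X Y /\
  exists c : R, 0 < c /\ forall i j : 'I_3,
    let e := tnth [tuple X; Y; Z] in
    - c%:C * killing (e i) (e j) = (i == j)%:R.

Definition laplacian (X Y Z : su2 R) (f : SU2_smooth R) : SU2_smooth R :=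
  - smooth_lie X (smooth_lie X f) - smooth_lie Y (smooth_lie Y f)
  - smooth_lie Z (smooth_lie Z f).

Definition sub_laplacian (X Y : su2 R) (u : SU2_distribution R) :
    SU2_distribution R :=
  distribution_lie X (distribution_lie X u) +
  distribution_lie Y (distribution_lie Y u).

Definition heat_operator (X Y Z : su2 R) (u : SU2_distribution R) :
    SU2_distribution R :=
  distribution_lie Z u - sub_laplacian X Y u.

(* v = (1 + L)^(b/2) u in the sense of the spectral calculus of L, extended to
   distributions by duality: L is symmetric for the bilinear pairing, its
   eigenvalues are real and nonnegative (the equation below only has f = 0 as
   solution when l is not an eigenvalue), and its smooth eigenfunctions span a
   dense subspace of the smooth functions, so that v is determined by u. *)
Definition is_bessel (X Y Z : su2 R) (b : R)
    (u v : SU2_distribution R) : Prop :=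
  forall (l : R) (f : SU2_smooth R), laplacian X Y Z f = l%:C *: f ->
    v f = ((1 + l) `^ (b / 2))%:C * u f.

Definition bessel (X Y Z : su2 R) (b : R) (u : SU2_distribution R) :
    SU2_distribution R :=
  xget 0 [set v | is_bessel X Y Z b u v].

Definition is_haar (mu : probability (SU2 R) R) : Prop :=
  forall (g : SU2 R) (A : set (SU2 R)), measurable A ->
    mu (SU2_mul g @` A) = mu A.

Variable mu : probability (SU2 R) R.

(* f is integrable and u is the distribution phi |-> \int f phi. Since mu is
   finite, all functions in L^p, 1 <= p <= oo, are integrable. *)
Definition represents (f : SU2 R -> C) (u : SU2_distribution R) : Prop :=
  [/\ mu.-integrable setT (fun x => (complex.Re (f x))%:E),
      mu.-integrable setT (fun x => (complex.Im (f x))%:E) &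
      forall phi : SU2_smooth R,
        u phi = Rintegral mu setT (fun x => complex.Re (f x * phi x))
                  +i* Rintegral mu setT (fun x => complex.Im (f x * phi x))].

(* The norms of a distribution are those of the function representing it,
   which is unique up to a null set, and +oo if there is no such function. *)
Definition distribution_norm (N : (SU2 R -> C) -> \bar R)
    (u : SU2_distribution R) : \bar R :=
  ereal_inf [set N f | f in [set f | represents f u]].

Definition Lp_norm (p : \bar R) : SU2_distribution R -> \bar R :=
  distribution_norm (fun f => Lnorm mu p (fun x => (Normc.normc (f x))%:E)).

Definition weak_L1_norm : SU2_distribution R -> \bar R :=
  distribution_norm (fun f => ereal_sup
    [set (a%:E * mu [set x | (a < Normc.normc (f x))%R])%E
      | a in [set a : R | 0 < a]]).

Definition sobolev_norm (X Y Z : su2 R) (p : \bar R) (b : R)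
    (u : SU2_distribution R) : \bar R :=
  Lp_norm p (bessel X Y Z b u).

End analysis.

(* Main.v *)
Require Import Defs.
From HB Require Import structures.
From mathcomp Require Import all_boot all_order all_algebra.
From mathcomp Require Import complex.
From mathcomp Require Import all_classical all_reals all_analysis.
From mathcomp Require Import measurable_realfun.
From mathcomp Require Import ring lra.

(** Write L for the Laplacian and W = 1 + L. On test functions the operator acts, by
    transposition, as a sign times T = - X^2 - Y^2 + ka Z. Away from the constants
    the inverse of T gains much more than the operator W^(1/8) that the order - 1/4
    costs. This room makes singular integrals unnecessary: the estimate holds with
    the L^1 norm of u, which bounds the weak L^1 norm by Chebyshev's inequality
    ([weak_le]).

    The calculus takes place on polynomials in the matrix entries. Each of them is a
    finite sum of joint eigenfunctions of L and Z ([pol_decomposition]), on which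
    functions of L and Z act by scalars. Polynomials are dense in the continuous and
    in the integrable functions ([pol_dense], [pol_dense_mean]), and smooth functions
    are limits of polynomials together with all derivatives ([mollifiers]), so that
    a distribution is determined by its values on polynomials.

    The analytic core is the bound of the maximum norm of W^(1/8) p by that of T p,
    for p of mean zero ([eighth_bound]). It rests on maximum principles.
    Bernstein's method bounds the derivatives of q = e^(- t T) p along X and Y by
    t^(-1/2) and along Z = [X, Y] by t^(-1) ([bernstein]). For a fixed large t the
    oscillation of q is therefore at most half the norm of p, while q - p is bounded
    by t |T p|; this gives a Poincare inequality ([poincare]). For small t the bound
    t |T p| for q - p is interpolated with the bound t^(-2) |T p| for W q: between
    the times 16^(-j) and 16^(-j-1) the increment of W^(1/4) q is of the
    order 2^(-j), and the sum over j converges ([quarter_bound]). The interpolation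
    inequality ([landau_kolmogorov]) needs that W^(2^-k) is accretive in the maximum
    norm; this holds for W by the maximum principle and passes to square roots by
    solving v'' = b(L) v on a half line ([accretive_sqrt]). Accretivity also shows
    that the negative powers of W are contractions ([bessel_contraction]), from which
    Bessel potentials of distributions are obtained ([bessel_exists]).

    Duality turns the bound of W^(1/8) T^(-1) in the maximum norm into a bound of its
    transpose in L^1 ([transpose_mean]); the transpose is given by the same symbol
    with the opposite weight of Z, because integrals of left-invariant derivatives
    vanish ([mult_orthogonal], [int_lie0]). For a measure that is invariant under left
    translations the latter uses invariance under right translations, which follows
    from invariance under inversion ([haar_inv], [haar_right]). If f0 represents
    W^(-1/8) applied to the image of u under the operator, and k is the image of f0
    under the transpose, then u is represented by the sum of the constant u(1) and of
    k up to sign. Finally u(1) is the mean value of the function representing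
    W^(-N/2) u, because W fixes the constants ([norm_bound]). *)

Set Implicit Arguments.
Unset Strict Implicit.
Unset Printing Implicit Defensive.

Import Order.TTheory GRing.Theory Num.Theory.
Import numFieldNormedType.Exports.

Local Open Scope classical_set_scope.
Local Open Scope complex_scope.
Local Open Scope sesquilinear_scope.
Local Open Scope ring_scope.

Notation nm := Normc.normc.

(** * Complex numbers and derivatives of complex curves *)

Section complex_curves.
Variable R : realType.
Local Notation C := R[i].
Implicit Types (z w : C) (f h : R -> C).

Lemma Re_mul z w : complex.Re (z * w) =
  complex.Re z * complex.Re w - complex.Im z * complex.Im w.
Proof. by case: z w => ? ? []. Qed.

Lemma Im_mul z w : complex.Im (z * w) =
  complex.Re z * complex.Im w + complex.Im z * complex.Re w.
Proof. by case: z w => ? ? []. Qed.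

Lemma Re_add z w : complex.Re (z + w) = complex.Re z + complex.Re w.
Proof. by case: z w => ? ? []. Qed.

Lemma Im_add z w : complex.Im (z + w) = complex.Im z + complex.Im w.
Proof. by case: z w => ? ? []. Qed.

Lemma Re_opp z : complex.Re (- z) = - complex.Re z.
Proof. by case: z. Qed.

Lemma Im_opp z : complex.Im (- z) = - complex.Im z.
Proof. by case: z. Qed.

Lemma Re_sum (I : finType) (F : I -> C) :
  complex.Re (\sum_i F i) = \sum_i complex.Re (F i).
Proof. by elim/big_rec2: _ => [//|i x y _ <-]; rewrite Re_add. Qed.

Lemma Im_sum (I : finType) (F : I -> C) :
  complex.Im (\sum_i F i) = \sum_i complex.Im (F i).
Proof. by elim/big_rec2: _ => [//|i x y _ <-]; rewrite Im_add. Qed.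

Definition cReE := (Re_mul, Re_add, Re_opp).
Definition cImE := (Im_mul, Im_add, Im_opp).

Lemma complexP z w :
  complex.Re z = complex.Re w -> complex.Im z = complex.Im w -> z = w.
Proof. by case: z w => a b [c d] /= -> ->. Qed.

Lemma complexRI z : z = complex.Re z +i* complex.Im z.
Proof. by case: z. Qed.

Lemma nmE z : `|z| = (nm z)%:C. Proof. by []. Qed.

Lemma nm_ge0 z : 0 <= nm z.
Proof. by case: z => a b; exact: sqrtr_ge0. Qed.

Lemma nmD z w : nm (z + w) <= nm z + nm w.
Proof. by have := ler_normD z w; rewrite !nmE -rmorphD lecR. Qed.

Lemma nmM z w : nm (z * w) = nm z * nm w.
Proof. exact: Normc.normcM. Qed.

Lemma nmN z : nm (- z) = nm z.
Proof. by case: z => a b /=; rewrite !sqrrN. Qed.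

Lemma nmB z w : nm (z - w) <= nm z + nm w.
Proof. by rewrite (le_trans (nmD _ _)) // nmN. Qed.

Lemma nm_distC z w : nm (z - w) = nm (w - z).
Proof. by rewrite -nmN opprB. Qed.

Lemma nm0 : nm (0 : C) = 0. Proof. exact: Normc.normc0. Qed.

Lemma nm_real (x : R) : nm x%:C = `|x|.
Proof. by rewrite /= expr0n addr0 sqrtr_sqr. Qed.

Lemma nm_sqr z : nm z ^+ 2 = complex.Re z ^+ 2 + complex.Im z ^+ 2.
Proof. by case: z => a b /=; rewrite sqr_sqrtr // addr_ge0 // sqr_ge0. Qed.

Lemma nm_sum (I : finType) (F : I -> C) : nm (\sum_i F i) <= \sum_i nm (F i).
Proof.
elim/big_rec2: _ => [|i x y _ yx]; first by rewrite nm0.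
by rewrite (le_trans (nmD _ _)) // lerD2l.
Qed.

Lemma nm_eq0 z : nm z = 0 -> z = 0. Proof. exact: Normc.eq0_normc. Qed.

Lemma ler_Re_nm z : `|complex.Re z| <= nm z.
Proof.
rewrite -(ler_pXn2r (n := 2)) ?nnegrE ?nm_ge0 //.
by rewrite nm_sqr real_normK ?num_real // lerDl sqr_ge0.
Qed.

Lemma ler_Im_nm z : `|complex.Im z| <= nm z.
Proof.
rewrite -(ler_pXn2r (n := 2)) ?nnegrE ?nm_ge0 //.
by rewrite nm_sqr real_normK ?num_real // lerDr sqr_ge0.
Qed.

Lemma ler_nm_ReIm z : nm z <= `|complex.Re z| + `|complex.Im z|.
Proof.
rewrite -(ler_pXn2r (n := 2)) ?nnegrE ?nm_ge0 ?addr_ge0 //.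
rewrite nm_sqr sqrrD !real_normK ?num_real //.
rewrite lerD2r lerDl mulrn_wge0 // mulr_ge0 //.
Qed.

(** A complex number is bounded as soon as all its rotations have bounded real
    part; this reduces mean value estimates to real functions. *)
Lemma ler_nm_rot z (B : R) : 0 <= B ->
  (forall c : C, nm c = 1 -> complex.Re (c * z) <= B) -> nm z <= B.
Proof.
move=> B0 H; have [->|z0] := eqVneq z 0; first by rewrite nm0.
have n0 : nm z != 0 by apply: contra_neq z0 => /nm_eq0.
have np : 0 < nm z by rewrite lt_def n0 nm_ge0.
have := H ((complex.Re z / nm z) -i* (complex.Im z / nm z)).
rewrite Re_mul /= mulNr opprK => h; have := nm_sqr z.
set x := complex.Re z in h *; set y := complex.Im z in h * => E.
suff <- : x / nm z * x + y / nm z * y = nm z.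
  apply: h; rewrite sqrrN !expr_div_n -mulrDl -E divff ?sqrtr1 //.
  by rewrite expf_neq0.
by apply: (mulIf n0); rewrite -expr2 E; field.
Qed.

(** Differentiability by components, as in the definition of the derivative along
    a left-invariant vector field. *)
Definition isCd (f : R -> C) (t : R) (l : C) : Prop :=
  is_derive t 1 (fun s => complex.Re (f s)) (complex.Re l) /\
  is_derive t 1 (fun s => complex.Im (f s)) (complex.Im l).

Lemma is_derive_cstE (x v c : R) : is_derive x v (fun=> c) 0.
Proof. exact: is_derive_cst. Qed.

Lemma is_deriveDE (f g : R -> R) (x a b : R) : is_derive x 1 f a ->
  is_derive x 1 g b -> is_derive x 1 (fun t => f t + g t) (a + b).
Proof. by move=> fa gb; exact: (@is_deriveD _ _ _ f g). Qed.

Lemma is_deriveME (f g : R -> R) (x a b : R) : is_derive x 1 f a ->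
  is_derive x 1 g b -> is_derive x 1 (fun t => f t * g t) (a * g x + f x * b).
Proof.
move=> fa gb; apply: (is_derive_eq (@is_deriveM _ _ f g x 1 a b fa gb)).
by rewrite /GRing.scale /=; ring.
Qed.

Lemma is_deriveNE (f : R -> R) (x a : R) : is_derive x 1 f a ->
  is_derive x 1 (fun t => - f t) (- a).
Proof. by move=> fa; exact: (@is_deriveN _ _ _ f). Qed.

Lemma isCd_cst c t : isCd (fun=> c) t 0.
Proof. by split; exact: is_derive_cst. Qed.

Lemma isCdD f h t l k : isCd f t l -> isCd h t k ->
  isCd (fun s => f s + h s) t (l + k).
Proof.
move=> [fr fi] [hr hi]; split.
  rewrite (_ : (fun s => _) = (fun s => complex.Re (f s) + complex.Re (h s))).
    by rewrite Re_add; exact: is_deriveDE.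
  by apply/funext => s; rewrite Re_add.
rewrite (_ : (fun s => _) = (fun s => complex.Im (f s) + complex.Im (h s))).
  by rewrite Im_add; exact: is_deriveDE.
by apply/funext => s; rewrite Im_add.
Qed.

Lemma isCdM f h t l k : isCd f t l -> isCd h t k ->
  isCd (fun s => f s * h s) t (l * h t + f t * k).
Proof.
move=> [fr fi] [hr hi]; split.
  rewrite (_ : (fun s => _) = (fun s => complex.Re (f s) * complex.Re (h s) +
     - (complex.Im (f s) * complex.Im (h s)))).
    apply: (is_derive_eq (is_deriveDE (is_deriveME fr hr)
      (is_deriveNE (is_deriveME fi hi)))).
    by rewrite !cReE; ring.
  by apply/funext => s; rewrite Re_mul.
rewrite (_ : (fun s => _) = (fun s => complex.Re (f s) * complex.Im (h s) +
   (complex.Im (f s) * complex.Re (h s)))).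
  apply: (is_derive_eq (is_deriveDE (is_deriveME fr hi) (is_deriveME fi hr))).
  by rewrite !cImE; ring.
by apply/funext => s; rewrite Im_mul.
Qed.

Lemma isCd_eq f t l k : isCd f t l -> l = k -> isCd f t k.
Proof. by move=> + <-. Qed.

Lemma isCdZ (c : C) f t l : isCd f t l -> isCd (fun s => c * f s) t (c * l).
Proof.
by move=> fl; apply: (isCd_eq (isCdM (isCd_cst c t) fl)); rewrite mul0r add0r.
Qed.

Lemma isCd_sum (I : finType) (F : I -> R -> C) (L : I -> C) t :
  (forall i, isCd (F i) t (L i)) ->
  isCd (fun s => \sum_i F i s) t (\sum_i L i).
Proof.
move=> H; rewrite /index_enum; elim: (Finite.enum I) => [|i r IH].
  rewrite big_nil (_ : (fun s => _) = fun=> 0); first exact: isCd_cst.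
  by apply/funext => s; rewrite big_nil.
rewrite big_cons (_ : (fun s => _) = fun s => F i s + \sum_(j <- r) F j s).
  exact: isCdD.
by apply/funext => s; rewrite big_cons.
Qed.

Lemma isCd_sqr f t l : isCd f t l ->
  is_derive t 1 (fun s => nm (f s) ^+ 2)
    (2 * (complex.Re (f t) * complex.Re l + complex.Im (f t) * complex.Im l)).
Proof.
move=> [fr fi]; rewrite (_ : (fun s => _) = (fun s =>
    complex.Re (f s) * complex.Re (f s) + complex.Im (f s) * complex.Im (f s))).
  apply: (is_derive_eq (is_deriveDE (is_deriveME fr fr) (is_deriveME fi fi))).
  by ring.
by apply/funext => s; rewrite nm_sqr !expr2.
Qed.

(** The real pairing Re (z conj w), which polarises the squared modulus. *)
Definition dot z w := complex.Re z * complex.Re w + complex.Im z * complex.Im w.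

Lemma dotDr z w k : dot z (w + k) = dot z w + dot z k.
Proof. by rewrite /dot !cReE !cImE; ring. Qed.
Lemma dotNr z w : dot z (- w) = - dot z w.
Proof. by rewrite /dot !cReE !cImE; ring. Qed.
Lemma dotZr z (a : R) w : dot z (a%:C * w) = a * dot z w.
Proof. by rewrite /dot !cReE !cImE /=; ring. Qed.
Lemma dotxx z : dot z z = nm z ^+ 2. Proof. by rewrite nm_sqr /dot !expr2. Qed.

Lemma ler_dot z w : dot z w <= nm z * nm w.
Proof.
apply: (le_trans (ler_norm _)).
rewrite -(ler_pXn2r (n := 2)) ?nnegrE ?mulr_ge0 ?nm_ge0 //.
rewrite real_normK ?num_real // exprMn !nm_sqr /dot -subr_ge0.
set a := complex.Re z; set b := complex.Im z; set c := complex.Re w.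
set d := complex.Im w.
by rewrite (_ : _ - _ = (a * d - b * c) ^+ 2) ?sqr_ge0 //; ring.
Qed.

Lemma isCd_dot f h t l k : isCd f t l -> isCd h t k ->
  is_derive t 1 (fun s => dot (f s) (h s)) (dot l (h t) + dot (f t) k).
Proof.
move=> [fr fi] [hr hi].
apply: (is_derive_eq (is_deriveDE (is_deriveME fr hr) (is_deriveME fi hi))).
by rewrite /dot; ring.
Qed.

Lemma is_derive_compE (f g : R -> R) (x a b : R) : is_derive x 1 f a ->
  is_derive (f x) 1 g b -> is_derive x 1 (fun t => g (f t)) (b * a).
Proof.
move=> [df fa] [dg gb].
have D : derivable (g \o f) x 1.
  apply/derivable1_diffP; apply: differentiable_comp.
    by apply/derivable1_diffP; exact: df.
  by apply/derivable1_diffP; exact: dg.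
have E : 'D_1 (g \o f) x = b * a.
  by rewrite -(derive1E (g \o f)) (derive1_comp df dg) !derive1E gb fa.
exact: (DeriveDef D E).
Qed.

Lemma is_derive_affine (a b x : R) : is_derive x 1 (fun t => a * t + b) a.
Proof.
have := is_deriveDE (is_deriveME (is_derive_cstE x 1 a) (is_derive_id x 1))
  (is_derive_cstE x 1 b).
by move/is_derive_eq; apply; rewrite mul0r add0r mulr1 addr0.
Qed.

Lemma isCd_affine f (a b t : R) l : isCd f (a * t + b) l ->
  isCd (fun s => f (a * s + b)) t (a%:C * l).
Proof.
move=> [fr fi]; have d := is_derive_affine a b t; split.
  have := is_derive_compE d fr; move/is_derive_eq; apply.
  by rewrite Re_mul /= mul0r subr0 mulrC.
have := is_derive_compE d fi; move/is_derive_eq; apply.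
by rewrite Im_mul /= mul0r addr0 mulrC.
Qed.

Lemma derivable_cvg (f : R -> R) (x a : R) : is_derive x 1 f a ->
  {for x, continuous f}.
Proof.
by move=> [d _]; apply/differentiable_continuous/derivable1_diffP.
Qed.

(** The mean value theorem holds for the real part of each rotated curve c f. *)
Lemma isCd_mvt f (df : R -> C) (a b B : R) : a <= b -> 0 <= B ->
  (forall t, a <= t <= b -> isCd f t (df t) /\ nm (df t) <= B) ->
  nm (f b - f a) <= B * (b - a).
Proof.
move=> ab B0 H; apply: ler_nm_rot; first by rewrite mulr_ge0 // subr_ge0.
move=> c c1.
have D t : a <= t <= b ->
    is_derive t 1 (fun s => complex.Re (c * f s)) (complex.Re (c * df t)).
  by move=> /H[/(isCdZ c)[]].
have [x xab E] : exists2 x, x \in `[a, b]%R &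
    complex.Re (c * f b) - complex.Re (c * f a) = complex.Re (c * df x) * (b - a).
  apply: (@MVT_segment R (fun s => complex.Re (c * f s))
    (fun t => complex.Re (c * df t))) => //.
    by move=> x; rewrite in_itv /= => /andP[? ?]; apply: D; rewrite !ltW.
  apply: continuous_in_subspaceT => x; rewrite inE /= in_itv /= => xab.
  exact: (derivable_cvg (D x xab)).
rewrite mulrBr Re_add Re_opp E; apply: ler_wpM2r; first by rewrite subr_ge0.
apply: (le_trans (ler_norm _)); apply: (le_trans (ler_Re_nm _)).
by rewrite nmM c1 mul1r; move: xab; rewrite in_itv /= => /H[].
Qed.

(** If c were positive, F' would be positive to the right of its zero x, and F
    would exceed F x there. *)
Lemma max_derive2 (F F' : R -> R) (x c e : R) : 0 < e ->
  (forall t, x - e < t < x + e -> is_derive t 1 F (F' t)) ->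
  is_derive x 1 F' c ->
  (forall t, x - e < t < x + e -> F t <= F x) -> F' x = 0 /\ c <= 0.
Proof.
move=> e0 dF dF' mx.
have xin : x \in `](x - e), (x + e)[%R by rewrite in_itv /= ltrBlDr !ltrDl e0.
have F'0 : F' x = 0.
  have := @derive1_at_max R F (x - e) (x + e) x.
  case.
  - lra.
  - by move=> t; rewrite in_itv /= => /dF[].
  - by [].
  - by move=> t; rewrite in_itv /= => /mx.
  - move=> _ E; have [_ E'] : is_derive x 1 F (F' x) by apply: dF; lra.
    by rewrite -E' E.
split=> //; rewrite leNgt; apply/negP => c0.
have [d [d0 de Hd]] : exists d, [/\ 0 < d, d <= e &
    forall t, 0 < t < d -> 0 < F' (x + t)].
  have [+ E] := dF'.
  move=> D; have {D E} : (fun h : R => h^-1 *: (F' (h *: 1 + x) - F' x)) @ 0^' --> c.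
    by rewrite -E; exact: D.
  move=> /cvgrPdist_lt /(_ _ c0) [d /= d0 Hd].
  exists (Num.min d e); split; first by rewrite lt_min d0.
    by rewrite ge_min lexx orbT.
  move=> t /andP[t0]; rewrite lt_min => /andP[td _].
  have := Hd t; rewrite /= sub0r normrN gtr0_norm // => /(_ td).
  have tn0 : t != 0 by rewrite gt_eqF.
  move=> /(_ tn0); rewrite F'0 subr0 /GRing.scale /= mulr1 => H.
  have : 0 < t^-1 * F' (t + x) by move: H; rewrite ltr_norml; lra.
  by rewrite pmulr_rgt0 ?invr_gt0 // addrC.
have [z] : exists2 z, z \in `]x, (x + d / 2)[%R &
    F (x + d / 2) - F x = F' z * (x + d / 2 - x).
  apply: MVT; first lra.
    by move=> t; rewrite in_itv /= => /andP[? ?]; apply: dF; lra.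
  apply: continuous_in_subspaceT => t; rewrite inE /= in_itv /= => /andP[? ?].
  by apply: (derivable_cvg (dF t _)); lra.
rewrite in_itv /= => /andP[z1 z2] E.
have : 0 < F' (x + (z - x)) by apply: Hd; lra.
rewrite addrC subrK => Fz; have : F (x + d / 2) <= F x by apply: mx; lra.
rewrite -subr_le0 E leNgt => /negP; apply; apply: mulr_gt0 => //; lra.
Qed.

Lemma max_right_derive_le0 (F : R -> R) (x c e : R) : 0 < e ->
  is_derive x 1 F c -> (forall t, x < t < x + e -> F t <= F x) -> c <= 0.
Proof.
move=> e0 [D E] mx; rewrite leNgt; apply/negP => c0.
have {D E} : (fun h : R => h^-1 *: (F (h *: 1 + x) - F x)) @ 0^' --> c.
  by rewrite -E; exact: D.
move=> /cvgrPdist_lt /(_ _ c0) [d /= d0 Hd].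
pose t := Num.min d e / 2.
have m0 : 0 < Num.min d e by rewrite lt_min d0.
have t0 : 0 < t by rewrite divr_gt0.
have md : Num.min d e <= d by rewrite ge_min lexx.
have me : Num.min d e <= e by rewrite ge_min lexx orbT.
have td : t < d by rewrite /t; lra.
have te : t < e by rewrite /t; lra.
have := Hd t; rewrite /= sub0r normrN gtr0_norm // => /(_ td).
have tn0 : t != 0 by rewrite gt_eqF.
move=> /(_ tn0); rewrite /GRing.scale /= mulr1 => H.
have : 0 < t^-1 * (F (t + x) - F x) by move: H; rewrite ltr_norml; lra.
rewrite pmulr_rgt0 ?invr_gt0 // subr_gt0 ltNge => /negP; apply.
by rewrite addrC; apply: mx; lra.
Qed.

Lemma max_left_derive_ge0 (F : R -> R) (x c e : R) : 0 < e ->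
  is_derive x 1 F c -> (forall t, x - e < t < x -> F t <= F x) -> 0 <= c.
Proof.
move=> e0 dF mx; rewrite -oppr_le0.
have dG : is_derive (- x) 1 (fun t => F (- 1 * t + 0)) (- c).
  have h : - 1 * (- x) + 0 = x by rewrite mulN1r opprK addr0.
  have := is_derive_affine (- 1) 0 (- x).
  move=> /is_derive_compE H; have := H F c; rewrite h => /(_ dF).
  by move/is_derive_eq; apply; rewrite mulrN1.
apply: (max_right_derive_le0 e0 dG) => t tx.
rewrite !mulN1r !addr0 opprK; apply: mx; lra.
Qed.

End complex_curves.

(** * The group SU(2) and its topology *)

Section matrices2.
Variable K : comNzRingType.
Implicit Types A B : 'M[K]_2.

Lemma sum_I2 (V : nmodType) (F : 'I_2 -> V) : \sum_i F i = F 0 + F 1.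
Proof.
rewrite !big_ord_recl big_ord0 addr0.
by congr (F _ + F _); exact: val_inj.
Qed.

Lemma forall_I2 (P : 'I_2 -> Prop) : P 0 -> P 1 -> forall i, P i.
Proof.
move=> P0 P1; case=> -[|[|//]] i.
- by rewrite (_ : Ordinal i = 0) //; exact: val_inj.
- by rewrite (_ : Ordinal i = 1) //; exact: val_inj.
Qed.

Lemma mx2P A B : A 0 0 = B 0 0 -> A 0 1 = B 0 1 ->
  A 1 0 = B 1 0 -> A 1 1 = B 1 1 -> A = B.
Proof.
by move=> a b c d; apply/matrixP => i j; move: i j; do 2 apply: forall_I2.
Qed.

Lemma det2E A : \det A = A 0 0 * A 1 1 - A 0 1 * A 1 0.
Proof.
rewrite (expand_det_row _ 0) sum_I2 /cofactor !det_mx11 !mxE /=.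
rewrite expr0 expr1 mul1r mulN1r mulrN.
by congr (A _ _ * A _ _ - A _ _ * A _ _); exact: val_inj.
Qed.

Lemma tr2E A : \tr A = A 0 0 + A 1 1. Proof. exact: sum_I2. Qed.

Lemma mulmx2E A B i j : (A *m B) i j = A i 0 * B 0 j + A i 1 * B 1 j.
Proof. by rewrite mxE sum_I2. Qed.

(** Cayley-Hamilton: the adjugate of a matrix of size 2 is tr A - A. *)
Lemma mul_adj2 A : A *m ((\tr A)%:M - A) = (\det A)%:M.
Proof.
by apply: mx2P; rewrite mulmx2E !mxE /= tr2E det2E ?mulr1n ?mulr0n; ring.
Qed.

(** Polarisation of the determinant. It shows that the left-hand side is unchanged
    when both matrices are multiplied by a matrix of determinant 1. *)
Lemma det2D A B : \tr A * \tr B - \tr (A *m B) =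
  \det (A + B) - \det A - \det B.
Proof. by rewrite !tr2E !det2E !mulmx2E !mxE; ring. Qed.

End matrices2.

Section group.
Variable R : realType.
Local Notation C := R[i].
Local Notation G := (SU2 R).
Local Notation M2 := 'M[C]_2.
Implicit Types (g h : G) (A : su2 R).

Lemma SU2P g : (g : M2) *m (g : M2)^t* = 1%:M /\ \det g = 1.
Proof. by case: g => g /= /andP[/unitarymxP gu /eqP]. Qed.

Lemma SU2_inv_subproof g : ((g : M2)^t* \is unitarymx) && (\det ((g : M2)^t*) == 1).
Proof.
have [gu gd] := SU2P g.
by rewrite trmxC_unitary det_map_mx det_tr gd rmorph1 eqxx andbT; case: g {gu gd} => g /= /andP[].
Qed.

Definition SU2_inv g : G := MkSU2 (SU2_inv_subproof g).

Lemma SU2_eq g h : g = h :> M2 -> g = h. Proof. exact: val_inj. Qed.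

Lemma SU2_mulA g h k : SU2_mul g (SU2_mul h k) = SU2_mul (SU2_mul g h) k.
Proof. by apply: SU2_eq; rewrite /= mulmxA. Qed.

Lemma SU2_mul1 g : SU2_mul g (SU2_one R) = g.
Proof. by apply: SU2_eq; rewrite /= mulmx1. Qed.

Lemma SU2_1mul g : SU2_mul (SU2_one R) g = g.
Proof. by apply: SU2_eq; rewrite /= mul1mx. Qed.

Lemma SU2_mulV g : SU2_mul g (SU2_inv g) = SU2_one R.
Proof. by apply: SU2_eq => /=; have [] := SU2P g. Qed.

Lemma SU2_Vmul g : SU2_mul (SU2_inv g) g = SU2_one R.
Proof. by apply: SU2_eq => /=; have [/mulmx1C] := SU2P g. Qed.

Lemma SU2_mulVK g h : SU2_mul g (SU2_mul (SU2_inv g) h) = h.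
Proof. by rewrite SU2_mulA SU2_mulV SU2_1mul. Qed.

Lemma SU2_mulKV g h : SU2_mul (SU2_inv g) (SU2_mul g h) = h.
Proof. by rewrite SU2_mulA SU2_Vmul SU2_1mul. Qed.

Lemma SU2_mulrKV g h : SU2_mul (SU2_mul h g) (SU2_inv g) = h.
Proof. by rewrite -SU2_mulA SU2_mulV SU2_mul1. Qed.

Lemma SU2_invK g : SU2_inv (SU2_inv g) = g.
Proof.
by rewrite -[LHS]SU2_mul1 -(SU2_Vmul g) SU2_mulA SU2_Vmul SU2_1mul.
Qed.

Lemma SU2_invM g h : SU2_inv (SU2_mul g h) = SU2_mul (SU2_inv h) (SU2_inv g).
Proof.
have E : SU2_mul (SU2_mul g h) (SU2_mul (SU2_inv h) (SU2_inv g)) = SU2_one R.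
  by rewrite SU2_mulA SU2_mulrKV SU2_mulV.
by rewrite -[RHS](SU2_mulKV (SU2_mul g h)) E SU2_mul1.
Qed.

(** On SU(2) the conjugate transpose is the adjugate. *)
Lemma SU2_invE g : SU2_inv g = (\tr g)%:M - (g : M2) :> M2.
Proof.
have [_ gd] := SU2P g; have := mul_adj2 (g : M2); rewrite gd => E.
rewrite -[RHS]mul1mx -[1%:M]/(SU2_one R : M2) -(SU2_Vmul g) /=.
by rewrite -mulmxA E mulmx1.
Qed.

Lemma SU2_tr_inv g : \tr (SU2_inv g) = \tr g.
Proof. by rewrite SU2_invE raddfB /= mxtrace_scalar mulr2n addrK. Qed.

Lemma SU2_tr_conj g : (\tr g)^* = \tr g.
Proof.
by rewrite -[RHS]SU2_tr_inv /= -(mxtrace_tr (g : M2)) /mxtrace rmorph_sum;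
  apply: eq_bigr => i _; rewrite !mxE.
Qed.

Lemma SU2_tr_real g : \tr g = (complex.Re (\tr g))%:C.
Proof.
have := SU2_tr_conj g; case: (\tr g) => a b /eqP; rewrite eq_complex /=.
by move=> /andP[_ /eqP h]; congr (_ +i* _); lra.
Qed.

Lemma SU2_entry_le1 g i j : nm (g i j) <= 1.
Proof.
have [E _] := SU2P g; have := congr1 (fun M : M2 => complex.Re (M i i)) E.
rewrite !mxE eqxx /= sum_I2 !mxE Re_add.
have h (z : C) : complex.Re (z * z^*) = nm z ^+ 2.
  by rewrite nm_sqr; case: z => a b /=; ring.
rewrite !h => {E}E; rewrite -(ler_pXn2r (n := 2)) ?nnegrE ?nm_ge0 // expr1n.
rewrite -E; move: j; apply: forall_I2; first by rewrite lerDl sqr_ge0.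
by rewrite lerDr sqr_ge0.
Qed.

End group.

Section complex_continuity.
Variables (R : realType).
Local Notation C := R[i].

Lemma contD (T : topologicalType) (f h : T -> R) :
  continuous f -> continuous h -> continuous (fun x => f x + h x).
Proof. by move=> a b x; apply: cvgD; [exact: a|exact: b]. Qed.

Lemma contN (T : topologicalType) (f : T -> R) :
  continuous f -> continuous (fun x => - f x).
Proof. by move=> a x; apply: cvgN; exact: a. Qed.

Lemma contM (T : topologicalType) (f h : T -> R) :
  continuous f -> continuous h -> continuous (fun x => f x * h x).
Proof. by move=> a b x; apply: cvgM; [exact: a|exact: b]. Qed.

(** Continuity by components, to which the rules for real functions apply. *)
Definition contC (T : topologicalType) (f : T -> C) : Prop :=
  continuous (fun x => complex.Re (f x)) /\
  continuous (fun x => complex.Im (f x)).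

Lemma nm_ltC (z : C) (e : C) : (`|z| < e) = (complex.Im e == 0) && (nm z < complex.Re e).
Proof. by rewrite nmE; case: e => a b; rewrite ltcE. Qed.

Lemma cvgCP (T : Type) (F : set_system T) {FF : Filter F} (f : T -> C) (l : C) :
  (f @ F --> (l : C^o)) <->
  (forall e : R, 0 < e -> \forall t \near F, nm (l - f t) < e).
Proof.
have P := @cvgrPdist_lt C C^o T F FF f l.
split=> [/P H e e0|H].
  have := H e%:C; rewrite ltcR => /(_ e0); apply: filterS => t.
  by rewrite nm_ltC eqxx.
apply/P => e; rewrite ltcE /= => /andP[/eqP i0 e0].
by apply: filterS (H _ e0) => t te; rewrite nm_ltC i0 eqxx.
Qed.

Lemma cvgC_ReIm (T : Type) (F : set_system T) {FF : Filter F} (f : T -> C) (l : C) :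
  (f @ F --> (l : C^o)) <->
  ((fun t => complex.Re (f t)) @ F --> complex.Re l /\
   (fun t => complex.Im (f t)) @ F --> complex.Im l).
Proof.
rewrite cvgCP; split=> [H|[/cvgrPdist_lt hr /cvgrPdist_lt hi] e e0].
  split; apply/cvgrPdist_lt => e e0; apply: filterS (H e e0) => t;
    apply: le_lt_trans; rewrite -?Re_opp -?Im_opp -?Re_add -?Im_add.
    exact: ler_Re_nm.
  exact: ler_Im_nm.
have e2 : 0 < e / 2 by rewrite divr_gt0.
apply: filterS2 (hr _ e2) (hi _ e2) => t h1 h2.
apply: (le_lt_trans (ler_nm_ReIm _)); rewrite !cReE !cImE; lra.
Qed.

Lemma contCP (T : topologicalType) (f : T -> C) :
  contC f <-> continuous (f : T -> C^o).
Proof.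
split=> [[h k] x|H]; first by apply/cvgC_ReIm; split; [exact: h|exact: k].
by split=> x; have /cvgC_ReIm[] := H x.
Qed.

Lemma contC_cst (T : topologicalType) (c : C) : contC (fun _ : T => c).
Proof. by split=> x; exact: cvg_cst. Qed.

Lemma contCD (T : topologicalType) (f h : T -> C) :
  contC f -> contC h -> contC (fun x => f x + h x).
Proof.
move=> [a b] [c d]; split=> x.
  under eq_fun do rewrite Re_add.
  by apply: cvgD; [exact: a|exact: c].
under eq_fun do rewrite Im_add.
by apply: cvgD; [exact: b|exact: d].
Qed.

Lemma contCM (T : topologicalType) (f h : T -> C) :
  contC f -> contC h -> contC (fun x => f x * h x).
Proof.
move=> [a b] [c d]; split=> x.
  under eq_fun do rewrite Re_mul.
  by apply: cvgB; apply: cvgM; [exact: a|exact: c|exact: b|exact: d].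
under eq_fun do rewrite Im_mul.
by apply: cvgD; apply: cvgM; [exact: a|exact: d|exact: b|exact: c].
Qed.

Lemma contC_sum (T : topologicalType) (I : finType) (F : I -> T -> C) :
  (forall i, contC (F i)) -> contC (fun x => \sum_i F i x).
Proof.
move=> H; rewrite /index_enum; elim: (Finite.enum I) => [|i r IH].
  rewrite (_ : (fun _ => _) = fun=> 0); first exact: contC_cst.
  by apply/funext => x; rewrite big_nil.
rewrite (_ : (fun _ => _) = fun x => F i x + \sum_(j <- r) F j x).
  exact: contCD.
by apply/funext => x; rewrite big_cons.
Qed.

Lemma contC_comp (T U : topologicalType) (f : U -> C) (k : T -> U) :
  contC f -> continuous k -> contC (fun x => f (k x)).
Proof.
move=> [a b] kc; split=> x.
  exact: (@continuous_comp _ _ _ k (fun x => complex.Re (f x)) x (kc x) (a (k x))).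
exact: (@continuous_comp _ _ _ k (fun x => complex.Im (f x)) x (kc x) (b (k x))).
Qed.

Lemma contC_real (T : topologicalType) (f : T -> R) :
  continuous f -> contC (fun x => (f x)%:C).
Proof. by move=> fc; split=> x /=; [exact: fc|exact: cvg_cst]. Qed.

Lemma contC_sqr (T : topologicalType) (f : T -> C) :
  contC f -> continuous (fun x => nm (f x) ^+ 2).
Proof.
move=> [a b] x; under eq_fun do rewrite nm_sqr !expr2.
by apply: cvgD; apply: cvgM; [exact: a|exact: a|exact: b|exact: b].
Qed.

Lemma contC_nm (T : topologicalType) (f : T -> C) :
  contC f -> continuous (fun x => nm (f x)).
Proof.
move=> fc x; rewrite (_ : (fun x => _) = Num.sqrt \o (fun x => nm (f x) ^+ 2)).
  by apply: continuous_comp; [exact: contC_sqr|exact: sqrt_continuous].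
by apply/funext => y /=; rewrite sqrtr_sqr ger0_norm ?nm_ge0.
Qed.

End complex_continuity.

Section SU2_topology.
Variable R : realType.
Local Notation C := R[i].
Local Notation G := (SU2 R).
Local Notation M2 := 'M[C]_2.
Implicit Types (g h : G) (A : su2 R).

Lemma contC_entry i j : contC (fun g : G => g i j).
Proof.
apply/contCP => g.
have h1 : {for g, continuous (@SU2_mx R : G -> 'M[C^o]_2)}.
  exact: (@initial_continuous G 'M[C^o]_2 (@SU2_mx R)).
have h2 : {for (g : 'M[C^o]_2), continuous (fun M : 'M[C^o]_2 => M i j)}.
  exact: coord_continuous.
exact: (@continuous_comp G 'M[C^o]_2 C^o _ _ g h1 h2).
Qed.

Lemma contC_SU2 (T : topologicalType) (f : T -> G) i j :
  continuous f -> contC (fun t => f t i j).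
Proof. by move=> fc; apply: (contC_comp (contC_entry i j)). Qed.

(** The group carries the topology induced by the space of matrices. *)
Lemma cvg_SU2 (T : Type) (F : set_system T) {FF : Filter F} (f : T -> G) g :
  (forall i j (e : R), 0 < e -> \forall t \near F, nm (g i j - f t i j) < e) ->
  f @ F --> g.
Proof.
move=> H A [_ [[B Bop <-] Bfs sBfA]].
have : nbhs (g : 'M[C^o]_2) B by rewrite nbhsE; exists B.
case=> P PB sPB; apply: (@filterS _ F _ [set t | forall i j, P i j (f t i j)]).
  by move=> t Pt; apply: sBfA; exact: sPB.
have HP i j : F [set t | P i j (f t i j)].
  have : (fun t => f t i j) @ F --> (g i j : C^o) by apply/cvgCP; exact: H.
  by apply; exact: PB.
have fI := @filterI _ F FF.
have H0 := fI _ _ (fI _ _ (HP 0 0) (HP 0 1)) (fI _ _ (HP 1 0) (HP 1 1)).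
apply: (@filterS _ F FF _ _ _ H0) => t [[a b] [c d]] /= i j.
by move: i j; do 2 apply: forall_I2 => //.
Qed.

Lemma continuous_SU2 (T : topologicalType) (f : T -> G) :
  (forall i j, contC (fun t => f t i j)) -> continuous f.
Proof.
move=> H x; apply: cvg_SU2 => i j e e0; have /contCP/(_ x) := H i j.
by move/cvgCP; apply.
Qed.

Lemma continuous_mul (T : topologicalType) (f h : T -> G) :
  continuous f -> continuous h -> continuous (fun t => SU2_mul (f t) (h t)).
Proof.
move=> fc hc; apply: continuous_SU2 => i j.
rewrite (_ : (fun _ => _) = fun t => f t i 0 * h t 0 j + f t i 1 * h t 1 j).
  by apply: contCD; apply: contCM; exact: contC_SU2.
by apply/funext => t; rewrite /= mulmx2E.
Qed.

Lemma conj_contC (T : topologicalType) (f : T -> C) :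
  contC f -> contC (fun t => (f t)^*).
Proof.
move=> [a b]; rewrite /contC.
have -> : (fun t => complex.Re (f t)^*) = (fun t => complex.Re (f t)).
  by apply/funext => y; case: (f y).
have -> : (fun t => complex.Im (f t)^*) = (fun t => - complex.Im (f t)).
  by apply/funext => y; case: (f y).
by split=> // x; apply: cvgN; exact: b.
Qed.

Lemma continuous_inv (T : topologicalType) (f : T -> G) :
  continuous f -> continuous (fun t => SU2_inv (f t)).
Proof.
move=> fc; apply: continuous_SU2 => i j.
rewrite (_ : (fun _ => _) = fun t => (f t j i)^*).
  by apply: conj_contC; exact: contC_SU2.
by apply/funext => t; rewrite /= !mxE.
Qed.

Lemma contC_tr (T : topologicalType) (f : T -> G) (M : M2) :
  continuous f -> contC (fun t => \tr (M *m f t)).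
Proof.
move=> fc; rewrite (_ : (fun _ => _) = fun t => (M 0 0 * f t 0 0 + M 0 1 * f t 1 0) +
    (M 1 0 * f t 0 1 + M 1 1 * f t 1 1)).
  by do 2 apply: contCD; apply: contCM; (exact: contC_cst || exact: contC_SU2).
by apply/funext => t; rewrite tr2E !mulmx2E.
Qed.

(** The parametrisation of SU(2) by the unit sphere of R^4. *)
Definition quat_mx (x : 'rV[R]_4) : M2 := \matrix_(i, j)
  (if i == 0 then (if j == 0 then x 0 0 +i* x 0 1 else x 0 2 +i* x 0 3)
   else (if j == 0 then (- x 0 2) +i* x 0 3 else x 0 0 -i* x 0 1)).

Lemma quat_mx_SU2 (x : 'rV[R]_4) : x 0 0 ^+ 2 + x 0 1 ^+ 2 + x 0 2 ^+ 2 + x 0 3 ^+ 2 = 1 ->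
  (quat_mx x \is unitarymx) && (\det (quat_mx x) == 1).
Proof.
move=> E; apply/andP; split.
  by apply/unitarymxP; apply: mx2P; rewrite mulmx2E !mxE /=;
  apply: complexP; rewrite /= -?E; ring.
by apply/eqP; rewrite det2E !mxE; apply: complexP; rewrite /= -?E; ring.
Qed.

Lemma quat_mx_surj g : exists x : 'rV[R]_4,
  x 0 0 ^+ 2 + x 0 1 ^+ 2 + x 0 2 ^+ 2 + x 0 3 ^+ 2 = 1 /\ quat_mx x = g.
Proof.
have [E _] := SU2P g; have := SU2_invE g => /= V.
have V00 := congr1 (fun M : M2 => M 0 0) V; have V01 := congr1 (fun M : M2 => M 0 1) V.
have E00 := congr1 (fun M : M2 => complex.Re (M 0 0)) E.
move: V00 V01 E00; rewrite mulmx2E !mxE tr2E /= ?mulr1n ?mulr0n.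
rewrite addrAC subrr add0r sub0r => V00 V01 E00.
exists (\row_i [:: complex.Re (g 0 0); complex.Im (g 0 0);
  complex.Re (g 0 1); complex.Im (g 0 1)]`_i).
rewrite !mxE /=; split.
  by rewrite -E00; case: (g 0 0) => a b; case: (g 0 1) => c d /=; ring.
apply: mx2P; rewrite !mxE /= -?complexRI //.
  move: V01; case: (g 0 1) => c d; case: (g 1 0) => c' d' /eqP.
  by rewrite eq_complex /= => /andP[/eqP h /eqP h']; congr (_ +i* _); lra.
by move: V00; case: (g 0 0) => c d.
Qed.

(** A continuous image of the unit sphere of R^4. *)
Lemma SU2_compact : compact [set: G].
Proof.
pose S := [set x : 'rV[R]_4 |
  x 0 0 ^+ 2 + x 0 1 ^+ 2 + x 0 2 ^+ 2 + x 0 3 ^+ 2 = 1].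
pose f (x : 'rV[R]_4) : G := insubd (SU2_one R) (quat_mx x).
have fE x : S x -> f x = quat_mx x :> M2.
  by move=> Sx; apply: (insubdK (SU2_one R)); exact: quat_mx_SU2 Sx.
have cc (k : 'I_4) : continuous (fun x : 'rV[R]_4 => x 0 k).
  exact: coord_continuous.
have Sc : compact S.
  apply: bounded_closed_compact.
    exists 1; split=> // M M1 x Sx; apply: le_trans (ltW M1).
    have H k : `|x 0 k| <= 1.
      rewrite -(ler_pXn2r (n := 2)) ?nnegrE // real_normK ?num_real // expr1n.
      rewrite -Sx; have h := fun k => sqr_ge0 (x 0 k).
      have := (h 0, h 1, h 2, h 3) => -[[[h0 h1] h2] h3].
      case: k => -[|[|[|[|//]]]] i.
      - rewrite (_ : Ordinal i = 0); [lra|exact: val_inj].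
      - rewrite (_ : Ordinal i = 1); [lra|exact: val_inj].
      - rewrite (_ : Ordinal i = 2); [lra|exact: val_inj].
      - rewrite (_ : Ordinal i = 3); [lra|exact: val_inj].
    rewrite [leLHS]/Num.norm /= mx_normrE; apply/bigmax_leP; split => // -[i j] _ /=.
    by rewrite ord1.
  pose F (x : 'rV[R]_4) := x 0 0 ^+ 2 + x 0 1 ^+ 2 + x 0 2 ^+ 2 + x 0 3 ^+ 2.
  have Fc : continuous F.
    have sq k : continuous (fun x : 'rV[R]_4 => x 0 k ^+ 2).
      move=> x; apply: (@continuous_comp _ _ _ (fun y : 'rV[R]_4 => y 0 k)
        (fun r : R => r ^+ 2) x); first exact: cc.
      exact: exprn_continuous.
    exact: contD (contD (contD (sq 0) (sq 1)) (sq 2)) (sq 3).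
  have -> : S = F @^-1` [set y | y = 1] by [].
  apply: preimage_closed; last exact: closed_eq.
  by move=> x _; exact: Fc.
rewrite (_ : [set: G] = f @` S).
  apply: continuous_compact => //; apply/subspace_continuousP => x Sx.
  apply: cvg_SU2 => i j e e0.
  have Hq : contC (fun y => quat_mx y i j).
    have cN k : continuous (fun y : 'rV[R]_4 => - y 0 k).
      exact: contN (cc k).
    have E k l : (fun y => quat_mx y k l) = (fun y => if k == 0 then
        (if l == 0 then y 0 0 +i* y 0 1 else y 0 2 +i* y 0 3)
        else (if l == 0 then (- y 0 2) +i* y 0 3 else y 0 0 -i* y 0 1)).
      by apply/funext => y; rewrite mxE.
    by rewrite E; case: (i == 0); case: (j == 0); split; [exact: cc|exact: cc|
      exact: cc|exact: cc|exact: cN|exact: cc|exact: cc|exact: cN].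
  change (nbhs x (fun y => S y -> nm (f x i j - f y i j) < e)).
  have h1 := (contCP _).1 Hq x.
  have h2 : nbhs x (fun y => nm (quat_mx x i j - quat_mx y i j) < e).
    by move/cvgCP: h1; apply.
  by apply: (@filterS _ (nbhs x) _ _ _ _ h2) => y h Sy; rewrite !fE.
apply/seteqP; split=> // g _; have [x [Sx xg]] := quat_mx_surj g.
by exists x => //; apply: SU2_eq; rewrite fE.
Qed.

End SU2_topology.

(** * The Lie algebra su(2), one-parameter subgroups and frames *)

Section su2_algebra.
Variable R : realType.
Local Notation C := R[i].
Local Notation M2 := 'M[C]_2.
Implicit Types (A B : su2 R).

(** Coordinates y, p, q on su(2): the first row of a matrix is (i y, p + i q), and
    the second row is (- p + i q, - i y). *)
Definition cy A : R := complex.Im ((A : M2) 0 0).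
Definition cp A : R := complex.Re ((A : M2) 0 1).
Definition cq A : R := complex.Im ((A : M2) 0 1).

Lemma su2_coords A : [/\ (A : M2) 0 0 = 0 +i* cy A, (A : M2) 1 1 = 0 -i* cy A,
  (A : M2) 0 1 = cp A +i* cq A & (A : M2) 1 0 = - cp A +i* cq A].
Proof.
have [AN A0] := su2P A.
have E i j : ((A : M2) j i)^* = - (A : M2) i j.
  by have /matrixP/(_ i j) := AN; rewrite !mxE.
have := E 0 0; have := E 0 1; move: A0; rewrite tr2E /cy /cp /cq.
case: ((A : M2) 0 0) => x y; case: ((A : M2) 1 1) => x' y'.
case: ((A : M2) 0 1) => p q; case: ((A : M2) 1 0) => p' q' /eqP.
rewrite eq_complex /= => /andP[/eqP xx' /eqP yy'].
move=> /eqP + /eqP; rewrite !eq_complex /=.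
move=> /andP[/eqP pp' /eqP qq'] /andP[/eqP xx _].
by split; congr (_ +i* _); lra.
Qed.

(** The Euclidean scalar product in these coordinates, which is - 1/2 of the trace
    form and - 1/8 of the Killing form. *)
Definition sdot A B : R := cy A * cy B + cp A * cp B + cq A * cq B.

Lemma su2_eqP A B : cy A = cy B -> cp A = cp B -> cq A = cq B -> A = B :> M2.
Proof.
have [a d b c] := su2_coords A; have [a' d' b' c'] := su2_coords B.
by move=> e1 e2 e3; apply: mx2P; rewrite ?a ?b ?c ?d ?a' ?b' ?c' ?d' ?e1 ?e2 ?e3.
Qed.

Lemma bracket_coords A B : [/\
  cy (su2_bracket A B) = 2 * (cp A * cq B - cq A * cp B),
  cp (su2_bracket A B) = 2 * (cq A * cy B - cy A * cq B) &
  cq (su2_bracket A B) = 2 * (cy A * cp B - cp A * cy B)].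
Proof.
have [a d b c] := su2_coords A; have [a' d' b' c'] := su2_coords B.
rewrite [cy (su2_bracket _ _)]/cy [cp (su2_bracket _ _)]/cp [cq (su2_bracket _ _)]/cq /= !mxE !sum_I2 ?a ?d ?b ?c ?a' ?b' ?c' ?d' /=.
by split; ring.
Qed.

Lemma su2_sqr A : (A : M2) *m A = (- sdot A A)%:C *: (1%:M : M2).
Proof.
have [a d b c] := su2_coords A; rewrite /sdot.
by apply: mx2P; rewrite mulmx2E !mxE ?a ?d ?b ?c; apply: complexP => /=; ring.
Qed.

Lemma sdot_ge0 A : 0 <= sdot A A.
Proof. by rewrite /sdot -!expr2 !addr_ge0 ?sqr_ge0. Qed.

Lemma sdot_eq0 A : sdot A A = 0 -> A = 0 :> M2.
Proof.
have [a d b c] := su2_coords A.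
move/eqP; rewrite /sdot -!expr2 !paddr_eq0 ?addr_ge0 ?sqr_ge0 // !sqrf_eq0.
move=> /andP[/andP[/eqP y0 /eqP p0] /eqP q0].
by apply: mx2P; rewrite mxE ?a ?b ?c ?d ?y0 ?p0 ?q0 ?oppr0.
Qed.

Lemma tr_su2_mul A B : \tr ((A : M2) *m B) = (- 2 * sdot A B)%:C.
Proof.
have [a d b c] := su2_coords A; have [a' d' b' c'] := su2_coords B.
by rewrite tr2E !mulmx2E a d b c a' b' c' d' /sdot; apply: complexP => /=; ring.
Qed.

Lemma killingE A B : killing A B = (- 8 * sdot A B)%:C.
Proof.
rewrite /killing; set f := _ \o _.
have E : \tr (lin_mx f) = \sum_i \sum_j f (delta_mx i j) i j.
  rewrite /mxtrace pair_bigA /= (reindex _ (curry_mxvec_bij _ _)) /=.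
  apply: eq_bigr => -[i j] _ /=.
  by rewrite mxE /= mxvecE vec_mx_delta.
have EM (P Q : M2) i j : (P *m delta_mx i j *m Q) i j = P i i * Q j j.
  by rewrite !mulmx2E; move: i j; do 2 apply: forall_I2; rewrite !mxE /=; ring.
have F i j : f (delta_mx i j) i j = ((A : M2) *m B) i i - (A : M2) i i * (B : M2) j j -
    ((B : M2) i i * (A : M2) j j - ((B : M2) *m A) j j).
  have B' (U V : M2) k l : (U - V) k l = U k l - V k l by rewrite !mxE.
  have e1 : ((A : M2) *m ((B : M2) *m delta_mx i j)) i j = ((A : M2) *m B) i i.
    by rewrite mulmxA -[_ *m delta_mx _ _]mulmx1 EM [X in _ * X]mxE eqxx mulr1.
  have e2 : ((A : M2) *m (delta_mx i j *m B)) i j = (A : M2) i i * (B : M2) j j.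
    by rewrite mulmxA EM.
  have e3 : (delta_mx i j *m (B : M2) *m (A : M2)) i j = ((B : M2) *m A) j j.
    by rewrite -mulmxA -[delta_mx _ _]mul1mx EM [X in X * _]mxE eqxx mul1r.
  by rewrite /f /= mulmxBr mulmxBl !B' e1 e2 e3 EM.
have [a d b c] := su2_coords A; have [a' d' b' c'] := su2_coords B.
clearbody f; rewrite E {E} !sum_I2 !F {F} !mulmx2E a d b c a' b' c' d' /sdot.
by apply: complexP => /=; ring.
Qed.

(** The exponential series of a matrix whose square is - th ^ 2: its even and
    odd parts are the series of cosine and sine. *)
Lemma expmxE (A : M2) (th : R) : A *m A = (- th ^+ 2)%:C *: (1%:M : M2) ->
  (th = 0 -> A = 0) ->
  expmx A = (cos th)%:C *: 1%:M + (sin th / th)%:C *: A.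
Proof.
move=> AA A0.
have sqr k : (A ^+ k.*2 : M2) = ((- th ^+ 2) ^+ k)%:C *: 1%:M.
  elim: k => [|k IH]; first by rewrite !expr0 scale1r.
  rewrite doubleS !(exprS A) mulrA IH -[A * A]/(A *m A) AA (exprS (- th ^+ 2) k).
  by rewrite -[_ * _]/(_ *m _) -scalemxAl mul1mx scalerA -rmorphM.
have term n : (n`!%:R)^-1 *: (A ^+ n : M2) =
  (cos_coeff th n)%:C *: 1%:M + (sin_coeff th n / th)%:C *: A.
  have -> : (n`!%:R)^-1 = (n`!%:R^-1)%:C :> C by rewrite fmorphV rmorph_nat.
  have pw k : (- th ^+ 2) ^+ k = (-1) ^+ k * th ^+ k.*2.
    by rewrite -mul2n exprM -exprMn mulN1r.
  have [k [b ->]] : exists k (b : bool), n = (b + k.*2)%N.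
    by exists n./2, (odd n); rewrite odd_double_half.
  rewrite /cos_coeff /sin_coeff -?exprnP /=; case: b => /=; last first.
    rewrite add0n odd_double /= sqr scalerA -rmorphM !mul0r scale0r addr0 pw.
    by congr (_%:C *: _); rewrite doubleK -exprnP; ring.
  rewrite add1n /= odd_double /= !mul0r scale0r add0r exprS sqr.
  rewrite -[_ * _]/(_ *m _) -scalemxAr mulmx1.
  have [th0|th0] := eqVneq th 0; first by rewrite A0 // !scaler0.
  rewrite scalerA -rmorphM pw; congr (_%:C *: _).
  rewrite doubleK [in RHS]exprS.
  by field; rewrite th0 pnatr_eq0 -lt0n fact_gt0.
have toC (u : R^nat) (l : R) : u @ \oo --> l ->
    (fun n => (u n)%:C : C^o) @ \oo --> (l%:C : C^o).
  by move=> ul; apply/cvgC_ReIm; split => //=; exact: cvg_cst.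
have lim_series : series (fun n => (n`!%:R)^-1 *: (A ^+ n : 'M[C^o]_2)) @ \oo -->
    ((cos th)%:C *: 1%:M + (sin th / th)%:C *: A : 'M[C^o]_2).
  rewrite (_ : series _ = fun n => (series (cos_coeff th) n)%:C *: 1%:M +
      (series (sin_coeff th) n / th)%:C *: (A : 'M[C^o]_2)); last first.
    apply/funext => n; rewrite /series /= (eq_bigr _ (fun i _ => term i)).
    by rewrite big_split /= -!scaler_suml mulr_suml !rmorph_sum.
  apply: cvgD; apply: cvgZr_tmp; apply: toC.
    by rewrite unlock; exact: is_cvg_series_cos_coeff.
  by apply: cvgMr_tmp; rewrite unlock; exact: is_cvg_series_sin_coeff.
exact: (cvg_lim (@norm_hausdorff _ 'M[C^o]_2) lim_series).
Qed.

(** The square of A is - speed A ^ 2, so that exp (t A) is a rotation by the angle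
    t * speed A. *)
Definition speed A : R := Num.sqrt (sdot A A).

Lemma speed_sqr A : speed A ^+ 2 = sdot A A.
Proof. by rewrite sqr_sqrtr // sdot_ge0. Qed.

Lemma speed_eq0 A : speed A = 0 -> A = 0 :> M2.
Proof. by move=> h; apply: sdot_eq0; rewrite -speed_sqr h expr0n. Qed.

Lemma translateE A g t : translate A g t =
  (cos (t * speed A))%:C *: (g : M2) +
  (sin (t * speed A) / speed A)%:C *: (g *m A) :> M2.
Proof.
rewrite /= (@expmxE _ (t * speed A)).
- rewrite mulmxDr -!scalemxAr mulmx1 scalerA -rmorphM; congr (_ + _).
  have [s0|s0] := eqVneq (speed A) 0.
    by rewrite (speed_eq0 s0) mulmx0 !scaler0.
  have [->|t0] := eqVneq t 0; first by rewrite mulr0 mul0r sin0 mul0r.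
  by congr (_%:C *: _); field; rewrite s0 t0.
- rewrite -scalemxAr -scalemxAl scalerA su2_sqr scalerA -!rmorphM -speed_sqr.
  by congr (_%:C *: _); ring.
- move/eqP; rewrite mulf_eq0 => /orP[/eqP ->|/eqP /speed_eq0 ->].
    by rewrite scale0r.
  by rewrite scaler0.
Qed.

Lemma translateD A g s t : translate A (translate A g s) t = translate A g (s + t).
Proof.
apply: SU2_eq; rewrite !translateE mulmxDl -!scalemxAl -mulmxA su2_sqr.
rewrite -scalemxAr mulmx1 -speed_sqr !scalerDr !scalerA -!rmorphM.
rewrite !mulrDl cosD sinD.
have [s0|s0] := eqVneq (speed A) 0.
  rewrite s0 (speed_eq0 s0) mulmx0 !mulr0 !scaler0 !addr0 !cos0 !sin0 !mulr0.
  by rewrite !mul0r !scale0r !addr0 subr0.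
rewrite [X in _ + X]addrC addrACA -!scalerDl -!rmorphD; congr (_%:C *: _ + _%:C *: _); by field.
Qed.

Lemma translate0 A g : translate A g 0 = g.
Proof.
by apply: SU2_eq; rewrite translateE mul0r cos0 sin0 mul0r scale0r addr0 scale1r.
Qed.

Lemma translate_mul A h g t : translate A (SU2_mul h g) t = SU2_mul h (translate A g t).
Proof. by rewrite /translate SU2_mulA. Qed.

Lemma continuous_translate A (T : topologicalType) (f : T -> SU2 R) (k : T -> R) :
  continuous f -> continuous k -> continuous (fun x => translate A (f x) (k x)).
Proof.
move=> fc kc; apply: continuous_SU2 => i j.
rewrite (_ : (fun _ => _) = fun x => (cos (k x * speed A))%:C * f x i j +
   (sin (k x * speed A) / speed A)%:C * (f x i 0 * (A : M2) 0 j + f x i 1 * (A : M2) 1 j)).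
  have ks : continuous (fun x => k x * speed A).
    by apply: contM => // x; exact: cvg_cst.
  apply: contCD; apply: contCM.
  - apply: contC_real => x.
    exact: (@continuous_comp _ _ _ (fun x => k x * speed A) cos x (ks x) (@continuous_cos _ _)).
  - exact: contC_SU2.
  - apply: contC_real; apply: contM; last by move=> x; exact: cvg_cst.
    move=> x.
    exact: (@continuous_comp _ _ _ (fun x => k x * speed A) sin x (ks x) (@continuous_sin _ _)).
  - by apply: contCD; apply: contCM; (exact: contC_SU2 || exact: contC_cst).
by apply/funext => x; rewrite translateE mxE [X in X + _]mxE [X in _ + X]mxE mulmx2E.
Qed.

End su2_algebra.

Section frames.
Variable R : realType.
Local Notation C := R[i].
Local Notation M2 := 'M[C]_2.
Variables X Y Z : su2 R.
Hypothesis XYZ : su2_frame X Y Z.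

(** In coordinates the bracket is twice the cross product. The frame is orthogonal
    with vectors of equal length, and Z = [X, Y] forces this length to be 1/2. *)
Lemma frame_dots : [/\ sdot X X = 4^-1, sdot Y Y = 4^-1, sdot Z Z = 4^-1 &
  [/\ sdot X Y = 0, sdot X Z = 0 & sdot Y Z = 0]].
Proof.
have [Zb [c [c0 H]]] := XYZ.
have h i j : 8 * c * sdot (tnth [tuple X; Y; Z] i) (tnth [tuple X; Y; Z] j) =
    (i == j)%:R.
  have : - c%:C * killing (tnth [tuple X; Y; Z] i) (tnth [tuple X; Y; Z] j) =
      (i == j)%:R by exact: H.
  rewrite killingE -rmorphN -rmorphM => /(congr1 (@complex.Re _)).
  rewrite [LHS]/= => E; transitivity (- c * (- 8 * sdot (tnth [tuple X; Y; Z] i) (tnth [tuple X; Y; Z] j))); first by ring.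
  by rewrite E; case: (i == j).
have c8 : 8 * c != 0 by rewrite mulf_neq0 // gt_eqF.
have hX := h 0 0; have hY := h 1 1; have hZ := h 2 2.
have hXY := h 0 1; have hXZ := h 0 2; have hYZ := h 1 2.
move: hX hY hZ hXY hXZ hYZ; rewrite !(tnth_nth X) /= => hX hY hZ hXY hXZ hYZ.
have z (x : R) : 8 * c * x = 0 -> x = 0.
  by move/eqP; rewrite mulf_eq0 (negPf c8) => /eqP.
have {}hXY := z _ hXY; have {}hXZ := z _ hXZ; have {}hYZ := z _ hYZ.
have [zy zp zq] := bracket_coords X Y.
have hc : 8 * c = 4.
  have : sdot Z Z = 4 * (sdot X X * sdot Y Y - sdot X Y ^+ 2).
    by rewrite Zb /sdot zy zp zq; ring.
  rewrite hXY expr0n subr0 => E.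
  have E2 : (8 * c) * (8 * c * sdot Z Z) = 4 * ((8 * c * sdot X X) * (8 * c * sdot Y Y)).
    by rewrite E; ring.
  by move: E2; rewrite hX hY hZ !mulr1.
by split=> //; [move: hX|move: hY|move: hZ]; rewrite hc; lra.
Qed.

(** The coordinates of the frame form half of an orthogonal matrix; its columns are
    orthogonal because its rows are. *)
Lemma frame_complete : [/\ cy X * cy X + cy Y * cy Y + cy Z * cy Z = 4^-1,
  cp X * cp X + cp Y * cp Y + cp Z * cp Z = 4^-1,
  cq X * cq X + cq Y * cq Y + cq Z * cq Z = 4^-1 &
  [/\ cy X * cp X + cy Y * cp Y + cy Z * cp Z = 0,
  cy X * cq X + cy Y * cq Y + cy Z * cq Z = 0 &
  cp X * cq X + cp Y * cq Y + cp Z * cq Z = 0]].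
Proof.
have [xx yy zz [xy xz yz]] := frame_dots.
pose c3 (A : su2 R) (k : 'I_3) : R := [:: cy A; cp A; cq A]`_k.
pose N : 'M[R]_3 := \matrix_(i, k) (2 * c3 (tnth [tuple X; Y; Z] i) k).
have NN : N *m N^T = 1%:M.
  apply/matrixP => i j; rewrite !mxE !big_ord_recl big_ord0 !mxE /c3 /=.
  have -> (A B : su2 R) : 2 * cy A * (2 * cy B) + (2 * cp A * (2 * cp B) +
    (2 * cq A * (2 * cq B) + 0)) = 4 * sdot A B by rewrite /sdot; ring.
  have xy' : sdot Y X = 0 by rewrite -xy /sdot; ring.
  have xz' : sdot Z X = 0 by rewrite -xz /sdot; ring.
  have yz' : sdot Z Y = 0 by rewrite -yz /sdot; ring.
  by case: i => -[|[|[|//]]] hi; case: j => -[|[|[|//]]] hj;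
    rewrite !(tnth_nth X) /= ?xx ?yy ?zz ?xy ?xz ?yz ?xy' ?xz' ?yz' ?mulr0 // divff.
have {NN} NN := mulmx1C NN.
have h k l : 4 * (c3 X k * c3 X l + c3 Y k * c3 Y l + c3 Z k * c3 Z l) = (k == l)%:R.
  have := congr1 (fun M : 'M[R]_3 => M k l) NN.
  rewrite !mxE !big_ord_recl big_ord0 !mxE !(tnth_nth X) /= => <-; ring.
have := (h 0 0, h 1 1, h 2 2, (h 0 1, h 0 2, h 1 2)).
rewrite /c3 /= => -[[[h1 h2] h3] [[h4 h5] h6]].
by split; [lra|lra|lra|split; lra].
Qed.

Lemma frame_brackets : [/\ (X : M2) *m Y - (Y : M2) *m X = Z,
  (Y : M2) *m Z - (Z : M2) *m Y = X & (Z : M2) *m X - (X : M2) *m Z = Y].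
Proof.
have [Zb _] := XYZ.
have [xx yy zz [xy xz yz]] := frame_dots.
have [zy zp zq] := bracket_coords X Y.
have [zy' zp' zq'] := bracket_coords Y Z.
have [zy2 zp2 zq2] := bracket_coords Z X.
move: xx yy xy; rewrite /sdot => xx yy xy.
split; first by rewrite Zb.
  rewrite -[LHS]/(su2_bracket Y Z : M2); apply: su2_eqP; rewrite ?zy' ?zp' ?zq' Zb ?zy ?zp ?zq.
  - transitivity (4 * (cy X * (cy Y * cy Y + cp Y * cp Y + cq Y * cq Y) -
      cy Y * (cy X * cy Y + cp X * cp Y + cq X * cq Y))); first ring.
    by rewrite yy xy; field.
  - transitivity (4 * (cp X * (cy Y * cy Y + cp Y * cp Y + cq Y * cq Y) -
      cp Y * (cy X * cy Y + cp X * cp Y + cq X * cq Y))); first ring.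
    by rewrite yy xy; field.
  - transitivity (4 * (cq X * (cy Y * cy Y + cp Y * cp Y + cq Y * cq Y) -
      cq Y * (cy X * cy Y + cp X * cp Y + cq X * cq Y))); first ring.
    by rewrite yy xy; field.
rewrite -[LHS]/(su2_bracket Z X : M2); apply: su2_eqP; rewrite ?zy2 ?zp2 ?zq2 Zb ?zy ?zp ?zq.
- transitivity (4 * (cy Y * (cy X * cy X + cp X * cp X + cq X * cq X) -
    cy X * (cy X * cy Y + cp X * cp Y + cq X * cq Y))); first ring.
  by rewrite xx xy; field.
- transitivity (4 * (cp Y * (cy X * cy X + cp X * cp X + cq X * cq X) -
    cp X * (cy X * cy Y + cp X * cp Y + cq X * cq Y))); first ring.
  by rewrite xx xy; field.
- transitivity (4 * (cq Y * (cy X * cy X + cp X * cp X + cq X * cq X) -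
    cq X * (cy X * cy Y + cp X * cp Y + cq X * cq Y))); first ring.
  by rewrite xx xy; field.
Qed.

Lemma frame_sqr A : A = X \/ A = Y \/ A = Z ->
  (A : M2) *m A = (- 4^-1)%:C *: (1%:M : M2).
Proof.
have [xx yy zz _] := frame_dots.
by move=> [->|[->|->]]; rewrite su2_sqr ?xx ?yy ?zz.
Qed.

(** The Casimir tensor of the frame acts on a tensor square of C^2 as a
    combination of the identity and the exchange of the factors. *)
Lemma frame_fierz (P Q : M2) :
  \tr (P *m X) * \tr (Q *m X) + \tr (P *m Y) * \tr (Q *m Y) +
    \tr (P *m Z) * \tr (Q *m Z) =
  (4^-1)%:C * (\tr P * \tr Q) - (2^-1)%:C * \tr (P *m Q).
Proof.
have [yy pp qq [yp yq pq]] := frame_complete.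
have trE (M : M2) (A : su2 R) : \tr (M *m A) =
    (cy A)%:C * ('i * (M 0 0 - M 1 1)) + (cp A)%:C * (M 1 0 - M 0 1) +
    (cq A)%:C * ('i * (M 1 0 + M 0 1)).
  have [a d b c] := su2_coords A; rewrite tr2E !mulmx2E a b c d.
  by apply: complexP; rewrite ?cReE ?cImE /=; ring.
pose u1 := 'i * (P 0 0 - P 1 1); pose u2 := P 1 0 - P 0 1.
pose u3 := 'i * (P 1 0 + P 0 1).
pose v1 := 'i * (Q 0 0 - Q 1 1); pose v2 := Q 1 0 - Q 0 1.
pose v3 := 'i * (Q 1 0 + Q 0 1).
rewrite !trE -/u1 -/u2 -/u3 -/v1 -/v2 -/v3.
transitivity ((cy X * cy X + cy Y * cy Y + cy Z * cy Z)%:C * (u1 * v1) +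
  (cp X * cp X + cp Y * cp Y + cp Z * cp Z)%:C * (u2 * v2) +
  (cq X * cq X + cq Y * cq Y + cq Z * cq Z)%:C * (u3 * v3) +
  (cy X * cp X + cy Y * cp Y + cy Z * cp Z)%:C * (u1 * v2 + u2 * v1) +
  (cy X * cq X + cy Y * cq Y + cy Z * cq Z)%:C * (u1 * v3 + u3 * v1) +
  (cp X * cq X + cp Y * cq Y + cp Z * cq Z)%:C * (u2 * v3 + u3 * v2)).
  by rewrite !rmorphD !rmorphM; ring.
rewrite yy pp qq yp yq pq !mul0r !addr0 !tr2E !mulmx2E /u1 /u2 /u3 /v1 /v2 /v3.
have ii : 'i * 'i = - 1 :> C by apply: complexP => /=; ring.
have q4 : (4^-1)%:C = (2^-1)%:C * (2^-1)%:C :> C by rewrite -rmorphM; congr (_%:C); field.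
have h2 : (2^-1)%:C + (2^-1)%:C = 1 :> C by rewrite -rmorphD; congr (_%:C); field.
rewrite q4; set h := (2^-1)%:C in h2 *.
have -> : 'i * (P 0 0 - P 1 1) * ('i * (Q 0 0 - Q 1 1)) =
  - ((P 0 0 - P 1 1) * (Q 0 0 - Q 1 1)) by rewrite mulrACA ii mulN1r.
have -> : 'i * (P 1 0 + P 0 1) * ('i * (Q 1 0 + Q 0 1)) =
  - ((P 1 0 + P 0 1) * (Q 1 0 + Q 0 1)) by rewrite mulrACA ii mulN1r.
apply/eqP; rewrite -subr_eq0; apply/eqP.
rewrite -[h in X in _ - X * _]mul1r.
transitivity (h * (1 - (h + h)) * (P 0 0 * Q 0 0 + P 1 1 * Q 1 1 + P 0 1 * Q 1 0 + P 1 0 * Q 0 1)).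
  ring.
by rewrite h2 subrr mulr0 mul0r.
Qed.

Lemma frame_span (B : su2 R) : let a A := 4 * sdot B A in
  (B : M2) = (a X)%:C *: (X : M2) + (a Y)%:C *: (Y : M2) + (a Z)%:C *: (Z : M2).
Proof.
move=> a; have [yy pp qq [yp yq pq]] := frame_complete.
have [b1 b2 b3 b4] := su2_coords B.
have [x1 x2 x3 x4] := su2_coords X; have [y1 y2 y3 y4] := su2_coords Y.
have [z1 z2 z3 z4] := su2_coords Z.
have e1 : a X * cy X + a Y * cy Y + a Z * cy Z = cy B.
  rewrite /a /sdot; transitivity (4 * (cy B * (cy X * cy X + cy Y * cy Y + cy Z * cy Z)
   + cp B * (cy X * cp X + cy Y * cp Y + cy Z * cp Z)
   + cq B * (cy X * cq X + cy Y * cq Y + cy Z * cq Z))); first ring.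
  by rewrite yy yp yq; field.
have e2 : a X * cp X + a Y * cp Y + a Z * cp Z = cp B.
  rewrite /a /sdot; transitivity (4 * (cy B * (cy X * cp X + cy Y * cp Y + cy Z * cp Z)
   + cp B * (cp X * cp X + cp Y * cp Y + cp Z * cp Z)
   + cq B * (cp X * cq X + cp Y * cq Y + cp Z * cq Z))); first ring.
  by rewrite pp yp pq; field.
have e3 : a X * cq X + a Y * cq Y + a Z * cq Z = cq B.
  rewrite /a /sdot; transitivity (4 * (cy B * (cy X * cq X + cy Y * cq Y + cy Z * cq Z)
   + cp B * (cp X * cq X + cp Y * cq Y + cp Z * cq Z)
   + cq B * (cq X * cq X + cq Y * cq Y + cq Z * cq Z))); first ring.
  by rewrite qq yq pq; field.
by apply: mx2P; rewrite !mxE ?b1 ?b2 ?b3 ?b4 ?x1 ?x2 ?x3 ?x4 ?y1 ?y2 ?y3 ?y4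
  ?z1 ?z2 ?z3 ?z4 -?e1 -?e2 -?e3; apply: complexP; rewrite ?cReE ?cImE /=; ring.
Qed.

End frames.

(** * Left-invariant derivatives and polynomial functions *)

Section lie_calculus.
Variable R : realType.
Local Notation C := R[i].
Local Notation G := (SU2 R).
Local Notation M2 := 'M[C]_2.
Implicit Types (A B : su2 R) (f h : G -> C).

(** [lie_derive] is total; this makes it an actual derivative. *)
Definition lie_diff f := forall A g,
  isCd (fun t => f (translate A g t)) 0 (lie_derive A f g).

Lemma lie_derive_val A f g l :
  isCd (fun t => f (translate A g t)) 0 l -> lie_derive A f g = l.
Proof.
move=> [[_ r] [_ i]]; rewrite /lie_derive !derive1E r i.
by rewrite -complexRI.
Qed.

Lemma lie_diffP f (F : su2 R -> G -> C) :
  (forall A g, isCd (fun t => f (translate A g t)) 0 (F A g)) ->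
  lie_diff f /\ forall A, lie_derive A f = F A.
Proof.
move=> H; split=> [A g|A]; first by rewrite (lie_derive_val (H A g)).
by apply/funext => g; rewrite (lie_derive_val (H A g)).
Qed.

Lemma lie_diff_at f A g t : lie_diff f ->
  isCd (fun t => f (translate A g t)) t (lie_derive A f (translate A g t)).
Proof.
move=> df; have h0 : 1 * t + - t = 0 by rewrite mul1r subrr.
have := df A (translate A g t); rewrite -h0 => /isCd_affine.
rewrite mul1r; congr (isCd _ t _).
by apply/funext => s; rewrite translateD; congr (f (translate A g _)); ring.
Qed.

Lemma lie_cst (c : C) : lie_diff (fun=> c) /\ forall A, lie_derive A (fun=> c) = fun=> 0.
Proof. by apply: lie_diffP => A g; exact: isCd_cst. Qed.

Lemma lieD f h : lie_diff f -> lie_diff h ->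
  lie_diff (fun g => f g + h g) /\ forall A,
  lie_derive A (fun g => f g + h g) = fun g => lie_derive A f g + lie_derive A h g.
Proof. by move=> df dh; apply: lie_diffP => A g; exact: isCdD. Qed.

Lemma lieM f h : lie_diff f -> lie_diff h ->
  lie_diff (fun g => f g * h g) /\ forall A,
  lie_derive A (fun g => f g * h g) =
    fun g => lie_derive A f g * h g + f g * lie_derive A h g.
Proof.
move=> df dh; apply: lie_diffP => A g.
by have := isCdM (df A g) (dh A g); rewrite !translate0.
Qed.

Lemma lieZ c f : lie_diff f -> lie_diff (fun g => c * f g) /\ forall A,
  lie_derive A (fun g => c * f g) = fun g => c * lie_derive A f g.
Proof. by move=> df; apply: lie_diffP => A g; exact: isCdZ. Qed.

Lemma lie_sum (I : finType) (F : I -> G -> C) : (forall i, lie_diff (F i)) ->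
  lie_diff (fun g => \sum_i F i g) /\ forall A,
  lie_derive A (fun g => \sum_i F i g) = fun g => \sum_i lie_derive A (F i) g.
Proof.
by move=> dF; apply: lie_diffP => A g; apply: isCd_sum => i; exact: dF.
Qed.

Lemma lie_tr (M : M2) : lie_diff (fun g : G => \tr (M *m g)) /\ forall A,
  lie_derive A (fun g : G => \tr (M *m g)) = fun g : G => \tr (((A : M2) *m M) *m g).
Proof.
apply: lie_diffP => A g.
rewrite (_ : (fun t => _) = fun t => (cos (t * speed A + 0))%:C * \tr (M *m g) +
    (sin (t * speed A + 0) / speed A)%:C * \tr (M *m (g *m A))); last first.
  apply/funext => t; rewrite translateE mulmxDr raddfD /= -!scalemxAr !mxtraceZ.
  by rewrite addr0.
have tr3 : \tr (M *m (g *m A)) = \tr ((A : M2) *m M *m g).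
  by rewrite mulmxA mxtrace_mulC mulmxA.
have dc : is_derive (0 : R) 1 (fun t => cos (t * speed A + 0)) 0.
  have d := is_derive_affine (speed A) 0 0; have h0 : speed A * 0 + 0 = 0 by ring.
  have := is_derive_compE d (is_derive_cos _).
  rewrite h0 sin0 oppr0 mul0r; congr (is_derive _ _ _ _).
  by apply/funext => t; rewrite mulrC.
have ds : is_derive (0 : R) 1 (fun t => sin (t * speed A + 0) / speed A)
    (speed A / speed A).
  have d := is_derive_affine (speed A) 0 0; have h0 : speed A * 0 + 0 = 0 by ring.
  have := is_derive_compE d (is_derive_sin _).
  rewrite h0 cos0 mul1r => d1.
  have := is_deriveME d1 (is_derive_cstE 0 1 (speed A)^-1).
  rewrite mulr0 addr0; congr (is_derive _ _ _ _).
  by apply/funext => t; rewrite mulrC [speed A * t]mulrC mulrC.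
have realC (F : R -> R) d : is_derive (0 : R) 1 F d -> isCd (fun t => (F t)%:C) 0 d%:C.
  by move=> h; split=> //=; exact: is_derive_cst.
apply: (isCd_eq (isCdD (isCdM (realC _ _ dc) (isCd_cst _ _))
  (isCdM (realC _ _ ds) (isCd_cst _ _)))).
rewrite mul0r !mulr0 !addr0 add0r tr3.
have [s0|s0] := eqVneq (speed A) 0; last by rewrite divff // mul1r.
by rewrite (speed_eq0 s0) !mul0mx mxtrace0 mulr0.
Qed.

Local Opaque lie_derive.

(** Restrictions to SU(2) of polynomials in the matrix entries. The index bounds
    the degree, on which the spectral decomposition is an induction. *)
Inductive polyfun : nat -> (G -> C) -> Prop :=
| polyfun_cst n c : polyfun n (fun=> c)
| polyfun_tr n (M : M2) f : polyfun n f -> polyfun n.+1 (fun g => \tr (M *m g) * f g)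
| polyfun_add n f h : polyfun n f -> polyfun n h -> polyfun n (fun g => f g + h g).

Lemma polyfun0_cst f : polyfun 0 f -> exists c, f = fun=> c.
Proof.
move E : 0%N => n pf; elim: pf E => {n f} // [n c _|n f h _ IHf _ IHh n0].
  by exists c.
have [c ->] := IHf n0; have [d ->] := IHh n0.
by exists (c + d).
Qed.

Lemma polyfun_diff n f : polyfun n f -> lie_diff f.
Proof.
elim=> {n f} [n c|n M f _ df|n f h _ df _ dh].
- exact: (lie_cst c).1.
- exact: (lieM (lie_tr M).1 df).1.
- exact: (lieD df dh).1.
Qed.

Lemma polyfun_contC n f : polyfun n f -> contC f.
Proof.
elim=> {n f} [n c|n M f _ cf|n f h _ cf _ ch].
- exact: contC_cst.
- by apply: contCM => //; apply: contC_tr => x; exact: cvg_id.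
- exact: contCD.
Qed.

Lemma polyfun_leq m n f : (m <= n)%N -> polyfun m f -> polyfun n f.
Proof.
move=> mn pf; elim: pf n mn => {m f} [m c|m M f _ IH|m f h _ IHf _ IHh] n mn.
- exact: polyfun_cst.
- by case: n mn => // n mn; apply: polyfun_tr; exact: IH.
- by apply: polyfun_add; [exact: IHf|exact: IHh].
Qed.

Lemma polyfun_mul m n f h : polyfun m f -> polyfun n h ->
  polyfun (m + n) (fun g => f g * h g).
Proof.
move=> pf ph; elim: pf => {m f} [m c|m M f _ IH|m f k _ IHf _ IHk].
- apply: (@polyfun_leq n); first exact: leq_addl.
  elim: ph => {n h} [n d|n M h _ IH|n h k _ IHh _ IHk]; first exact: polyfun_cst.
  - have -> : (fun g : G => c * (\tr (M *m g) * h g)) =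
        (fun g : G => \tr (M *m g) * (c * h g)).
      by apply/funext => g; rewrite mulrCA.
    exact: (polyfun_tr M IH).
  - rewrite (_ : (fun _ => _) = fun g => c * h g + c * k g).
      exact: (polyfun_add IHh IHk).
    by apply/funext => g; rewrite mulrDr.
- have -> : (fun g : G => \tr (M *m g) * f g * h g) =
      (fun g : G => \tr (M *m g) * (f g * h g)).
    by apply/funext => g; rewrite mulrA.
  exact: (polyfun_tr M IH).
- rewrite (_ : (fun _ => _) = fun g => f g * h g + k g * h g).
    exact: (polyfun_add IHf IHk).
  by apply/funext => g; rewrite mulrDl.
Qed.

Lemma polyfun_scale n c f : polyfun n f -> polyfun n (fun g => c * f g).
Proof. by move=> pf; exact: (polyfun_mul (polyfun_cst 0 c) pf). Qed.

Lemma polyfun_lie n A f : polyfun n f -> polyfun n (lie_derive A f).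
Proof.
elim=> {n f} [n c|n M f pf IH|n f h pf IHf ph IHh].
- by rewrite (lie_cst c).2; exact: polyfun_cst.
- have df := polyfun_diff pf.
  rewrite (lieM (lie_tr M).1 df).2 (lie_tr M).2.
  by apply: polyfun_add; exact: polyfun_tr.
- by rewrite (lieD (polyfun_diff pf) (polyfun_diff ph)).2; exact: polyfun_add.
Qed.

(** A coinduction principle for smoothness. *)
Lemma smoothI (P : (G -> C) -> Prop) :
  (forall f, P f -> contC f /\ lie_diff f) ->
  (forall A f, P f -> P (lie_derive A f)) -> forall f, P f -> is_smooth f.
Proof.
move=> H HA f Pf s.
have [cf df] : contC (iter_lie s f) /\ lie_diff (iter_lie s f).
  by apply: H; elim: s => //= A s; exact: HA.
split; first exact/contCP.
by move=> A g; have [[dr _] [di _]] := df A g.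
Qed.

Lemma polyfun_smooth n f : polyfun n f -> is_smooth f.
Proof.
apply: (@smoothI (polyfun n)) => [h ph|A h]; last exact: polyfun_lie.
by split; [exact: polyfun_contC ph|exact: polyfun_diff ph].
Qed.

Local Transparent lie_derive.

Lemma smooth_contC s f : is_smooth f -> contC (iter_lie s f).
Proof. by move=> /(_ s)[/contCP]. Qed.

Lemma smooth_diff s f : is_smooth f -> lie_diff (iter_lie s f).
Proof.
move=> /(_ s)[_ H] A g; have [dr di] := H A g.
rewrite /lie_derive; split; apply: DeriveDef; rewrite ?derive1E //.
Qed.

Local Opaque lie_derive.

(** The commutator of two derivations is a derivation, so that it is enough to
    compare both sides on the matrix entries. *)
Lemma lie_comm n A B f g : polyfun n f -> lie_derive A (lie_derive B f) g =
  lie_derive B (lie_derive A f) g + lie_derive (su2_bracket A B) f g.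
Proof.
move=> pf; elim: pf g => {n f} [n c|n M f pf IH|n f h pf IHf ph IHh] g.
- by rewrite !(lie_cst c).2 !(lie_cst 0).2 addr0.
- have alg (a b c d e x y z v w : C) : a * x + b * y + (c * z + d * (v + w)) =
      e * x + c * z + (b * y + d * v) + ((a - e) * x + d * w) by ring.
  have df := polyfun_diff pf; have dA D := polyfun_diff (polyfun_lie D pf).
  have dt N := (lie_tr N).1.
  rewrite !(fun D => (lieM (dt M) df).2 D) !(lie_tr M).2.
  rewrite !(fun N D => (lieD (lieM (dt N) df).1 (lieM (dt M) (dA D)).1).2).
  rewrite !(fun N D => (lieM (dt N) df).2 D) !(fun N D D' => (lieM (dt N) (dA D)).2 D').
  rewrite !(fun N D => (lie_tr N).2 D) IH /= mulmxBl mulmxBl raddfB /= !mulmxA.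
  exact: alg.
- have df := polyfun_diff pf; have dA D := polyfun_diff (polyfun_lie D pf).
  have dh := polyfun_diff ph; have dB D := polyfun_diff (polyfun_lie D ph).
  rewrite !(fun D => (lieD df dh).2 D) !(fun D D' => (lieD (dA D) (dB D)).2 D').
  by rewrite IHf IHh addrACA.
Qed.

(** Again both sides are derivations, so that the identity for matrix entries is
    enough. *)
Lemma lie_lincomb n (a b c : R) A A1 A2 A3 f g : polyfun n f ->
  (A : M2) = a%:C *: (A1 : M2) + b%:C *: (A2 : M2) + c%:C *: (A3 : M2) ->
  lie_derive A f g = a%:C * lie_derive A1 f g + b%:C * lie_derive A2 f g +
    c%:C * lie_derive A3 f g.
Proof.
move=> pf E; elim: pf g => {n f} [n d|n M f pf IH|n f h pf IHf ph IHh] g.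
- by rewrite !(lie_cst d).2 !mulr0 !addr0.
- have alg (x y z t u v w k l : C) : (a%:C * x + b%:C * y + c%:C * z) * t +
      u * (a%:C * v + b%:C * w + c%:C * k) = a%:C * (x * t + u * v) +
      b%:C * (y * t + u * w) + c%:C * (z * t + u * k) by ring.
  have df := polyfun_diff pf; have dt := (lie_tr M).1.
  rewrite !(fun D => (lieM dt df).2 D) !(lie_tr M).2 IH E.
  rewrite !mulmxDl !raddfD /= -!scalemxAl !mxtraceZ; exact: alg.
- have df := polyfun_diff pf; have dh := polyfun_diff ph.
  by rewrite !(fun D => (lieD df dh).2 D) IHf IHh; ring.
Qed.

End lie_calculus.

(** * Spectral decomposition of polynomial functions *)

(** A copy of [lie_derive] that unification never unfolds. *)
Fact dl_key : unit. Proof. exact: tt. Qed.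
Definition dl (R : realType) : su2 R -> (SU2 R -> R[i]) -> SU2 R -> R[i] :=
  locked_with dl_key (@lie_derive R).

Lemma dlE (R : realType) : @dl R = @lie_derive R.
Proof. by rewrite /dl unlock. Qed.

Section spectral.
Variable R : realType.
Local Notation C := R[i].
Local Notation G := (SU2 R).
Local Notation M2 := 'M[C]_2.
Local Notation D := (@dl R).
Variables X Y Z : su2 R.
Hypothesis XYZ : su2_frame X Y Z.
Implicit Types (A B : su2 R) (f h : G -> C).

Definition pol f := exists n, polyfun n f.

Lemma su2_inj A B : A = B :> M2 -> A = B.
Proof.
by case: A B => a pa [b pb] /= ab; move: pa; rewrite ab => pa; congr MkSu2; exact: bool_irrelevance.
Qed.

Lemma pol_diff f : pol f -> lie_diff f.
Proof. by move=> [n /polyfun_diff]. Qed.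

Lemma pol_contC f : pol f -> contC f.
Proof. by move=> [n /polyfun_contC]. Qed.

Lemma pol_cst c : pol (fun=> c). Proof. by exists 0; exact: polyfun_cst. Qed.

Lemma pol_tr (M : M2) : pol (fun g => \tr (M *m g)).
Proof.
exists 1%N; have := polyfun_tr M (polyfun_cst 0 1); congr (polyfun 1 _).
by apply/funext => g; rewrite mulr1.
Qed.

Lemma polD f h : pol f -> pol h -> pol (fun g => f g + h g).
Proof.
move=> [n pf] [m ph]; exists (maxn n m); apply: polyfun_add.
  by apply: polyfun_leq pf; exact: leq_maxl.
by apply: polyfun_leq ph; exact: leq_maxr.
Qed.

Lemma polM f h : pol f -> pol h -> pol (fun g => f g * h g).
Proof. by move=> [n pf] [m ph]; exists (n + m)%N; exact: polyfun_mul. Qed.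

Lemma polZ c f : pol f -> pol (fun g => c * f g).
Proof. by move=> [n pf]; exists n; exact: polyfun_scale. Qed.

Lemma polB f h : pol f -> pol h -> pol (fun g => f g - h g).
Proof.
move=> pf ph; have := polD pf (polZ (-1) ph); congr pol.
by apply/funext => g; rewrite mulN1r.
Qed.

Lemma pol_sum (I : finType) (F : I -> G -> C) :
  (forall i, pol (F i)) -> pol (fun g => \sum_i F i g).
Proof.
move=> H; rewrite /index_enum; elim: (Finite.enum I) => [|i r IH].
  by have := pol_cst 0; congr pol; apply/funext => x; rewrite big_nil.
have := polD (H i) IH; congr pol.
by apply/funext => x; rewrite big_cons.
Qed.

Lemma pol_lie A f : pol f -> pol (D A f).
Proof. by move=> [n pf]; exists n; rewrite dlE; exact: polyfun_lie. Qed.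

Lemma pol_smooth f : pol f -> is_smooth f.
Proof. by move=> [n /polyfun_smooth]. Qed.

Lemma D_cst A c : D A (fun=> c) = fun=> 0.
Proof. by rewrite dlE (lie_cst c).2. Qed.

Lemma D_tr A (M : M2) :
  D A (fun g : G => \tr (M *m g)) = fun g : G => \tr ((A : M2) *m M *m g).
Proof. by rewrite dlE (lie_tr M).2. Qed.

Lemma D_lincomb (a b c : R) A A1 A2 A3 f : pol f ->
  (A : M2) = a%:C *: (A1 : M2) + b%:C *: (A2 : M2) + c%:C *: (A3 : M2) ->
  D A f = fun g => a%:C * D A1 f g + b%:C * D A2 f g + c%:C * D A3 f g.
Proof.
by move=> [n pf] E; apply/funext => g; rewrite dlE (lie_lincomb g pf E).
Qed.

Lemma D_add A f h : pol f -> pol h ->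
  D A (fun g => f g + h g) = fun g => D A f g + D A h g.
Proof. by move=> /pol_diff pf /pol_diff ph; rewrite dlE (lieD pf ph).2. Qed.

Lemma D_scale A c f : pol f -> D A (fun g => c * f g) = fun g => c * D A f g.
Proof. by move=> /pol_diff pf; rewrite dlE (lieZ c pf).2. Qed.

Lemma D_mul A f h : pol f -> pol h ->
  D A (fun g => f g * h g) = fun g => D A f g * h g + f g * D A h g.
Proof. by move=> /pol_diff pf /pol_diff ph; rewrite dlE (lieM pf ph).2. Qed.

Lemma D_sum A (I : finType) (F : I -> G -> C) : (forall i, pol (F i)) ->
  D A (fun g => \sum_i F i g) = fun g => \sum_i D A (F i) g.
Proof. by move=> pF; rewrite dlE (lie_sum (fun i => pol_diff (pF i))).2. Qed.

Lemma D_XY f : pol f -> D X (D Y f) = fun g => D Y (D X f) g + D Z f g.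
Proof.
move=> [n pf]; apply/funext => g; rewrite dlE (lie_comm _ _ _ pf).
by have [<- _] := XYZ.
Qed.

Lemma D_YZ f : pol f -> D Y (D Z f) = fun g => D Z (D Y f) g + D X f g.
Proof.
move=> [n pf]; apply/funext => g; rewrite dlE (lie_comm _ _ _ pf).
by congr (_ + lie_derive _ f g); apply: su2_inj; have [_ <- _] := frame_brackets XYZ.
Qed.

Lemma D_ZX f : pol f -> D Z (D X f) = fun g => D X (D Z f) g + D Y f g.
Proof.
move=> [n pf]; apply/funext => g; rewrite dlE (lie_comm _ _ _ pf).
by congr (_ + lie_derive _ f g); apply: su2_inj; have [_ _ <-] := frame_brackets XYZ.
Qed.

Definition Lap f g := - D X (D X f) g - D Y (D Y f) g - D Z (D Z f) g.

Lemma pol_Lap f : pol f -> pol (Lap f).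
Proof.
move=> pf; have p2 A : pol (D A (D A f)) by do 2 apply: pol_lie.
by do 2 (apply: polB => //); have := polZ (-1) (p2 X); congr pol;
  apply/funext => g; rewrite mulN1r.
Qed.

Lemma Lap_add f h : pol f -> pol h ->
  Lap (fun g => f g + h g) = fun g => Lap f g + Lap h g.
Proof.
move=> pf ph; apply/funext => g; rewrite /Lap !(D_add _ pf ph).
rewrite !(fun A => D_add _ (pol_lie A pf) (pol_lie A ph)).
move: (D X (D X f) g) (D X (D X h) g) (D Y (D Y f) g) (D Y (D Y h) g) => a b c d.
by move: (D Z (D Z f) g) (D Z (D Z h) g) => k l; ring.
Qed.

Lemma Lap_scale c f : pol f -> Lap (fun g => c * f g) = fun g => c * Lap f g.
Proof.
move=> pf; apply/funext => g; rewrite /Lap !(D_scale _ _ pf).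
by rewrite !(fun A => D_scale _ _ (pol_lie A pf)); ring.
Qed.

Lemma Lap_sum (I : finType) (F : I -> G -> C) : (forall i, pol (F i)) ->
  Lap (fun g => \sum_i F i g) = fun g => \sum_i Lap (F i) g.
Proof.
move=> pF; apply/funext => g; rewrite /Lap !(D_sum _ pF).
rewrite !(fun A => D_sum _ (fun i => pol_lie A (pF i))).
by rewrite !sumrB sumrN.
Qed.

(** L is the Casimir operator: it commutes with all left-invariant fields. *)
Lemma Lap_comm A f : pol f -> D A (Lap f) = Lap (D A f).
Proof.
move=> pf; have p A1 : pol (D A1 f) := pol_lie A1 pf.
have p2 A1 A2 : pol (D A1 (D A2 f)) := pol_lie A1 (p A2).
have DL B g : D B (Lap f) g =
    - D B (D X (D X f)) g - D B (D Y (D Y f)) g - D B (D Z (D Z f)) g.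
  have pX : pol (fun g => - 1 * D X (D X f) g) by exact: polZ.
  have pY : pol (fun g => - 1 * D Y (D Y f) g) by exact: polZ.
  have pZ : pol (fun g => - 1 * D Z (D Z f) g) by exact: polZ.
  have -> : Lap f = fun g => (- 1 * D X (D X f) g + - 1 * D Y (D Y f) g) +
      - 1 * D Z (D Z f) g by apply/funext => x; rewrite !mulN1r.
  by rewrite (D_add _ (polD pX pY) pZ) (D_add _ pX pY) !D_scale // !mulN1r.
have XL g : D X (Lap f) g = Lap (D X f) g.
  have e1 : D X (D Y (D Y f)) g =
      D Y (D Y (D X f)) g + D Y (D Z f) g + D Z (D Y f) g.
    by rewrite (D_XY (p Y)) (D_XY pf) (D_add _ (p2 _ _) (p _)).
  have e2 : D Z (D Z (D X f)) g =
      D X (D Z (D Z f)) g + D Y (D Z f) g + D Z (D Y f) g.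
    by rewrite (D_ZX pf) (D_add _ (p2 _ _) (p _)) (D_ZX (p Z)).
  rewrite DL e1 /Lap e2.
  move: (D X (D X (D X f)) g) (D Y (D Y (D X f)) g) (D X (D Z (D Z f)) g).
  by move: (D Y (D Z f) g) (D Z (D Y f) g) => a b c d k; ring.
have YL g : D Y (Lap f) g = Lap (D Y f) g.
  have e1 : D Y (D Z (D Z f)) g =
      D Z (D Z (D Y f)) g + D Z (D X f) g + D X (D Z f) g.
    by rewrite (D_YZ (p Z)) (D_YZ pf) (D_add _ (p2 _ _) (p _)).
  have e2 : D X (D X (D Y f)) g =
      D Y (D X (D X f)) g + D Z (D X f) g + D X (D Z f) g.
    by rewrite (D_XY pf) (D_add _ (p2 _ _) (p _)) (D_XY (p X)).
  rewrite DL e1 /Lap e2.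
  move: (D Y (D Y (D Y f)) g) (D Z (D Z (D Y f)) g) (D Y (D X (D X f)) g).
  by move: (D Z (D X f) g) (D X (D Z f) g) => a b c d k; ring.
have ZL g : D Z (Lap f) g = Lap (D Z f) g.
  have e1 : D Z (D X (D X f)) g =
      D X (D X (D Z f)) g + D X (D Y f) g + D Y (D X f) g.
    by rewrite (D_ZX (p X)) (D_ZX pf) (D_add _ (p2 _ _) (p _)).
  have e2 : D Y (D Y (D Z f)) g =
      D Z (D Y (D Y f)) g + D X (D Y f) g + D Y (D X f) g.
    by rewrite (D_YZ pf) (D_add _ (p2 _ _) (p _)) (D_YZ (p Y)).
  rewrite DL e1 /Lap e2.
  move: (D Z (D Z (D Z f)) g) (D X (D X (D Z f)) g) (D Z (D Y (D Y f)) g).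
  by move: (D X (D Y f) g) (D Y (D X f) g) => a b c d k; ring.
have E := frame_span XYZ A.
rewrite (D_lincomb pf E) (D_lincomb (pol_Lap pf) E).
apply/funext => g; rewrite XL YL ZL.
by rewrite (Lap_add (polD (polZ _ (p X)) (polZ _ (p Y))) (polZ _ (p Z)))
  (Lap_add (polZ _ (p X)) (polZ _ (p Y))) !(Lap_scale _ (p _)).
Qed.

(** The defect of the Leibniz rule for the Laplacian, see [Lap_mul]. *)
Definition grad_dot f h g := D X f g * D X h g + D Y f g * D Y h g + D Z f g * D Z h g.

Lemma Lap_mul f h : pol f -> pol h -> Lap (fun g => f g * h g) =
  fun g => f g * Lap h g + h g * Lap f g - 2 * grad_dot f h g.
Proof.
move=> pf ph; apply/funext => g; rewrite /Lap /grad_dot !(D_mul _ pf ph).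
have pA A := pol_lie A pf; have qA A := pol_lie A ph.
rewrite !(fun A => D_add _ (polM (pA A) ph) (polM pf (qA A))).
rewrite !(fun A => D_mul _ (pA A) ph) !(fun A => D_mul _ pf (qA A)).
move: (f g) (h g) (D X f g) (D Y f g) (D Z f g) (D X h g) (D Y h g) (D Z h g).
move: (D X (D X f) g) (D Y (D Y f) g) (D Z (D Z f) g) (D X (D X h) g).
by move: (D Y (D Y h) g) (D Z (D Z h) g) => *; ring.
Qed.

(** Each of X, Y and Z squares to - 1/4 as a matrix. *)
Lemma Lap_tr (M : M2) : Lap (fun g => \tr (M *m g)) =
  fun g => (3 / 4)%:C * \tr (M *m g).
Proof.
apply/funext => g; rewrite /Lap !D_tr !mulmxA.
rewrite (frame_sqr XYZ (or_introl erefl)).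
rewrite (frame_sqr XYZ (or_intror (or_introl erefl))).
rewrite (frame_sqr XYZ (or_intror (or_intror erefl))).
rewrite -!scalemxAl mul1mx !mxtraceZ; set t := \tr _.
rewrite !rmorphN /= !mulNr !opprK -!mulrDl -!rmorphD.
by congr (_%:C * _); field.
Qed.

(** The pairing of the gradients of two matrix coefficients is, up to a
    constant, minus a quarter of their product: the constant is a polarised
    determinant, because det g = 1. *)
Lemma grad_dot_tr (M N : M2) : exists d : C, forall g : G,
  grad_dot (fun g => \tr (M *m g)) (fun g => \tr (N *m g)) g =
  d - (4^-1)%:C * (\tr (M *m g) * \tr (N *m g)).
Proof.
exists ((2^-1)%:C * (\det (M + N) - \det M - \det N)) => g.
have [_ dg] := SU2P g.
rewrite /grad_dot !D_tr.
have trA (P : M2) A : \tr ((A : M2) *m P *m g) = \tr ((P *m g) *m A).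
  by rewrite -mulmxA mxtrace_mulC.
rewrite !trA (frame_fierz XYZ).
have := det2D (M *m g) (N *m g).
rewrite -mulmxDl !det_mulmx dg !mulr1 => <-.
have -> : (2^-1)%:C = (4^-1)%:C + (4^-1)%:C :> C.
  by rewrite -rmorphD; congr (_%:C); field.
by move: (\tr (M *m g)) (\tr (N *m g)) (\tr (M *m g *m (N *m g))) => a b c; ring.
Qed.

(** By the Leibniz rule each of the n factors of a monomial contributes the product
    in [grad_dot_tr], up to terms of lower degree. *)
Lemma grad_dot_lower n (M : M2) f : polyfun n f -> polyfun n
  (fun g => grad_dot (fun g => \tr (M *m g)) f g + (n%:R / 4)%:C * (\tr (M *m g) * f g)).
Proof.
have pM := pol_tr M.
elim=> {n f} [n c|n N f pf IH|n f h pf IHf ph IHh].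
- case: n => [|n].
    have := polyfun_cst 0 (0 : C); congr (polyfun 0 _); apply/funext => g.
    by rewrite /grad_dot !D_cst !mulr0 !addr0 mulr0n mul0r rmorph0 mul0r addr0.
  have := polyfun_tr M (polyfun_cst n ((n.+1%:R / 4)%:C * c)).
  congr (polyfun _ _); apply/funext => g.
  by rewrite /grad_dot !D_cst !mulr0 !add0r; ring.
- have [d E] := grad_dot_tr M N; have pf' : pol f by exists n.
  have h1 : polyfun n.+1 (fun g => d * f g).
    by apply: polyfun_scale; apply: polyfun_leq pf; exact: leqnSn.
  have := polyfun_add h1 (polyfun_tr N IH); congr (polyfun _ _).
  apply/funext => g; rewrite [in RHS]/grad_dot !(D_mul _ (pol_tr N) pf').
  have -> : d = grad_dot (fun g => \tr (M *m g)) (fun g => \tr (N *m g)) g +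
      (4^-1)%:C * (\tr (M *m g) * \tr (N *m g)) by rewrite E subrK.
  have -> : (n.+1%:R / 4)%:C = (n%:R / 4)%:C + (4^-1)%:C :> C.
    by rewrite -rmorphD -natr1; congr (_%:C); field.
  rewrite /grad_dot.
  move: (\tr (M *m g)) (\tr (N *m g)) (f g) (D X f g) (D Y f g) (D Z f g).
  move: (D X (fun g => \tr (M *m g)) g) (D Y (fun g => \tr (M *m g)) g).
  move: (D Z (fun g => \tr (M *m g)) g) (D X (fun g => \tr (N *m g)) g).
  move: (D Y (fun g => \tr (N *m g)) g) (D Z (fun g => \tr (N *m g)) g) => *; ring.
- have := polyfun_add IHf IHh; congr (polyfun _ _); apply/funext => g.
  rewrite /grad_dot !D_add; [|by exists n..].
  move: (\tr (M *m g)) (f g) (D X f g) (D Y f g) (D Z f g).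
  move: (D X (fun g => \tr (M *m g)) g) (D Y (fun g => \tr (M *m g)) g).
  move: (D Z (fun g => \tr (M *m g)) g) (h g) (D X h g) (D Y h g) (D Z h g) => *; ring.
Qed.

(** The eigenvalue of the Laplacian on the matrix coefficients of the irreducible
    representation of dimension n + 1. *)
Definition lam (n : nat) : R := n%:R * (n%:R + 2) / 4.

(** A new factor contributes its own eigenvalue 3/4 and, through the gradient term,
    n/2; indeed lam (n + 1) = lam n + 3/4 + n/2. *)
Lemma Lap_lower n f : polyfun n f ->
  polyfun n.-1 (fun g => Lap f g - (lam n)%:C * f g).
Proof.
elim=> {n f} [n c|n M f pf IH|n f h pf IHf ph IHh].
- have := polyfun_cst n.-1 (- (lam n)%:C * c); congr (polyfun _ _).
  apply/funext => g; rewrite /Lap !D_cst; ring.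
- have pf' : pol f by exists n.
  have h1 : polyfun n (fun g => \tr (M *m g) * (Lap f g - (lam n)%:C * f g)).
    case: n pf IH {pf'} => [|n] pf IH; last exact: polyfun_tr.
    suff E : (fun g => Lap f g - (lam 0)%:C * f g) = fun=> 0.
      have := polyfun_cst 0 (0 : C); congr (polyfun 0 _); apply/funext => g.
      by have /(congr1 (fun k => k g)) /= -> := E; rewrite mulr0.
    have [c ->] := polyfun0_cst pf; apply/funext => g.
    by rewrite /Lap !D_cst /lam mul0r mul0r mul0r; ring.
  have h2 := polyfun_scale (- 2) (grad_dot_lower M pf).
  have := polyfun_add h1 h2; congr (polyfun _ _); apply/funext => g /=.
  rewrite (Lap_mul (pol_tr M) pf') Lap_tr.
  have -> : lam n.+1 = lam n + 3 / 4 + 2 * (n%:R / 4) by rewrite /lam -natr1; field.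
  rewrite !rmorphD [X in _ = _ - (_ + X) * _]rmorphM /=.
  have -> : (2 : R)%:C = 2 :> C by rewrite rmorph_nat.
  move: (\tr (M *m g)) (f g) (Lap f g) (grad_dot _ _ g) => *; ring.
- have := polyfun_add IHf IHh; congr (polyfun _ _); apply/funext => g /=.
  rewrite Lap_add; [|by exists n..].
  by move: (f g) (h g) (Lap f g) (Lap h g) => *; ring.
Qed.

Definition eigL (l : R) f := pol f /\ Lap f = fun g => l%:C * f g.

Definition eigZ (m : R) f := D Z f = fun g => (0 +i* m) * f g.

(** Finite sums without an index type, to be built by induction; [sums_family]
    recovers a family. *)
Inductive sums (P : (G -> C) -> Prop) : (G -> C) -> Prop :=
| sums_one f : P f -> sums P f
| sums_add f h : sums P f -> sums P h -> sums P (fun g => f g + h g).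

Lemma sums_family P f : sums P f -> exists (I : finType) (F : I -> G -> C),
  (forall i, P (F i)) /\ f = fun g => \sum_i F i g.
Proof.
elim=> {f} [f Pf|f h _ [I [F [PF ->]]] _ [J [H [PH ->]]]].
  exists unit, (fun=> f); split=> //; apply/funext => g.
  by rewrite (big_pred1 tt) //; case.
exists (I + J)%type, (fun k => match k with inl i => F i | inr j => H j end).
split; first by case.
by apply/funext => g; rewrite big_sumType.
Qed.

Lemma sums_impl (P Q : (G -> C) -> Prop) f :
  (forall h, P h -> Q h) -> sums P f -> sums Q f.
Proof.
move=> PQ; elim=> {f} [f /PQ|f h _ IHf _ IHh]; first exact: sums_one.
exact: sums_add.
Qed.

Lemma sums_bind (P Q : (G -> C) -> Prop) f :
  (forall h, P h -> sums Q h) -> sums P f -> sums Q f.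
Proof. by move=> PQ; elim=> {f} [f /PQ|f h _ IHf _ IHh] //; exact: sums_add. Qed.

(** The matrix Z has the eigenvalues +- i/2, so every function tr (M g) is the
    sum of two such functions that are eigenfunctions of the field Z. *)
Lemma weight_decomposition n f : polyfun n f ->
  sums (fun h => polyfun n h /\ exists m, eigZ m h) f.
Proof.
elim=> {n f} [n c|n M f pf IH|n f h pf IHf ph IHh].
- apply: sums_one; split; first exact: polyfun_cst.
  exists 0; rewrite /eigZ D_cst; apply/funext => g.
  by rewrite (_ : 0 +i* 0 = 0) // mul0r.
- have ZZ := frame_sqr XYZ (or_intror (or_intror erefl)).
  pose N (s : R) : M2 := (2^-1)%:C *: M + (0 +i* s) *: ((Z : M2) *m M).
  have eN (s : R) : s * s = 1 -> (Z : M2) *m N s = (0 +i* (- s / 2)) *: N s.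
    move=> ss; rewrite /N mulmxDr -!scalemxAr mulmxA ZZ -scalemxAl mul1mx.
    rewrite scalerDr !scalerA addrC; congr (_ *: _ + _ *: _).
      by apply: complexP => /=; field.
    by apply: complexP => /=; last ring; transitivity (2^-1 * (s * s)); [rewrite ss mulr1; ring|field].
  have eM g : \tr (M *m g) = \tr (N 1 *m g) + \tr (N (-1) *m g).
    rewrite -raddfD -mulmxDl /= /N addrACA -!scalerDl.
    have -> : (2^-1)%:C + (2^-1)%:C = 1 :> C by rewrite -rmorphD; congr (_%:C); field.
    have -> : (0 +i* 1) + (0 +i* -1) = 0 :> C by apply: complexP => /=; ring.
    by rewrite scale1r scale0r addr0.
  elim: IH => {f pf} [f [pf [m Zf]]|f h _ IHf _ IHh].
    have -> : (fun g : G => \tr (M *m g) * f g) =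
        fun g => \tr (N 1 *m g) * f g + \tr (N (-1) *m g) * f g.
      by apply/funext => g; rewrite eM mulrDl.
    have H s : s * s = 1 -> polyfun n.+1 (fun g : G => \tr (N s *m g) * f g) /\
        exists m, eigZ m (fun g : G => \tr (N s *m g) * f g).
      move=> ss; split; first exact: polyfun_tr.
      exists (- s / 2 + m); rewrite /eigZ D_mul; [|exact: pol_tr|by exists n].
      apply/funext => g; rewrite D_tr Zf (eN _ ss) -scalemxAl mxtraceZ.
      have -> : 0 +i* (- s / 2 + m) = (0 +i* (- s / 2)) + (0 +i* m) :> C.
        by apply: complexP => /=; ring.
      by move: (\tr _) (f g) => a b; ring.
    by apply: sums_add; apply: sums_one; apply: H; ring.
  have -> : (fun g : G => \tr (M *m g) * (f g + h g)) =
      fun g => \tr (M *m g) * f g + \tr (M *m g) * h g.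
    by apply/funext => g; rewrite mulrDr.
  exact: sums_add.
- exact: sums_add.
Qed.

Lemma lam_lt k n : (k < n)%N -> lam k < lam n.
Proof.
move=> kn; have h : (k%:R + 1 <= n%:R :> R) by rewrite natr1 ler_nat.
have k0 : 0 <= k%:R :> R by [].
by rewrite /lam -subr_gt0; nra.
Qed.

Lemma lam_ge0 n : 0 <= lam n.
Proof. by rewrite /lam !mulr_ge0 // ?addr_ge0 // ?invr_ge0. Qed.

Lemma eigZ_lin m f h a b : pol f -> pol h -> eigZ m f -> eigZ m h ->
  eigZ m (fun g => a * f g + b * h g).
Proof.
move=> pf ph Zf Zh; rewrite /eigZ D_add; [|exact: polZ|exact: polZ].
by apply/funext => g; rewrite !D_scale // Zf Zh; ring.
Qed.

Definition eigen_piece n m h : Prop := [/\ polyfun n h, eigZ m h &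
  exists k, [/\ (k <= n)%N, eigL (lam k) h & k = 0%N -> exists c, h = fun=> c]].

(** A function of degree n is the sum of its components in the eigenspaces
    lam 0, ..., lam n: since Lap - lam n lowers the degree, it can be inverted on
    the image by induction, where the eigenvalues are smaller. *)
Lemma eigen_decomposition n m f : polyfun n f -> eigZ m f ->
  sums (eigen_piece n m) f.
Proof.
elim: n f => [|n IH] f pf Zf.
  have pf' : pol f by exists 0%N.
  have [c E] := polyfun0_cst pf.
  apply: sums_one; split=> //; exists 0%N; split=> //; last by exists c.
  split=> //; apply/funext => g; rewrite E /Lap !D_cst /lam mul0r mul0r mul0r; ring.
have pf' : pol f by exists n.+1.
set P := (X in sums X); set mu := lam n.+1.
pose g0 g := Lap f g - mu%:C * f g.
have pg0 : polyfun n g0 := Lap_lower pf.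
have Zg0 : eigZ m g0.
  have pL := pol_Lap pf'.
  rewrite /eigZ (_ : g0 = fun g => 1 * Lap f g + (- mu%:C) * f g).
    apply: eigZ_lin => //; rewrite /eigZ Lap_comm // Zf Lap_scale //.
  by apply/funext => g; rewrite /g0; ring.
have {IH} := IH _ pg0 Zg0.
have solve h : sums (eigen_piece n m) h ->
    exists r, [/\ sums P r, polyfun n.+1 r, eigZ m r &
      forall g, Lap r g - mu%:C * r g = h g].
  elim=> {h} [h [ph Zh [k [kn [ph' Lh] hc]]]|h h' _ [r [sr pr Zr Er]] _ [r' [sr' pr' Zr' Er']]].
    have d0 : lam k - mu != 0 by rewrite subr_eq0 lt_eqF // lam_lt.
    pose c : C := ((lam k - mu)^-1)%:C.
    have pr : polyfun n.+1 (fun g => c * h g).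
      by apply: polyfun_scale; apply: polyfun_leq ph.
    have Zr : eigZ m (fun g => c * h g).
      by rewrite /eigZ D_scale // Zh; apply/funext => g; ring.
    exists (fun g => c * h g); split=> //.
      apply: sums_one; split=> //; exists k; split; first exact: leqW.
        split; first by exists n.+1.
        by rewrite Lap_scale // Lh; apply/funext => g; ring.
      by move=> /hc[z ->]; exists (c * z).
    move=> g; rewrite Lap_scale // Lh.
    transitivity ((c * (lam k - mu)%:C) * h g); first by rewrite rmorphB; ring.
    by rewrite -rmorphM mulVf // mul1r.
  exists (fun g => r g + r' g); split.
  - exact: sums_add.
  - exact: polyfun_add.
  - have -> : (fun g => r g + r' g) = fun g => 1 * r g + 1 * r' g.
      by apply/funext => g; rewrite !mul1r.
    by apply: eigZ_lin => //; exists n.+1.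
  - move=> g; rewrite Lap_add; [|by exists n.+1|by exists n.+1].
    by rewrite -Er -Er'; ring.
move=> /solve[r [sr pr Zr Er]]; have pr' : pol r by exists n.+1.
rewrite (_ : f = fun g => (1 * f g + - 1 * r g) + r g); last first.
  by apply/funext => g; ring.
apply: sums_add => //; apply: sums_one; split.
- by apply: polyfun_add; exact: polyfun_scale.
- exact: eigZ_lin.
- exists n.+1; split=> //; split; first by apply: polD; exact: polZ.
  rewrite Lap_add; [|exact: polZ|exact: polZ].
  apply/funext => g; rewrite !Lap_scale // -/mu.
  have := Er g; rewrite /g0; move: (Lap r g) (r g) (Lap f g) (f g) => a b c d E.
  have -> : a = (c - mu%:C * d) + mu%:C * b by rewrite -E; ring.
  by ring.
Qed.

(** The last clause records that the kernel of the Laplacian consists of the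
    constants, which is what separates the mean value from the rest. *)
Definition joint_eig (l m : R) f := [/\ eigL l f, eigZ m f, 0 <= l &
  l = 0 -> exists c, f = fun=> c].

(** Weights for Z are separated before the eigenspaces of the Laplacian, which
    commutes with Z. *)
Theorem pol_decomposition f : pol f -> exists (I : finType) (l m : I -> R)
    (F : I -> G -> C), (forall i, joint_eig (l i) (m i) (F i)) /\
  f = fun g => \sum_i F i g.
Proof.
move=> [n pf].
have : sums (fun h => exists l m, joint_eig l m h) f.
  apply: sums_bind (weight_decomposition pf) => h [ph [m Zh]].
  apply: sums_impl (eigen_decomposition ph Zh) => k [pk Zk [j [_ Lk kc]]].
  exists (lam j), m; split=> //; first exact: lam_ge0.
  case: j {Lk} kc => [kc _|j _ l0]; first exact: kc.
  by have := lam_lt (ltn0Sn j); rewrite l0 /lam !mul0r ltxx.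
move=> /sums_family[I [F [PF ->]]].
have [l hl] := choice PF; have [m hm] := choice hl.
by exists I, l, m, F.
Qed.

End spectral.

(** * The maximum principle for functions of the Laplacian *)

Section maximum.
Variable R : realType.
Local Notation C := R[i].
Local Notation G := (SU2 R).
Local Notation D := (@dl R).

Lemma SU2_max (F : G -> R) : continuous F -> exists g, forall h, F h <= F g.
Proof.
move=> Fc.
have [||g _ H] := @compact_EVT_max G R F [set: G] _ (@SU2_compact R).
- by exists (SU2_one R).
- exact: continuous_subspaceT.
- by exists g => h; apply: H; rewrite inE.
Qed.

Lemma slab_max (F : R * G -> R) (T : R) : 0 <= T -> continuous F ->
  exists (t : R) (g : G), 0 <= t <= T /\ forall (s : R) h, 0 <= s <= T -> F (s, h) <= F (t, g).
Proof.
move=> T0 Fc.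
have cK : compact (`[0, T]%classic `*` [set: G] : set (R * G)).
  by apply: compact_setX; [exact: segment_compact|exact: SU2_compact].
have [||[t g] tg H] := @compact_EVT_max _ R F _ _ cK.
- by exists (0, SU2_one R); split=> //=; rewrite in_itv /= lexx.
- exact: continuous_subspaceT.
move: tg; rewrite inE => -[/=]; rewrite in_itv /= => t0T _.
by exists t, g; split=> // s h sT; apply: H; rewrite inE; split; rewrite //= in_itv.
Qed.

Lemma SU2_bounded (f : G -> C) : contC f -> exists K : R, 0 <= K /\ forall g, nm (f g) <= K.
Proof.
move=> /contC_nm/SU2_max[g H]; exists (nm (f g)); split=> //; exact: nm_ge0.
Qed.

Lemma realC_mulA (x y : R) (z : C) : x%:C * (y%:C * z) = (x * y)%:C * z.
Proof. by rewrite rmorphM mulrA. Qed.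

Lemma D_isCd A f g : lie_diff f -> isCd (fun t => f (translate A g t)) 0 (D A f g).
Proof. by move=> df; rewrite dlE. Qed.

Lemma D_isCd_at A f g t : lie_diff f ->
  isCd (fun t => f (translate A g t)) t (D A f (translate A g t)).
Proof. by move=> df; rewrite dlE; exact: lie_diff_at. Qed.

Lemma is_derive_sum (I : finType) (F : I -> R -> R) (dF : I -> R) (x : R) :
  (forall i, is_derive x 1 (F i) (dF i)) ->
  is_derive x 1 (fun t => \sum_i F i t) (\sum_i dF i).
Proof.
move=> H; rewrite /index_enum; elim: (Finite.enum I) => [|i r IH].
  rewrite big_nil (_ : (fun t => _) = fun=> 0); first exact: is_derive_cst.
  by apply/funext => s; rewrite big_nil.
rewrite big_cons (_ : (fun t => _) = fun s => F i s + \sum_(j <- r) F j s).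
  exact: is_deriveDE.
by apply/funext => s; rewrite big_cons.
Qed.

Lemma is_deriveZE (c : R) (f : R -> R) (x a : R) : is_derive x 1 f a ->
  is_derive x 1 (fun t => c * f t) (c * a).
Proof.
move=> fa; apply: (is_derive_eq (is_deriveME (is_derive_cstE x 1 c) fa)).
by rewrite mul0r add0r.
Qed.

(** First and second order conditions at a maximum of a weighted sum of squared
    moduli, along a one-parameter subgroup. *)
Lemma space_max (I : finType) (c : I -> R) (u : I -> G -> C) g A :
  (forall i, pol (u i)) ->
  (forall h, \sum_i c i * nm (u i h) ^+ 2 <= \sum_i c i * nm (u i g) ^+ 2) ->
  \sum_i c i * dot (u i g) (D A (u i) g) = 0 /\
  \sum_i c i * (nm (D A (u i) g) ^+ 2 + dot (u i g) (D A (D A (u i)) g)) <= 0.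
Proof.
move=> pu mx; pose tr t := translate A g t.
pose F t := \sum_i c i * nm (u i (tr t)) ^+ 2.
pose F' t := \sum_i c i * (2 * dot (u i (tr t)) (D A (u i) (tr t))).
have dF (t : R) : is_derive t 1 F (F' t).
  apply: is_derive_sum => i; apply: is_deriveZE.
  by apply: (isCd_sqr (D_isCd_at A g t _)); exact: pol_diff.
have dF' : is_derive (0 : R) 1 F' (\sum_i c i * (2 *
    (nm (D A (u i) g) ^+ 2 + dot (u i g) (D A (D A (u i)) g)))).
  apply: is_derive_sum => i; do 2 apply: is_deriveZE.
  have d0 := D_isCd A g (pol_diff (pu i)).
  have d1 := D_isCd A g (pol_diff (pol_lie A (pu i))).
  by have := isCd_dot d0 d1; rewrite !translate0 dotxx.
have mxF t : 0 - 1 < t < 0 + 1 -> F t <= F 0.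
  by move=> _; rewrite /F /tr translate0; exact: mx.
have [] := max_derive2 ltr01 (fun t _ => dF t) dF' mxF.
rewrite /F' /tr translate0.
under eq_bigr do rewrite mulrCA; rewrite -mulr_sumr.
under [X in _ -> X <= 0 -> _]eq_bigr do rewrite mulrCA.
rewrite -mulr_sumr => /eqP; rewrite mulf_eq0 pnatr_eq0 /= => /eqP -> h.
by split=> //; rewrite -(pmulr_rle0 _ (ltr0n R 2)).
Qed.

End maximum.

Section dissipative.
Variable R : realType.
Local Notation C := R[i].
Local Notation G := (SU2 R).
Local Notation D := (@dl R).
Variables X Y Z : su2 R.
Hypothesis XYZ : su2_frame X Y Z.
Local Notation Lap := (Lap X Y Z).
Local Notation eigL := (eigL X Y Z).

(** At a maximum of |u| the second derivative of |u|^2 along each field of the frame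
    is nonpositive. *)
Lemma dot_Lap_ge0 u g : pol u -> (forall h, nm (u h) <= nm (u g)) ->
  0 <= dot (u g) (Lap u g).
Proof.
move=> pu mx.
have H A : dot (u g) (D A (D A u) g) <= 0.
  have [||_] := @space_max R unit (fun=> 1) (fun=> u) g A.
  - by [].
  - move=> h; rewrite !(big_pred1 tt) //; do ?by case.
    by rewrite !mul1r ler_pXn2r ?nnegrE ?nm_ge0.
  - rewrite (big_pred1 tt); last by case.
    by rewrite mul1r; apply: le_trans; rewrite lerDr sqr_ge0.
by rewrite /Lap !dotDr !dotNr; have := (H X, H Y, H Z) => -[[h1 h2] h3]; lra.
Qed.

Definition lc (I : finType) (c : I -> C) (F : I -> G -> C) (g : G) : C :=
  \sum_i c i * F i g.

Definition eigfam (I : finType) (l : I -> R) (F : I -> G -> C) : Prop :=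
  forall i, eigL (l i) (F i) /\ 0 <= l i.

Section families.
Variables (I : finType) (l : I -> R) (F : I -> G -> C).
Hypothesis EF : eigfam l F.

Lemma eigfam_pol i : pol (F i). Proof. by have [[]] := EF i. Qed.

Lemma lc_pol c : pol (lc c F).
Proof. by apply: pol_sum => i; apply: polZ; exact: eigfam_pol. Qed.

Lemma eigfam_scale (c : I -> C) : eigfam l (fun i g => c i * F i g).
Proof.
move=> i; have [[p L] l0] := EF i; split=> //; split; first exact: polZ.
by rewrite Lap_scale // L; apply/funext => g; rewrite mulrCA.
Qed.

Lemma Lap_lc c : Lap (lc c F) = lc (fun i => (l i)%:C * c i) F.
Proof.
rewrite Lap_sum; last by move=> i; apply: polZ; exact: eigfam_pol.
apply/funext => g; apply: eq_bigr => i _; have [[p L] _] := EF i.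
by rewrite Lap_scale // L; ring.
Qed.

Lemma D_lc A c : D A (lc c F) = lc c (fun i => D A (F i)).
Proof.
rewrite D_sum; last by move=> i; apply: polZ; exact: eigfam_pol.
by apply/funext => g; apply: eq_bigr => i _; rewrite D_scale //; exact: eigfam_pol.
Qed.

Lemma lc_add (c d : I -> C) g : lc (fun i => c i + d i) F g = lc c F g + lc d F g.
Proof. by rewrite /lc -big_split; apply: eq_bigr => i _; rewrite mulrDl. Qed.

Lemma lc_scale (a : C) (c : I -> C) g : lc (fun i => a * c i) F g = a * lc c F g.
Proof. by rewrite /lc mulr_sumr; apply: eq_bigr => i _; rewrite mulrA. Qed.

Lemma lc_eq (c d : I -> C) g : c =1 d -> lc c F g = lc d F g.
Proof. by move=> cd; apply: eq_bigr => i _; rewrite cd. Qed.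

End families.

Lemma eigfam_D (I : finType) (l : I -> R) (F : I -> G -> C) A :
  eigfam l F -> eigfam l (fun i => D A (F i)).
Proof.
move=> EF i; have [[p L] l0] := EF i; split=> //; split; first exact: pol_lie.
by rewrite -Lap_comm // L D_scale.
Qed.

(** b(L) - 1 is accretive for the sup norm: at a maximum point of |u| the real
    part of (b(L) u - u) conj u is nonnegative. *)
Definition accretive (b : R -> R) : Prop :=
  forall (I : finType) (l : I -> R) (F : I -> G -> C), eigfam l F ->
  forall (c : I -> C) g, (forall h, nm (lc c F h) <= nm (lc c F g)) ->
  nm (lc c F g) ^+ 2 <= dot (lc c F g) (lc (fun i => (b (l i))%:C * c i) F g).

Lemma accretive_Bessel : accretive (fun l => 1 + l).
Proof.
move=> I l F EF c g mx; have := dot_Lap_ge0 (lc_pol EF c) mx.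
rewrite (Lap_lc EF) => h.
have -> : lc (fun i => (1 + l i)%:C * c i) F g =
    lc (fun i => c i + (l i)%:C * c i) F g.
  by apply: lc_eq => i; rewrite rmorphD mulrDl rmorph1 mul1r.
by rewrite lc_add dotDr dotxx lerDl.
Qed.

Lemma expR_bound (a K s : R) : 0 < a -> 0 <= K -> 0 < s ->
  exists Y0 : R, 0 <= Y0 /\ forall y : R, Y0 <= y -> expR (- (a * y)) * K < s.
Proof.
move=> a0 K0 s0; exists (K / (s * a)); split.
  by rewrite divr_ge0 // mulr_ge0 // ltW.
move=> y hy; rewrite expRN mulrC ltr_pdivrMr ?expR_gt0 //.
have y0 : K <= s * (a * y) by move: hy; rewrite ler_pdivrMr ?mulr_gt0 // mulrC mulrA.
have := expR_ge1Dx (a * y) => h.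
apply: (le_lt_trans y0); rewrite ltr_pM2l //; apply: lt_le_trans h; lra.
Qed.

Lemma is_derive_expR (a y : R) : is_derive y 1 (fun y => expR (y * a)) (a * expR (y * a)).
Proof.
have d := is_derive_affine a 0 y.
have := is_derive_compE d (is_derive_expR _).
rewrite mulrC addr0 [a * y]mulrC; congr (is_derive _ _ _ _).
by apply/funext => s; rewrite addr0 mulrC.
Qed.

Lemma le_of_lt1_mul (n d : R) : 0 <= n ->
  (forall th : R, 0 <= th < 1 -> th * n <= d) -> n <= d.
Proof.
move=> n0 H; rewrite leNgt; apply/negP => dn.
have d0 : 0 <= d by have := H 0; rewrite mul0r; apply; rewrite lexx ltr01.
have np : 0 < n by apply: le_lt_trans dn.
have e0 : 0 < (n - d) / (2 * n) by rewrite divr_gt0 ?subr_gt0 // mulr_gt0.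
have e1 : (n - d) / (2 * n) <= 1 by rewrite ler_pdivrMr ?mulr_gt0 //; lra.
have := H (1 - (n - d) / (2 * n)).
rewrite (_ : (1 - _) * n = (n + d) / 2); last by field; rewrite gt_eqF.
move=> h; have : (n + d) / 2 <= d by apply: h; rewrite subr_ge0 e1 ltrBlDr ltrDl e0.
lra.
Qed.

(** Accretivity passes to square roots: e^(-y sqrt(b(L))) u solves the elliptic
    equation v'' = b(L) v on a half line, so that the maximum of its modulus is
    reached for y = 0. The factor e^(th y) with th < 1 makes the maximum principle
    strict. *)
Lemma accretive_sqrt (b : R -> R) : (forall x : R, 0 <= x -> 1 <= b x) ->
  accretive b -> accretive (fun x => Num.sqrt (b x)).
Proof.
move=> b1 Hb I l F EF c g mx.
pose r i := Num.sqrt (b (l i)).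
have l0 i : 0 <= l i by have [] := EF i.
have r1 i : 1 <= r i by rewrite -sqrtr1 ler_wsqrtr // b1.
have rr i : r i * r i = b (l i) by rewrite -expr2 sqr_sqrtr // (le_trans ler01) ?b1.
set u := lc c F; pose n2 : R := nm (u g) ^+ 2; rewrite -/n2.
suff H (th : R) : 0 <= th < 1 -> th * n2 <= dot (u g) (lc (fun i => (r i)%:C * c i) F g).
  by apply: le_of_lt1_mul H; exact: sqr_ge0.
move=> /andP[th0 th1].
pose E i y := expR (y * (th - r i)).
pose v y := lc (fun i => (E i y)%:C * c i) F.
pose v1 y := lc (fun i => ((th - r i) * E i y)%:C * c i) F.
pose v2 y := lc (fun i => ((th - r i) * ((th - r i) * E i y))%:C * c i) F.
have realC (f : R -> R) (y d : R) : is_derive y 1 f d -> isCd (fun t => (f t)%:C) y d%:C.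
  by move=> h; split=> //=; exact: is_derive_cst.
have dv y h : isCd (fun y => v y h) y (v1 y h).
  apply: isCd_sum => i; apply: (isCd_eq (isCdM (isCdM (realC _ _ _
    (is_derive_expR (th - r i) y)) (isCd_cst _ _)) (isCd_cst _ _))).
  by rewrite !mulr0 !addr0.
have dv1 y h : isCd (fun y => v1 y h) y (v2 y h).
  apply: isCd_sum => i; apply: (isCd_eq (isCdM (isCdM (realC _ _ _
    (is_deriveZE (th - r i) (is_derive_expR (th - r i) y))) (isCd_cst _ _)) (isCd_cst _ _))).
  by rewrite !mulr0 !addr0.
have v0 : v 0 = u.
  by apply/funext => h; apply: lc_eq => i; rewrite /E mul0r expR0 mul1r.
have vc : contC (fun p : R * G => v p.1 p.2).
  apply: contC_sum => i; apply: contCM; last first.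
    by apply: (contC_comp (pol_contC (eigfam_pol EF i))) => p; exact: cvg_snd.
  apply: contCM; last exact: contC_cst.
  apply: contC_real => p.
  have e1 : {for p, continuous (fun p : R * G => p.1 * (th - r i))}.
    by apply: contM => q; [exact: cvg_fst|exact: cvg_cst].
  exact: (@continuous_comp _ _ _ (fun p : R * G => p.1 * (th - r i)) expR p e1 (@continuous_expR _ _)).
have bound : exists K : R, 0 <= K /\ forall (y : R) h, 0 <= y ->
    nm (v y h) <= expR (- ((1 - th) * y)) * K.
  have hK i := SU2_bounded (pol_contC (polZ (c i) (eigfam_pol EF i))).
  have [K HK] := choice hK.
  exists (\sum_i K i); split; first by apply: sumr_ge0 => i _; have [] := HK i.
  move=> y h y0; apply: (le_trans (nm_sum _)); rewrite mulr_sumr.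
  apply: ler_sum => i _; rewrite -mulrA nmM nm_real ger0_norm ?expR_ge0 //.
  apply: ler_pM; [exact: expR_ge0|exact: nm_ge0| |by have [_] := HK i].
  rewrite ler_expR -mulNr mulrC; apply: ler_wpM2r => //; have := r1 i; lra.
have vM (y : R) h : 0 <= y -> nm (v y h) <= nm (u g).
  move=> y0; rewrite leNgt; apply/negP => hs; set s := nm (v y h) in hs.
  have s0 : 0 < s by apply: le_lt_trans hs; exact: nm_ge0.
  have [K [K0 HK]] := bound.
  have th10 : 0 < 1 - th by rewrite subr_gt0.
  have [Y0 [Y00 HY]] := expR_bound th10 K0 s0.
  pose T := Num.max y Y0 + 1.
  have yT : y < T by rewrite /T ltr_pwDr // le_max lexx.
  have YT : Y0 <= T by rewrite /T ler_wpDr // le_max lexx orbT.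
  have T0 : 0 <= T by apply: le_trans (ltW yT).
  have [t [k [/andP[t0 tT] mxt]]] := slab_max T0 (contC_sqr vc).
  have st : s <= nm (v t k).
    by rewrite -(ler_pXn2r (n := 2)) ?nnegrE ?nm_ge0 //; apply: mxt; rewrite y0 ltW.
  have t0' : 0 < t.
    rewrite lt_def t0 andbT; apply/eqP => t00; move: st; rewrite t00 v0 leNgt => /negP.
    by apply; exact: le_lt_trans (mx k) hs.
  have tT' : t < T.
    rewrite lt_neqAle tT andbT; apply/eqP => tT0; move: st; rewrite tT0 leNgt => /negP.
    by apply; apply: le_lt_trans (HK _ _ T0) (HY _ YT).
  have e0 : 0 < Num.min t (T - t) by rewrite lt_min t0' subr_gt0.
  have m1 : Num.min t (T - t) <= t by rewrite ge_min lexx.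
  have m2 : Num.min t (T - t) <= T - t by rewrite ge_min lexx orbT.
  pose N y := nm (v y k) ^+ 2; pose N1 y := 2 * dot (v y k) (v1 y k).
  have dN (y1 : R) : is_derive y1 1 N (N1 y1) by exact: isCd_sqr.
  have dN1 : is_derive t 1 N1 (2 * (nm (v1 t k) ^+ 2 + dot (v t k) (v2 t k))).
    by apply: is_deriveZE; have := isCd_dot (dv t k) (dv1 t k); rewrite dotxx.
  have mxN (y1 : R) : t - Num.min t (T - t) < y1 < t + Num.min t (T - t) -> N y1 <= N t.
    by move=> /andP[h1 h2]; apply: mxt; lra.
  have [N10 N20] := max_derive2 e0 (fun y1 _ => dN y1) dN1 mxN.
  have d0 : dot (v t k) (v1 t k) = 0 by move: N10; rewrite /N1; lra.
  have mxk h1 : nm (v t h1) <= nm (v t k).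
    rewrite -(ler_pXn2r (n := 2)) ?nnegrE ?nm_ge0 //; apply: mxt.
    by rewrite t0.
  (* At an interior maximum |v|^2 is critical and concave in y. Since
     b = r^2 = th^2 - 2 th (th - r) + (th - r)^2, accretivity of b would give
     |v|^2 <= th^2 |v|^2 - |v1|^2 there. *)
  have := Hb I l F EF _ k mxk.
  have -> : lc (fun i => (b (l i))%:C * ((E i t)%:C * c i)) F k =
      (th ^+ 2)%:C * v t k + (v2 t k + (- (2 * th))%:C * v1 t k).
    rewrite -!lc_scale -!lc_add; apply: lc_eq => i; rewrite -rr.
    rewrite !realC_mulA -!mulrDl -!rmorphD; congr (_%:C * _); ring.
  rewrite !dotDr !dotZr dotxx d0 mulr0 addr0 => H1.
  have n0 : 0 < nm (v t k) ^+ 2 by rewrite exprn_gt0 // (lt_le_trans s0).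
  have n1 := sqr_ge0 (nm (v1 t k)).
  have : th ^+ 2 * nm (v t k) ^+ 2 < nm (v t k) ^+ 2.
    by rewrite gtr_pMl // expr_lt1.
  by lra.
have dN0 := isCd_sqr (dv 0 g).
have := max_right_derive_le0 ltr01 dN0; rewrite v0 => H.
have {H} : 2 * dot (u g) (v1 0 g) <= 0.
  apply: H => t /andP[t0 _]; rewrite ler_pXn2r ?nnegrE ?nm_ge0 //.
  by apply: vM; exact: ltW.
have -> : v1 0 g = th%:C * u g + (-1)%:C * lc (fun i => (r i)%:C * c i) F g.
  rewrite -!lc_scale -!lc_add; apply: lc_eq => i; rewrite /E mul0r expR0 mulr1.
  by rewrite rmorphB rmorphN rmorph1; ring.
by rewrite dotDr !dotZr dotxx -/n2; lra.
Qed.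

Definition root (k : nat) (x : R) : R := (1 + x) `^ (2 ^- k).

Lemma root_ge1 k x : 0 <= x -> 1 <= root k x.
Proof.
move=> x0; rewrite -(powRr0 (1 + x)) /root; apply: ler_powR; first by rewrite lerDl.
by rewrite invr_ge0 exprn_ge0.
Qed.

Lemma powR_sqrt (x : R) : 0 <= x -> x `^ (2^-1) = Num.sqrt x.
Proof. by move=> x0; rewrite powR12_sqrt. Qed.

Lemma accretive_root k : accretive (root k).
Proof.
elim: k => [|k IH] I l F EF c g mx.
  have := accretive_Bessel EF mx; congr (_ <= dot _ _); apply: lc_eq => i.
  by have [_ l0] := EF i; rewrite /root expr0 invr1 powRr1 // addr_ge0.
have := accretive_sqrt (@root_ge1 k) IH EF mx.
congr (_ <= dot _ _); apply: lc_eq => i.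
have [_ l0] := EF i; congr (_%:C * _).
rewrite -powR_sqrt; last exact: powR_ge0.
by rewrite /root -powRrM exprSr invfM.
Qed.

Section accretive_bounds.
Variables (b : R -> R).
Hypothesis b_acc : accretive b.
Hypothesis b_ge1 : forall x : R, 0 <= x -> 1 <= b x.
Variables (I : finType) (l : I -> R) (F : I -> G -> C).
Hypothesis EF : eigfam l F.

(** Bounds at a maximum point are bounds everywhere. *)
Lemma max_bound (c d : I -> C) (s B : R) : 0 < s ->
  (forall g, (forall h, nm (lc c F h) <= nm (lc c F g)) ->
     s * nm (lc c F g) ^+ 2 <= dot (lc c F g) (lc d F g)) ->
  (forall g, nm (lc d F g) <= B) -> forall g, nm (lc c F g) <= B / s.
Proof.
move=> s0 H HB g; have [k mx] := SU2_max (contC_nm (pol_contC (lc_pol EF c))).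
apply: (le_trans (mx g)); rewrite ler_pdivlMr // mulrC.
have B0 : 0 <= B by apply: le_trans (HB g); exact: nm_ge0.
have := nm_ge0 (lc c F k); rewrite le_eqVlt => /predU1P[<-|n0]; first by rewrite mulr0.
rewrite -(ler_pM2l n0) mulrCA -expr2; apply: (le_trans (H k mx)).
apply: (le_trans (ler_dot _ _)); rewrite ler_pM2l //; exact: HB.
Qed.

Lemma accretive_le (c : I -> C) (B : R) :
  (forall g, nm (lc (fun i => (b (l i))%:C * c i) F g) <= B) ->
  forall g, nm (lc c F g) <= B.
Proof.
move=> HB g; have := @max_bound c _ 1 B ltr01 _ HB g; rewrite divr1; apply.
by move=> k mx; rewrite mul1r; exact: b_acc.
Qed.

Lemma accretive_inv (c : I -> C) (B : R) : (forall g, nm (lc c F g) <= B) ->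
  forall g, nm (lc (fun i => ((b (l i))^-1)%:C * c i) F g) <= B.
Proof.
move=> HB; apply: accretive_le => g.
rewrite (_ : lc _ F g = lc c F g) //; apply: lc_eq => i; have [_ l0] := EF i.
rewrite mulrA -rmorphM divff ?rmorph1 ?mul1r //.
by rewrite gt_eqF // (lt_le_trans ltr01) // b_ge1.
Qed.

Lemma resolvent_bound (c : I -> C) (s B : R) : 0 < s ->
  (forall g, nm (lc c F g) <= B) ->
  forall g, nm (lc (fun i => ((s + b (l i))^-1)%:C * c i) F g) <= B / s.
Proof.
move=> s0 HB; apply: (@max_bound _ c) => // g mx.
set w := fun i => ((s + b (l i))^-1)%:C * c i in mx *.
have -> : lc c F g = s%:C * lc w F g + lc (fun i => (b (l i))%:C * w i) F g.
  rewrite -lc_scale -lc_add; apply: lc_eq => i; have [_ l0] := EF i.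
  rewrite -mulrDl /w mulrA -rmorphD -rmorphM divff ?rmorph1 ?mul1r //.
  by rewrite gt_eqF // addr_gt0 // (lt_le_trans ltr01) // b_ge1.
rewrite dotDr dotZr dotxx lerDl.
by apply: le_trans (b_acc EF mx); exact: sqr_ge0.
Qed.

(** A Landau-Kolmogorov inequality, from the identity
    b = s (1 - s / (s + b)) + b ^ 2 / (s + b). *)
Lemma landau_kolmogorov (c : I -> C) (s B0 B2 : R) : 0 < s ->
  (forall g, nm (lc c F g) <= B0) ->
  (forall g, nm (lc (fun i => (b (l i) ^+ 2)%:C * c i) F g) <= B2) ->
  forall g, nm (lc (fun i => (b (l i))%:C * c i) F g) <= 2 * s * B0 + B2 / s.
Proof.
move=> s0 H0 H2 g.
have h1 := resolvent_bound s0 H0 g; have h2 := resolvent_bound s0 H2 g.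
have -> : lc (fun i => (b (l i))%:C * c i) F g =
    s%:C * lc c F g - (s ^+ 2)%:C * lc (fun i => ((s + b (l i))^-1)%:C * c i) F g +
    lc (fun i => ((s + b (l i))^-1)%:C * ((b (l i) ^+ 2)%:C * c i)) F g.
  rewrite -mulNr -!lc_scale -!lc_add; apply: lc_eq => i; have [_ l0] := EF i.
  have d0 : s + b (l i) != 0.
    by rewrite gt_eqF // addr_gt0 // (lt_le_trans ltr01) // b_ge1.
  have -> : (b (l i))%:C = s%:C - (s ^+ 2)%:C * ((s + b (l i))^-1)%:C +
     ((s + b (l i))^-1)%:C * (b (l i) ^+ 2)%:C :> C.
    by rewrite -!rmorphM -rmorphB -rmorphD; congr (_%:C); field.
  by ring.
apply: (le_trans (nmD _ _)); apply: lerD => //.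
apply: (le_trans (nmB _ _)); rewrite !nmM !nm_real.
rewrite (ger0_norm (ltW s0)) (ger0_norm (exprn_ge0 2 (ltW s0))) -mulrA (_ : 2 * (s * B0) = s * B0 + s ^+ 2 * (B0 / s)); last by field; rewrite gt_eqF.
by apply: lerD; rewrite ler_pM2l // exprn_gt0.
Qed.

End accretive_bounds.

Lemma powR_cvg (x a : R) (e : R) : 1 <= x -> 0 < e ->
  exists d : R, 0 < d /\ forall s, `|a - s| < d -> `|x `^ (- a) - x `^ (- s)| < e.
Proof.
move=> x1 e0; have x0 : x != 0 by rewrite gt_eqF // (lt_le_trans ltr01).
have E s : x `^ (- s) = expR (s * (- ln x)) by rewrite /powR (negPf x0) mulNr mulrN.
have : {for a, continuous (fun s : R => expR (s * (- ln x)))}.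
  exact: (derivable_cvg (is_derive_expR (- ln x) a)).
move=> /cvgrPdist_lt/(_ e e0)[d /= d0 Hd]; exists d; split=> // s sd.
by rewrite !E; exact: Hd.
Qed.

(** The Bessel potentials of negative order are contractions for the sup norm:
    they are limits of products of inverses of the roots above. *)
Lemma bessel_contraction (I : finType) (l : I -> R) (F : I -> G -> C) (a : R)
    (c : I -> C) (B : R) : eigfam l F -> 0 <= a ->
  (forall g, nm (lc c F g) <= B) ->
  forall g, nm (lc (fun i => ((1 + l i) `^ (- a))%:C * c i) F g) <= B.
Proof.
move=> EF a0 HB g; have l1 i : 1 <= 1 + l i by have [_ ?] := EF i; rewrite lerDl.
have dyadic k n : nm (lc (fun i => ((1 + l i) `^ (- (n%:R / 2 ^+ k)))%:C * c i) F g) <= B.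
  elim: n g => [|n IH] g.
    rewrite (@lc_eq _ _ _ c) // => i; rewrite mul0r oppr0 powRr0 rmorph1 mul1r //.
  have := accretive_inv (@accretive_root k) (@root_ge1 k) EF IH g.
  congr (nm _ <= _); apply: lc_eq => i; rewrite mulrA -rmorphM; congr (_%:C * _).
  have x0 : 1 + l i != 0 by rewrite gt_eqF // (lt_le_trans ltr01).
  rewrite /root -powRN -powRD; last by rewrite x0 implybT.
  by congr (_ `^ _); rewrite -natr1; ring.
apply/ler_addgt0Pr => e e0.
have hK i := SU2_bounded (pol_contC (polZ (c i) (eigfam_pol EF i))).
have [K HK] := choice hK.
pose S := \sum_i K i + 1.
have S0 : 0 < S.
  by rewrite /S ltr_wpDl // sumr_ge0 // => i _; have [] := HK i.
have [d [d0 Hd]] : exists d : R, 0 < d /\ forall i (s : R), `|a - s| < d ->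
    `|(1 + l i) `^ (- a) - (1 + l i) `^ (- s)| <= e / S.
  have h i := @powR_cvg (1 + l i) a (e / S) (l1 i) (divr_gt0 e0 S0).
  have [dd Hdd] := choice h.
  exists (\big[Num.min/1]_i dd i); split.
    by apply: lt_bigmin => [|i _]; [exact: ltr01|have [] := Hdd i].
  move=> i s hs; apply: ltW; have [_] := Hdd i; apply.
  by apply: (lt_le_trans hs); exact: bigmin_le_cond.
have [k hk] : exists k : nat, d^-1 < 2 ^+ k.
  exists (Num.truncn d^-1).+1; apply: (@lt_le_trans _ _ (Num.truncn d^-1).+1%:R).
    exact: truncnS_gt.
  by rewrite -natrX ler_nat ltnW // ltn_expl.
have p0 : 0 < 2 ^+ k :> R by rewrite exprn_gt0.
(* The dyadic number n / 2 ^ k is within 2 ^ - k < d of a. *)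
pose n := Num.truncn (a * 2 ^+ k).
have nd : `|a - n%:R / 2 ^+ k| < d.
  have n1 : n%:R <= a * 2 ^+ k by rewrite truncn_le // mulr_ge0 // ltW.
  have n2 : a * 2 ^+ k < n.+1%:R by exact: truncnS_gt.
  rewrite -[a](mulfK (lt0r_neq0 p0)) -mulrBl ger0_norm; last first.
    by rewrite divr_ge0 ?subr_ge0 // ltW.
  rewrite ltr_pdivrMr //; apply: (@lt_trans _ _ 1).
    by rewrite ltrBlDr addrC natr1.
  by move: hk; rewrite -(ltr_pM2l d0) mulfV ?lt0r_neq0.
have -> : lc (fun i => ((1 + l i) `^ (- a))%:C * c i) F g =
    lc (fun i => ((1 + l i) `^ (- (n%:R / 2 ^+ k)))%:C * c i) F g +
    lc (fun i => ((1 + l i) `^ (- a) - (1 + l i) `^ (- (n%:R / 2 ^+ k)))%:C * c i) F g.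
  by rewrite -lc_add; apply: lc_eq => i; rewrite rmorphB; ring.
apply: (le_trans (nmD _ _)); apply: lerD; first exact: dyadic.
apply: (le_trans (nm_sum _)); apply: (@le_trans _ _ (\sum_i (e / S) * K i)).
  apply: ler_sum => i _; rewrite -mulrA nmM nm_real.
  by apply: ler_pM; [exact: normr_ge0|exact: nm_ge0|exact: Hd|have [_] := HK i].
rewrite -mulr_sumr mulrAC ler_pdivrMr // ler_pM2l //.
by rewrite /S lerDl.
Qed.

End dissipative.

(** * Gradient bounds for the subelliptic heat semigroup *)

Section bernstein.
Variable R : realType.
Local Notation C := R[i].
Local Notation G := (SU2 R).
Local Notation D := (@dl R).
Variables X Y Z : su2 R.
Hypothesis XYZ : su2_frame X Y Z.
Local Notation Lap := (Lap X Y Z).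
Local Notation eigL := (eigL X Y Z).
Local Notation eigZ := (eigZ Z).
Local Notation eigfam := (eigfam X Y Z).

(** The curve e^(t z). *)
Definition cexp (z : C) (t : R) : C :=
  expR (t * complex.Re z) *: cos (t * complex.Im z) +i*
  (expR (t * complex.Re z) * sin (t * complex.Im z)).

Lemma cexp0 z : cexp z 0 = 1.
Proof. by rewrite /cexp !mul0r expR0 cos0 sin0 mulr0 scale1r. Qed.

Lemma isCd_cexp z t : isCd (cexp z) t (z * cexp z t).
Proof.
have ds : is_derive t 1 (fun s => sin (s * complex.Im z)) (complex.Im z * cos (t * complex.Im z)).
  have := is_derive_compE (is_derive_affine (complex.Im z) 0 t) (is_derive_sin _).
  rewrite addr0 mulrC [_ * t]mulrC; congr (is_derive _ _ _ _).
  by apply/funext => s; rewrite addr0 mulrC.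
have dc : is_derive t 1 (fun s => cos (s * complex.Im z)) (- complex.Im z * sin (t * complex.Im z)).
  have := is_derive_compE (is_derive_affine (complex.Im z) 0 t) (is_derive_cos _).
  rewrite addr0 mulrC [_ * t]mulrC mulrN -mulNr; congr (is_derive _ _ _ _).
  by apply/funext => s; rewrite addr0 mulrC.
have de := is_derive_expR (complex.Re z) t.
split.
  apply: (is_derive_eq (is_deriveME de dc)).
  by rewrite /cexp Re_mul /= /GRing.scale /=; ring.
apply: (is_derive_eq (is_deriveME de ds)).
by rewrite /cexp Im_mul /= /GRing.scale /=; ring.
Qed.

Lemma contC_cexp (T : topologicalType) (z : C) (k : T -> R) :
  continuous k -> contC (fun x => cexp z (k x)).
Proof.
move=> kc; have H (f : R -> R) : (forall t : R, exists l : R, is_derive t 1 f l) ->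
    continuous (fun x => f (k x)).
  move=> df x; have [l dl] := df (k x).
  exact: (@continuous_comp _ _ _ k f x (kc x) (derivable_cvg dl)).
split.
  apply: (H (fun t => complex.Re (cexp z t))) => t.
  by have [h _] := isCd_cexp z t; exists (complex.Re (z * cexp z t)).
apply: (H (fun t => complex.Im (cexp z t))) => t.
by have [_ h] := isCd_cexp z t; exists (complex.Im (z * cexp z t)).
Qed.

(** The computation behind [bernstein] at a maximum point of Phi - e t, where the
    letters stand for derivatives of u: p, q, z for Xu, Yu, Zu, then xy for XYu and
    so on. The hypotheses say that the time derivative is nonnegative there, that
    the second derivatives in the directions X and Y are nonpositive, and that the
    first derivative in the direction Z vanishes. The first quantity is twice the
    sum of the second ones minus a sum of squares: the term t |Zu|^2, which comes from
    differentiating t^2 / 2, is absorbed by 2 t (|XYu|^2 + |YXu|^2) because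
    Z = XY - YX, and with the weight 5/2 the products of first derivatives with the
    commutator terms complete squares. *)
Lemma bernstein_algebra (t ka e : R)
  (u p q z xx xy yx yy xz yz zz xxx yyx xxy yyy xxz yyz : C) : 0 <= t ->
  xy = yx + z ->
  e <= nm p ^+ 2 + nm q ^+ 2 +
    2 * t * (dot p (xxx + (yyx + yz + (yz - p)) - ka%:C * xz) +
             dot q ((xxy - (xz + q) - xz) + yyy - ka%:C * yz)) +
    t * nm z ^+ 2 + t ^+ 2 * dot z (xxz + yyz - ka%:C * zz) +
    5 * dot u (xx + yy - ka%:C * z) ->
  t * (nm xx ^+ 2 + dot p xxx) + t * (nm xy ^+ 2 + dot q xxy) +
    t ^+ 2 / 2 * (nm xz ^+ 2 + dot z xxz) + 5 / 2 * (nm p ^+ 2 + dot u xx) <= 0 ->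
  t * (nm yx ^+ 2 + dot p yyx) + t * (nm yy ^+ 2 + dot q yyy) +
    t ^+ 2 / 2 * (nm yz ^+ 2 + dot z yyz) + 5 / 2 * (nm q ^+ 2 + dot u yy) <= 0 ->
  t * dot p (xz + q) + t * dot q (yz - p) + t ^+ 2 / 2 * dot z zz +
    5 / 2 * dot u z = 0 -> e <= 0.
Proof.
move=> t0 -> hT hX hY hZ.
set T := (X in e <= X) in hT; set SX := (X in X <= 0) in hX.
set SY := (X in X <= 0) in hY; set SZ := (X in X = 0) in hZ.
have E : T - 2 * SX - 2 * SY + 2 * ka * SZ =
    - (nm (2%:C * p - t%:C * yz) ^+ 2 + nm (2%:C * q + t%:C * xz) ^+ 2 +
       2 * t * (nm p ^+ 2 + nm q ^+ 2) + 2 * t * (nm xx ^+ 2 + nm yy ^+ 2) +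
       t * nm (yx + z + yx) ^+ 2).
  rewrite /T /SX /SY /SZ !nm_sqr /dot !cReE !cImE /=.
  by field.
have h1 : 0 <= nm (2%:C * p - t%:C * yz) ^+ 2 by exact: sqr_ge0.
have h2 : 0 <= nm (2%:C * q + t%:C * xz) ^+ 2 by exact: sqr_ge0.
have h3 : 0 <= 2 * t * (nm p ^+ 2 + nm q ^+ 2) by rewrite !mulr_ge0 // addr_ge0 // sqr_ge0.
have h4 : 0 <= 2 * t * (nm xx ^+ 2 + nm yy ^+ 2) by rewrite !mulr_ge0 // addr_ge0 // sqr_ge0.
have h5 : 0 <= t * nm (yx + z + yx) ^+ 2 by rewrite mulr_ge0 // sqr_ge0.
have : 2 * ka * SZ = 0 by rewrite hZ mulr0.
by move: hT hX hY E h1 h2 h3 h4 h5; clear; move: T SX SY (2 * ka * SZ) => T SX SY S; lra.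
Qed.

Variable ka : R.

Definition jointfam (I : finType) (l m : I -> R) (F : I -> G -> C) : Prop :=
  eigfam l F /\ forall i, eigZ (m i) (F i).

(** The eigenvalue of - X^2 - Y^2 + ka Z on a joint eigenfunction. *)
Definition sym (l m : R) : C := (l - m ^+ 2) +i* (ka * m).

Section flow.
Variables (I : finType) (l m : I -> R) (F : I -> G -> C).
Hypothesis EF : jointfam l m F.
Let EL := EF.1.

Let pF i : pol (F i). Proof. exact: eigfam_pol EL i. Qed.

(** The semigroup generated by minus the operator - X^2 - Y^2 + ka Z. *)
Definition flow (c : I -> C) (t : R) : G -> C :=
  lc (fun i => cexp (- sym (l i) (m i)) t * c i) F.

Lemma flow0 c : flow c 0 = lc c F.
Proof. by apply/funext => g; apply: lc_eq => i; rewrite cexp0 mul1r. Qed.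

Lemma flow_pol c t : pol (flow c t). Proof. exact: lc_pol EL _. Qed.

Lemma flow_sym c t :
  flow (fun i => sym (l i) (m i) * c i) t =
  fun g => - D X (D X (flow c t)) g - D Y (D Y (flow c t)) g + ka%:C * D Z (flow c t) g.
Proof.
have DZF d : D Z (lc d F) = lc (fun i => (0 +i* m i) * d i) F.
  rewrite (D_lc EL); apply/funext => g; apply: eq_bigr => i _.
  by rewrite EF.2; ring.
apply/funext => g; have := congr1 (fun f => f g) (Lap_lc EL
  (fun i => cexp (- sym (l i) (m i)) t * c i)).
rewrite -/(flow c t) /Lap => E.
have -> : - D X (D X (flow c t)) g - D Y (D Y (flow c t)) g =
    lc (fun i => (l i)%:C * (cexp (- sym (l i) (m i)) t * c i)) F g +
    D Z (D Z (flow c t)) g by rewrite -E; ring.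
rewrite /flow !DZF -lc_scale -!lc_add; apply: lc_eq => i.
have -> : sym (l i) (m i) = (l i)%:C + (0 +i* m i) * (0 +i* m i) + ka%:C * (0 +i* m i).
  by apply: complexP => /=; ring.
by move: (cexp _ _) => ?; ring.
Qed.

Lemma isCd_flow A c t g : isCd (fun t => D A (flow c t) g) t
  (D A (fun g => - flow (fun i => sym (l i) (m i) * c i) t g) g).
Proof.
have -> : (fun g => - flow (fun i => sym (l i) (m i) * c i) t g) =
    lc (fun i => - sym (l i) (m i) * (cexp (- sym (l i) (m i)) t * c i)) F.
  apply/funext => h; rewrite /flow -mulN1r -lc_scale; apply: lc_eq => i.
  by ring.
have -> : (fun t => D A (flow c t) g) =
    fun t => lc (fun i => cexp (- sym (l i) (m i)) t * c i) (fun i => D A (F i)) g.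
  by apply/funext => s; rewrite /flow (D_lc EL).
rewrite (D_lc EL); apply: isCd_sum => i.
apply: (isCd_eq (isCdM (isCdM (isCd_cexp _ t) (isCd_cst _ _)) (isCd_cst _ _))).
by rewrite !mulr0 !addr0 mulrA.
Qed.

Lemma isCd_flow0 c t g : isCd (fun t => flow c t g) t
  (- flow (fun i => sym (l i) (m i) * c i) t g).
Proof.
rewrite /flow -mulN1r -lc_scale; apply: isCd_sum => i.
apply: (isCd_eq (isCdM (isCdM (isCd_cexp _ t) (isCd_cst _ _)) (isCd_cst _ _))).
by rewrite !mulr0 !addr0; ring.
Qed.

Lemma contC_flow (H : I -> G -> C) c : (forall i, contC (H i)) ->
  contC (fun p : R * G => lc (fun i => cexp (- sym (l i) (m i)) p.1 * c i) H p.2).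
Proof.
move=> cH; apply: contC_sum => i; apply: contCM; last first.
  by apply: (contC_comp (cH i)) => p; exact: cvg_snd.
apply: contCM; last exact: contC_cst.
by apply: contC_cexp => p; exact: cvg_fst.
Qed.

(** Bernstein's method for the hypoelliptic heat equation: the function
    Phi = t (|Xu|^2 + |Yu|^2) + t^2 |Zu|^2 / 2 + 5 |u|^2 / 2
    is a subsolution, because Z = [X, Y] is controlled by the second
    derivatives XYu and YXu. *)
Definition Phi c (t : R) g : R :=
  t * nm (D X (flow c t) g) ^+ 2 + t * nm (D Y (flow c t) g) ^+ 2 +
  t ^+ 2 / 2 * nm (D Z (flow c t) g) ^+ 2 + 5 / 2 * nm (flow c t g) ^+ 2.

Lemma bernstein c (B : R) : (forall g, nm (lc c F g) <= B) ->
  forall t g, 0 <= t -> Phi c t g <= 5 / 2 * B ^+ 2.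
Proof.
move=> HB T k T0.
have B0 : 0 <= B by apply: le_trans (HB k); exact: nm_ge0.
apply/ler_addgt0Pr => e' e'0.
(* Subtracting e t makes the maximum principle strict. *)
pose e := e' / (T + 1).
have T1 : 0 < T + 1 by rewrite ltr_wpDl.
have e0 : 0 < e by rewrite divr_gt0.
suff H : Phi c T k - e * T <= 5 / 2 * B ^+ 2.
  have eT : e * T <= e'.
    by rewrite /e mulrAC ler_pdivrMr // ler_pM2l // lerDl.
  lra.
pose Psi (p : R * G) := Phi c p.1 p.2 - e * p.1.
have c1 A : contC (fun p : R * G => D A (flow c p.1) p.2).
  rewrite (_ : (fun p => _) = fun p : R * G =>
    lc (fun i => cexp (- sym (l i) (m i)) p.1 * c i) (fun i => D A (F i)) p.2).
    by apply: contC_flow => i; exact: pol_contC (pol_lie A (pF i)).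
  by apply/funext => p; rewrite /flow (D_lc EL).
have c0 : contC (fun p : R * G => flow c p.1 p.2).
  by apply: contC_flow => i; exact: pol_contC (pF i).
have cst (a : R) : continuous (fun p : R * G => a) by move=> p; exact: cvg_cst.
have cf : continuous (fun p : R * G => p.1) by move=> p; exact: cvg_fst.
have Psic : continuous Psi.
  have h2 : continuous (fun p : R * G => p.1 ^+ 2 / 2).
    apply: contM => // p; under eq_fun do rewrite expr2.
    by apply: cvgM; exact: cf.
  apply: contD; last by apply: contN; exact: contM.
  apply: contD; last by apply: contM => //; exact: contC_sqr.
  apply: contD; last by apply: contM => //; exact: contC_sqr.
  by apply: contD; apply: contM => //; exact: contC_sqr.
have [t [g [/andP[t0 tT] mx]]] := slab_max T0 Psic.
have TT : 0 <= T <= T by rewrite T0 lexx.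
apply: (le_trans (mx T k TT)) => {TT k}; rewrite /Psi /=.
move: t0; rewrite le_eqVlt => /predU1P[t0|t0].
  rewrite -t0 /Phi expr0n !mul0r !add0r mulr0 subr0 flow0.
  by rewrite ler_pM2l // ler_pXn2r ?nnegrE ?nm_ge0 ?HB.
suff : e <= 0 by rewrite leNgt e0.
set u := flow c t; have pu : pol u := flow_pol c t.
have pA A : pol (D A u) := pol_lie A pu.
have pAA A1 A2 : pol (D A1 (D A2 u)) := pol_lie A1 (pA A2).
set V := fun g => - flow (fun i => sym (l i) (m i) * c i) t g.
have VE : V = fun g => (1 * D X (D X u) g + 1 * D Y (D Y u) g) + (- ka%:C) * D Z u g.
  by apply/funext => h; rewrite /V flow_sym -/u; ring.
have DV A h : D A V h = D A (D X (D X u)) h + D A (D Y (D Y u)) h - ka%:C * D A (D Z u) h.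
  rewrite VE (D_add _ (polD (polZ _ (pAA X X)) (polZ _ (pAA Y Y))) (polZ _ (pA Z))).
  rewrite (D_add _ (polZ _ (pAA X X)) (polZ _ (pAA Y Y))) !D_scale //.
  by rewrite !mul1r mulNr.
have dPsi : is_derive t 1 (fun s => Psi (s, g))
   (nm (D X u g) ^+ 2 + nm (D Y u g) ^+ 2 +
    2 * t * (dot (D X u g) (D X V g) + dot (D Y u g) (D Y V g)) +
    t * nm (D Z u g) ^+ 2 + t ^+ 2 * dot (D Z u g) (D Z V g) +
    5 * dot (u g) (V g) - e).
  have dN A : is_derive t 1 (fun s => nm (D A (flow c s) g) ^+ 2)
      (2 * dot (D A u g) (D A V g)) := isCd_sqr (isCd_flow A c t g).
  have dN0 : is_derive t 1 (fun s => nm (flow c s g) ^+ 2)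
      (2 * dot (u g) (V g)) := isCd_sqr (isCd_flow0 c t g).
  have d1 : is_derive t 1 (fun s : R => s) 1 by exact: is_derive_id.
  have d2 : is_derive t 1 (fun s : R => s ^+ 2 / 2) t.
    have := is_deriveME (is_deriveME d1 d1) (is_derive_cstE t 1 2^-1).
    by move/is_derive_eq; apply; field.
  have := is_deriveDE (is_deriveDE (is_deriveDE (is_deriveDE
    (is_deriveME d1 (dN X)) (is_deriveME d1 (dN Y))) (is_deriveME d2 (dN Z)))
    (is_deriveZE (5 / 2) dN0)) (is_deriveNE (is_deriveZE e d1)).
  by move/is_derive_eq; apply; rewrite -/u; field.
have mxt s : t - t < s < t -> Psi (s, g) <= Psi (t, g).
  by move=> /andP[h1 h2]; apply: mx; move: h1 h2 tT; lra.
have dge0 := max_left_derive_ge0 t0 dPsi mxt.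
pose uu (i : 'I_4) : G -> C := match val i with
  0%N => D X u | 1%N => D Y u | 2%N => D Z u | _ => u end.
pose cc (i : 'I_4) : R := match val i with
  0%N => t | 1%N => t | 2%N => t ^+ 2 / 2 | _ => 5 / 2 end.
have puu i : pol (uu i) by case: i => -[|[|[|[|//]]]] hi; rewrite /uu /=.
have sum4 (S : 'I_4 -> R) : \sum_i S i = S 0 + S 1 + S 2 + S 3.
  rewrite !big_ord_recl big_ord0 addr0 !addrA.
  by congr (S _ + S _ + S _ + S _); exact: val_inj.
have mxg h : \sum_i cc i * nm (uu i h) ^+ 2 <= \sum_i cc i * nm (uu i g) ^+ 2.
  rewrite !sum4 /cc /uu /=; have := mx t h; rewrite /Psi /Phi /= -/u ltW // tT.
  by move=> /(_ isT); rewrite lerD2r.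
have [_] := space_max X puu mxg; have [_] := space_max Y puu mxg.
have [+ _] := space_max Z puu mxg.
have ZY : D Z (D Y u) g = D Y (D Z u) g - D X u g.
  by rewrite (D_YZ XYZ pu) addrK.
have ZX : D Z (D X u) g = D X (D Z u) g + D Y u g by rewrite (D_ZX XYZ pu).
rewrite !sum4 /cc /uu /= ZX ZY => hZ hY hX.
apply: (@bernstein_algebra t ka e (u g) (D X u g) (D Y u g) (D Z u g)
  (D X (D X u) g) (D X (D Y u) g) (D Y (D X u) g) (D Y (D Y u) g)
  (D X (D Z u) g) (D Y (D Z u) g) (D Z (D Z u) g)
  (D X (D X (D X u)) g) (D Y (D Y (D X u)) g) (D X (D X (D Y u)) g)
  (D Y (D Y (D Y u)) g) (D X (D X (D Z u)) g) (D Y (D Y (D Z u)) g)) => //.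
- exact: ltW.
- by rewrite (D_XY XYZ pu).
- have eX : D X V g = D X (D X (D X u)) g + (D Y (D Y (D X u)) g + D Y (D Z u) g +
      (D Y (D Z u) g - D X u g)) - ka%:C * D X (D Z u) g.
    rewrite DV (D_XY XYZ (pA Y)) (D_XY XYZ pu) (D_add _ (pAA Y X) (pA Z)) ZY.
    by rewrite !addrA.
  have eY : D Y V g = (D X (D X (D Y u)) g - (D X (D Z u) g + D Y u g) -
      D X (D Z u) g) + D Y (D Y (D Y u)) g - ka%:C * D Y (D Z u) g.
    rewrite DV; congr (_ + _ - _).
    rewrite (D_XY XYZ pu) (D_add _ (pAA Y X) (pA Z)) (D_XY XYZ (pA X)) ZX.
    by move: (D Y (D X (D X u)) g) (D X (D Z u) g) (D Y u g) => *; ring.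
  have eZ : D Z V g = D X (D X (D Z u)) g + D Y (D Y (D Z u)) g - ka%:C * D Z (D Z u) g.
    rewrite DV; congr (_ - _).
    rewrite (D_ZX XYZ (pA X)) (D_ZX XYZ pu) (D_add _ (pAA X Z) (pA Y)).
    rewrite [in RHS](D_YZ XYZ pu) (D_add _ (pAA Z Y) (pA X)) (D_YZ XYZ (pA Y)).
    by move: (D X (D X (D Z u)) g) (D X (D Y u) g) (D Y (D X u) g) (D Z (D Y (D Y u)) g) => *; ring.
  have eV : V g = D X (D X u) g + D Y (D Y u) g - ka%:C * D Z u g.
    by rewrite VE !mul1r mulNr.
  by move: dge0; rewrite eX eY eZ eV subr_ge0.
Qed.

Lemma flow_le c (B : R) : (forall g, nm (lc c F g) <= B) ->
  forall t g, 0 <= t -> nm (flow c t g) <= B.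
Proof.
move=> HB t g t0; have B0 : 0 <= B by apply: le_trans (HB g); exact: nm_ge0.
have := bernstein HB g t0; rewrite /Phi.
set p := nm (D X _ _); set q := nm (D Y _ _); set z := nm (D Z _ _) => h.
rewrite -(ler_pXn2r (n := 2)) ?nnegrE ?nm_ge0 //.
have h1 : 0 <= t * p ^+ 2 by rewrite mulr_ge0 // sqr_ge0.
have h2 : 0 <= t * q ^+ 2 by rewrite mulr_ge0 // sqr_ge0.
have h3 : 0 <= t ^+ 2 / 2 * z ^+ 2 by rewrite mulr_ge0 ?sqr_ge0 // divr_ge0 ?sqr_ge0.
lra.
Qed.

Lemma flow_Z_le c (B : R) : (forall g, nm (lc c F g) <= B) ->
  forall t g, 0 < t -> nm (D Z (flow c t) g) <= 3 * B / t.
Proof.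
move=> HB t g t0; have B0 : 0 <= B by apply: le_trans (HB g); exact: nm_ge0.
have t0' := ltW t0; have := bernstein HB g t0'; rewrite /Phi.
set p := nm (D X _ _); set q := nm (D Y _ _); set z := nm (D Z _ _) => h.
have z0 : 0 <= z by exact: nm_ge0.
rewrite ler_pdivlMr // -(ler_pXn2r (n := 2)) ?nnegrE ?mulr_ge0 //.
have h1 : 0 <= t * p ^+ 2 by rewrite mulr_ge0 ?sqr_ge0.
have h2 : 0 <= t * q ^+ 2 by rewrite mulr_ge0 ?sqr_ge0.
have h3 := sqr_ge0 (nm (flow c t g)); have h4 := sqr_ge0 B.
rewrite !exprMn; move: h h1 h2 h3 h4; lra.
Qed.

Lemma flow_XY_le c (B : R) : (forall g, nm (lc c F g) <= B) ->
  forall t g A, 0 < t -> A = X \/ A = Y -> nm (D A (flow c t) g) ^+ 2 <= 3 * B ^+ 2 / t.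
Proof.
move=> HB t g A t0 AXY; have B0 : 0 <= B by apply: le_trans (HB g); exact: nm_ge0.
have t0' := ltW t0; have := bernstein HB g t0'; rewrite /Phi.
set z := nm (D Z _ _) => h; rewrite ler_pdivlMr // mulrC.
have h1 E : 0 <= t * nm (D E (flow c t) g) ^+ 2 by rewrite mulr_ge0 ?sqr_ge0.
have h2 : 0 <= t ^+ 2 / 2 * z ^+ 2 by rewrite mulr_ge0 ?sqr_ge0 // divr_ge0 ?sqr_ge0.
have h3 := sqr_ge0 (nm (flow c t g)); have h4 := sqr_ge0 B.
have hX := h1 X; have hY := h1 Y.
by case: AXY => ->; move: h h2 h3 h4 hX hY; lra.
Qed.

(** The time derivative of the flow is, up to sign, the flow of the image by the
    operator, to which [flow_le] applies. *)
Lemma flow_diff_le c (K : R) :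
  (forall g, nm (lc (fun i => sym (l i) (m i) * c i) F g) <= K) ->
  forall s t g, 0 <= s <= t -> nm (flow c t g - flow c s g) <= K * (t - s).
Proof.
move=> HK s t g /andP[s0 st].
have K0 : 0 <= K by apply: le_trans (HK g); exact: nm_ge0.
apply: (isCd_mvt (f := fun t => flow c t g) (df := fun t => - flow (fun i => sym (l i) (m i) * c i) t g)) => //.
move=> r /andP[r1 _]; split; first exact: isCd_flow0.
by rewrite nmN; apply: flow_le => //; apply: le_trans r1.
Qed.

End flow.
End bernstein.

Section oscillation.
Variable R : realType.
Local Notation C := R[i].
Local Notation G := (SU2 R).
Local Notation M2 := 'M[C]_2.
Local Notation D := (@dl R).
Variables X Y Z : su2 R.
Hypothesis XYZ : su2_frame X Y Z.

Lemma SU2_half_tr (k : G) :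
  \tr k = (complex.Re (\tr k) / 2)%:C + (complex.Re (\tr k) / 2)%:C :> C.
Proof. by rewrite -rmorphD {1}SU2_tr_real; congr (_%:C); field. Qed.

Definition traceless_mx (k : G) : M2 := (k : M2) - (complex.Re (\tr k) / 2)%:C%:M.

(** The adjoint of k is tr k - k, by [SU2_invE]. *)
Lemma traceless_subproof (k : G) :
  ((traceless_mx k)^t* == - traceless_mx k) && (\tr (traceless_mx k) == 0).
Proof.
have kV := SU2_invE k; rewrite /= in kV; have tk := SU2_half_tr k.
rewrite /traceless_mx; set x := complex.Re (\tr k) / 2 in tk *.
apply/andP; split; apply/eqP; last first.
  by rewrite raddfB /= mxtrace_scalar mulr2n {1}tk subrr.
apply/matrixP => i j; have := congr1 (fun M : M2 => M i j) kV.
rewrite !mxE tk => E; rewrite rmorphB /= E rmorphMn.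
rewrite [X in _ - X *+ _](_ : _ = x%:C); last exact: conjc_real.
rewrite eq_sym.
by case: (i == j); rewrite ?mulr1n ?mulr0n; ring.
Qed.

Definition traceless (k : G) : su2 R := MkSu2 (traceless_subproof k).

Lemma sdot_traceless k : sdot (traceless k) (traceless k) = 1 - (complex.Re (\tr k) / 2) ^+ 2.
Proof.
set x := complex.Re (\tr k) / 2.
have tk : \tr k = x%:C + x%:C :> C := SU2_half_tr k.
have := tr_su2_mul (traceless k) (traceless k).
rewrite /= /traceless_mx -/x; have [_ dk] := SU2P k.
have -> : ((k : M2) - x%:C%:M) *m ((k : M2) - x%:C%:M) = ((x ^+ 2)%:C - 1)%:M.
  have := mul_adj2 (k : M2); rewrite dk tk mulmxBr mul_mx_scalar => E.
  have kk : (k : M2) *m k = (x%:C + x%:C) *: (k : M2) - 1%:M by rewrite -E opprB addrC subrK.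
  rewrite mulmxBl !mulmxBr !mul_mx_scalar !mul_scalar_mx kk rmorphXn /=.
  apply/matrixP => i j; rewrite !mxE.
  by case: (i == j); rewrite ?mulr1n ?mulr0n; ring.
rewrite mxtrace_scalar => /(congr1 (@complex.Re _)) /=; lra.
Qed.

(** Let k = h^-1 g = x + S with S in su(2). If S is not zero, then k = exp (t S) for
    t = acos x / speed S, so that g and h are joined by an orbit along which the
    rotation angle t * speed S is at most pi. *)
Lemma osc_bound (f : G -> C) (K : R) : pol f ->
  (forall g A, A = X \/ A = Y \/ A = Z -> nm (D A f g) <= K) ->
  forall g h, nm (f g - f h) <= 6 * pi * K.
Proof.
move=> pf HK g h.
have K0 : 0 <= K by apply: le_trans (nm_ge0 _) (HK g X (or_introl erefl)).
have pi0 : 0 <= pi :> R := pi_ge0 R.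
pose k := SU2_mul (SU2_inv h) g.
have hk : SU2_mul h k = g by rewrite SU2_mulVK.
have path (S : su2 R) (V t : R) : 0 <= t -> translate S h t = g ->
    (forall x, nm (D S f x) <= V) -> nm (f g - f h) <= V * t.
  move=> t0 E HV; rewrite -E -{2}(translate0 S h) -[X in _ * X]subr0.
  have V0 : 0 <= V by apply: le_trans (nm_ge0 _) (HV g).
  apply: (isCd_mvt (f := fun t => f (translate S h t))
    (df := fun t => D S f (translate S h t))) => // r _.
  by split; [apply: D_isCd_at; exact: pol_diff|].
pose x := complex.Re (\tr k) / 2; pose S := traceless k.
have kE : (k : M2) = x%:C%:M + S by rewrite /S /= /traceless_mx addrC subrK.
have SS : sdot S S = 1 - x ^+ 2 := sdot_traceless k.
have sp0 := sqrtr_ge0 (sdot S S); rewrite -/(speed S) in sp0.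
have x1 : -1 <= x <= 1.
  have : x ^+ 2 <= 1 by have := sdot_ge0 S; rewrite SS; lra.
  move=> hx; rewrite -ler_norml -(ler_pXn2r (n := 2)) ?nnegrE //.
  by rewrite expr1n real_normK ?num_real.
have [s0|s0] := eqVneq (speed S) 0.
  have S0 := speed_eq0 s0.
  have xx : x ^+ 2 = 1 by have := speed_sqr S; rewrite s0 SS expr0n /=; lra.
  have [xp|xm] : x = 1 \/ x = -1.
    have /eqP : (x - 1) * (x + 1) = 0 by rewrite -subr_sqr xx; ring.
    by rewrite mulf_eq0 => /orP[/eqP ?|/eqP ?]; [left; lra|right; lra].
  - have -> : g = h.
      rewrite -hk; apply: SU2_eq; rewrite -[LHS]/((h : M2) *m k) kE S0 addr0 xp.
      by rewrite rmorph1 mulmx1.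
    by rewrite subrr nm0 !mulr_ge0.
  (* For k = - 1 every direction will do: X has speed 1/2 and reaches - 1 at the
     time 2 pi. *)
  have sX : speed X = 2^-1.
    have [xX _ _ _] := frame_dots XYZ.
    by rewrite /speed xX (_ : 4^-1 = 2^-1 ^+ 2) ?sqrtr_sqr ?ger0_norm //; field.
  have E : translate X h (2 * pi) = g.
    rewrite -hk; apply: SU2_eq; rewrite translateE sX -[RHS]/((h : M2) *m k) kE S0 addr0 xm.
    rewrite mulrC mulKf // cospi sinpi mul0r scale0r addr0.
    by rewrite mul_mx_scalar.
  have := path X K (2 * pi) _ E (fun y => HK y X (or_introl erefl)).
  move=> /(_ _) H; apply: le_trans (H _) _; first by rewrite mulr_ge0.
  by rewrite mulrC ler_wpM2r // ler_pM2r ?pi_gt0 // ler_nat.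
have sp : 0 < speed S by rewrite lt_def s0.
have E : translate S h (acos x / speed S) = g.
  rewrite -hk; apply: SU2_eq; rewrite translateE -[RHS]/((h : M2) *m k) divfK // kE.
  rewrite acosK; last by rewrite in_itv.
  rewrite sin_acos // -SS -/(speed S) divff // rmorph1 scale1r.
  by rewrite [RHS]mulmxDr mul_mx_scalar.
have bS y : nm (D S f y) <= 6 * speed S * K.
  have c1 A : A = X \/ A = Y \/ A = Z -> nm (4 * sdot S A)%:C <= 2 * speed S.
    move=> hA; have AA : sdot A A = 4^-1.
      by have [? ? ? _] := frame_dots XYZ; case: hA => [->|[->|->]].
    rewrite nm_real -(ler_pXn2r (n := 2)) ?nnegrE ?mulr_ge0 //.
    rewrite real_normK ?num_real // !exprMn speed_sqr.
    have CS : sdot S A ^+ 2 <= sdot S S * sdot A A.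
      rewrite -subr_ge0 (_ : _ - _ = (cy S * cp A - cp S * cy A) ^+ 2 +
        (cy S * cq A - cq S * cy A) ^+ 2 + (cp S * cq A - cq S * cp A) ^+ 2).
        by rewrite !addr_ge0 ?sqr_ge0.
      by rewrite /sdot; ring.
    by move: CS; rewrite AA; lra.
  rewrite (D_lincomb pf (frame_span XYZ S)).
  have h3 A : A = X \/ A = Y \/ A = Z ->
      nm ((4 * sdot S A)%:C * D A f y) <= 2 * speed S * K.
    move=> hA; rewrite nmM; apply: ler_pM; rewrite ?nm_ge0 //; first exact: c1.
    exact: HK.
  have -> : 6 * speed S * K = 2 * speed S * K + 2 * speed S * K + 2 * speed S * K by ring.
  apply: (le_trans (nmD _ _)); apply: lerD; last by apply: h3; right; right.
  apply: (le_trans (nmD _ _)); apply: lerD; apply: h3; first by left.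
  by right; left.
have a0 : 0 <= acos x by apply: acos_ge0.
have t0 : 0 <= acos x / speed S by rewrite divr_ge0.
apply: (le_trans (path S _ _ t0 E bS)).
rewrite (_ : 6 * speed S * K * (acos x / speed S) = 6 * acos x * K); last by field.
by rewrite ler_wpM2r // ler_pM2l // acos_lepi.
Qed.

End oscillation.

(** * Integration of continuous functions *)

Section integral.
Variable R : realType.
Local Notation C := R[i].
Local Notation G := (SU2 R).
Variable mu : probability G R.

(** Integrability and integral of real functions (ri, RI) and, by components, of
    complex functions (ci, cI). *)
Definition ri (f : G -> R) : Prop := mu.-integrable setT (fun x => (f x)%:E).
Definition RI (f : G -> R) : R := Rintegral mu setT f.
Definition ci (f : G -> C) : Prop :=
  ri (fun x => complex.Re (f x)) /\ ri (fun x => complex.Im (f x)).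
Definition cI (f : G -> C) : C :=
  RI (fun x => complex.Re (f x)) +i* RI (fun x => complex.Im (f x)).

Lemma RIE f : RI f = Rintegral mu setT f. Proof. by []. Qed.

Lemma cIE f :
  cI f = RI (fun x => complex.Re (f x)) +i* RI (fun x => complex.Im (f x)).
Proof. by []. Qed.

Lemma open_meas (U : set G) : open U -> measurable U.
Proof. by move=> oU; exact: sub_sigma_algebra. Qed.

Lemma cont_meas (f : G -> R) : continuous f -> measurable_fun [set: G] f.
Proof.
move=> /continuousP fc; apply: (measurability _ (RGenOpens.measurableE R)).
move=> _ [_ [a [b ->] <-]]; rewrite setTI; apply: open_meas.
exact/fc/interval_open.
Qed.

Lemma ri_meas (f : G -> R) : ri f -> measurable_fun [set: G] f.
Proof. by move=> /integrableP[/measurable_EFinP]. Qed.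

Lemma ri_le (f h : G -> R) : measurable_fun [set: G] f -> ri h ->
  (forall x, `|f x| <= `|h x|) -> ri f.
Proof.
move=> mf ih fh; apply: (le_integrable _ _ _ ih) => //; first exact/measurable_EFinP.
by move=> x _ /=; rewrite lee_fin.
Qed.

Lemma ri_cst (k : R) : ri (fun=> k).
Proof. exact: finite_measure_integrable_cst. Qed.

Lemma ri_add (f h : G -> R) : ri f -> ri h -> ri (fun x => f x + h x).
Proof.
move=> fi hi; rewrite /ri (_ : (fun x => _) =
  ((fun x => (f x)%:E) \+ (fun x => (h x)%:E))%E); first exact: integrableD.
by apply/funext => x.
Qed.

Lemma ri_scale (k : R) (f : G -> R) : ri f -> ri (fun x => k * f x).
Proof.
move=> fi; rewrite /ri (_ : (fun x => _) = (fun x => k%:E * (f x)%:E)%E).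
  exact: integrableZl.
by apply/funext => x.
Qed.

Lemma ri_opp (f : G -> R) : ri f -> ri (fun x => - f x).
Proof.
move=> fi; rewrite (_ : (fun x => - f x) = (fun x => (-1) * f x)).
  exact: ri_scale.
by apply/funext => x; rewrite mulN1r.
Qed.

Lemma ri_sub (f h : G -> R) : ri f -> ri h -> ri (fun x => f x - h x).
Proof. by move=> fi hi; apply: ri_add => //; exact: ri_opp. Qed.

Lemma ri_abs (f : G -> R) : ri f -> ri (fun x => `|f x|).
Proof.
move=> fi; apply: (ri_le _ fi) => [|x]; last by rewrite normr_id.
by apply: measurableT_comp => //; exact: ri_meas.
Qed.

Lemma ri_bmul (f h : G -> R) (K : R) : ri f -> measurable_fun [set: G] h ->
  (forall x, `|h x| <= K) -> ri (fun x => f x * h x).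
Proof.
move=> fi mh hK; apply: (ri_le _ (ri_scale K fi)) => [|x].
  by apply: measurable_funM => //; exact: ri_meas.
rewrite !normrM mulrC ler_wpM2r //; apply: le_trans (hK x) _.
exact: ler_norm.
Qed.

Lemma ri_meas_bounded (h : G -> R) (K : R) : measurable_fun [set: G] h ->
  (forall x, `|h x| <= K) -> ri h.
Proof.
move=> mh hK; have := ri_bmul (ri_cst 1) mh hK.
by rewrite (_ : (fun x => 1 * h x) = h) //; apply/funext => x; rewrite mul1r.
Qed.

Lemma RI_add (f h : G -> R) : ri f -> ri h -> RI (fun x => f x + h x) = RI f + RI h.
Proof. by move=> fi hi; rewrite /RI RintegralD. Qed.

Lemma RI_scale (k : R) (f : G -> R) : ri f -> RI (fun x => k * f x) = k * RI f.
Proof. by move=> fi; rewrite /RI RintegralZl. Qed.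

Lemma RI_opp (f : G -> R) : ri f -> RI (fun x => - f x) = - RI f.
Proof.
move=> fi; rewrite -mulN1r -RI_scale //; congr RI.
by apply/funext => x; rewrite mulN1r.
Qed.

Lemma RI_sub (f h : G -> R) : ri f -> ri h -> RI (fun x => f x - h x) = RI f - RI h.
Proof. by move=> fi hi; rewrite RI_add ?RI_opp //; exact: ri_opp. Qed.

Lemma RI_cst (k : R) : RI (fun=> k) = k.
Proof. by rewrite /RI Rintegral_cst //= probability_setT mulr1. Qed.

Lemma RI_le (f h : G -> R) : ri f -> ri h -> (forall x, f x <= h x) -> RI f <= RI h.
Proof. by move=> fi hi fh; apply: le_Rintegral => // x _. Qed.

Lemma RI_ge0 (f : G -> R) : (forall x, 0 <= f x) -> 0 <= RI f.
Proof. by move=> f0; apply: Rintegral_ge0 => x _. Qed.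

Lemma ri_nm (f : G -> C) : ci f -> ri (fun x => nm (f x)).
Proof.
move=> [fr fi]; apply: (ri_le _ (ri_add (ri_abs fr) (ri_abs fi))) => [|x].
  have -> : (fun x => nm (f x)) = fun x =>
      Num.sqrt (complex.Re (f x) ^+ 2 + complex.Im (f x) ^+ 2).
    by apply/funext => x; case: (f x).
  apply: (measurableT_comp (f := @Num.sqrt R)).
    by apply: continuous_measurable_fun; exact: sqrt_continuous.
  by apply: measurable_funD; apply: measurable_funX; exact: ri_meas.
rewrite ger0_norm ?nm_ge0 // ger0_norm ?addr_ge0 //; exact: ler_nm_ReIm.
Qed.

Lemma cont_ri (f : G -> R) : continuous f -> ri f.
Proof.
move=> fc.
have [g Hg] := SU2_max (F := fun x => `|f x|)
  (fun x => continuous_comp (fc x) (@norm_continuous _ R _)).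
exact: (ri_meas_bounded (K := `|f g|)) (cont_meas fc) Hg.
Qed.

Lemma contC_ci f : contC f -> ci f.
Proof. by case=> cr cm; split; exact: cont_ri. Qed.

Lemma ci_add f h : ci f -> ci h -> ci (fun x => f x + h x).
Proof.
move=> [a b] [c d]; split.
  have -> : (fun x => complex.Re (f x + h x)) =
    (fun x => complex.Re (f x) + complex.Re (h x)) by apply/funext => x; rewrite Re_add.
  exact: ri_add.
have -> : (fun x => complex.Im (f x + h x)) =
  (fun x => complex.Im (f x) + complex.Im (h x)) by apply/funext => x; rewrite Im_add.
exact: ri_add.
Qed.

Lemma ci_mul f h : ci f -> contC h -> ci (fun x => f x * h x).
Proof.
move=> [a b] ch; have [K [K0 HK]] := SU2_bounded ch; have [cr cm] := ch.
have hR x : `|complex.Re (h x)| <= K by apply: le_trans (ler_Re_nm _) (HK x).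
have hI x : `|complex.Im (h x)| <= K by apply: le_trans (ler_Im_nm _) (HK x).
have mR := cont_meas cr; have mI := cont_meas cm.
split.
  have -> : (fun x => complex.Re (f x * h x)) = (fun x =>
      complex.Re (f x) * complex.Re (h x) - complex.Im (f x) * complex.Im (h x)).
    by apply/funext => x; rewrite Re_mul.
  by apply: ri_sub; apply: ri_bmul; eauto.
have -> : (fun x => complex.Im (f x * h x)) = (fun x =>
    complex.Re (f x) * complex.Im (h x) + complex.Im (f x) * complex.Re (h x)).
  by apply/funext => x; rewrite Im_mul.
by apply: ri_add; apply: ri_bmul; eauto.
Qed.

Lemma ci_scale c f : ci f -> ci (fun x => c * f x).
Proof.
move=> fi; rewrite (_ : (fun x => c * f x) = (fun x => f x * c)).
  by apply: ci_mul => //; exact: contC_cst.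
by apply/funext => x; rewrite mulrC.
Qed.

Lemma ci_opp f : ci f -> ci (fun x => - f x).
Proof.
move=> fi; have := ci_scale (-1) fi.
by rewrite (_ : (fun x => -1 * f x) = (fun x => - f x)) //; apply/funext => x; rewrite mulN1r.
Qed.

Lemma ci_sub f h : ci f -> ci h -> ci (fun x => f x - h x).
Proof. by move=> fi hi; apply: ci_add => //; exact: ci_opp. Qed.

Lemma cI_add f h : ci f -> ci h -> cI (fun x => f x + h x) = cI f + cI h.
Proof.
move=> [a b] [c d]; apply: complexP; rewrite ?Re_add ?Im_add /= -RI_add //.
  by congr RI; apply/funext => x; rewrite Re_add.
by congr RI; apply/funext => x; rewrite Im_add.
Qed.

Lemma cI_scale c f : ci f -> cI (fun x => c * f x) = c * cI f.
Proof.
move=> [a b]; apply: complexP; rewrite ?Re_mul ?Im_mul /=.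
  rewrite -!RI_scale // -RI_sub; try exact: ri_scale.
  by congr RI; apply/funext => x; rewrite Re_mul.
rewrite -!RI_scale // -RI_add; try exact: ri_scale.
by congr RI; apply/funext => x; rewrite Im_mul.
Qed.

Lemma cI_opp f : ci f -> cI (fun x => - f x) = - cI f.
Proof.
move=> fi; rewrite -mulN1r -cI_scale //; congr cI.
by apply/funext => x; rewrite mulN1r.
Qed.

Lemma cI_sub f h : ci f -> ci h -> cI (fun x => f x - h x) = cI f - cI h.
Proof. by move=> fi hi; rewrite cI_add ?cI_opp //; exact: ci_opp. Qed.

Lemma cI_cst c : cI (fun=> c) = c.
Proof. by rewrite /cI !RI_cst; case: c. Qed.

Lemma ci_sum (I : finType) (F : I -> G -> C) : (forall i, ci (F i)) ->
  ci (fun x => \sum_i F i x) /\ cI (fun x => \sum_i F i x) = \sum_i cI (F i).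
Proof.
move=> H; rewrite /index_enum; elim: (Finite.enum I) => [|i r [IH1 IH2]].
  have -> : (fun x => \sum_(i <- [::]) F i x) = fun=> 0.
    by apply/funext => x; rewrite big_nil.
  by rewrite big_nil cI_cst; split=> //; apply: contC_ci; exact: contC_cst.
have -> : (fun x => \sum_(j <- i :: r) F j x) = fun x => F i x + \sum_(j <- r) F j x.
  by apply/funext => x; rewrite big_cons.
by rewrite big_cons cI_add // IH2; split=> //; exact: ci_add.
Qed.

Lemma cI_bound f (B : G -> R) : ci f -> ri B -> (forall x, nm (f x) <= B x) ->
  nm (cI f) <= RI B.
Proof.
move=> fi Bi H; have B0 x : 0 <= B x by apply: le_trans (nm_ge0 _) (H x).
apply: ler_nm_rot; first exact: RI_ge0.
move=> c c1; rewrite -cI_scale //=; apply: RI_le => // [|x].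
  by have [] := ci_scale c fi.
by apply: le_trans (ler_norm _) _; apply: le_trans (ler_Re_nm _) _; rewrite nmM c1 mul1r.
Qed.

Lemma cI_bound_cst f (B : R) : ci f -> (forall x, nm (f x) <= B) -> nm (cI f) <= B.
Proof. by move=> fi H; rewrite -(RI_cst B); apply: cI_bound => //; exact: ri_cst. Qed.

Hypothesis haar : is_haar mu.

Lemma RI_left (k : G -> R) h : continuous k -> RI (fun x => k (SU2_mul h x)) = RI k.
Proof.
have cm : continuous (SU2_mul h).
  by apply: continuous_mul => [|x]; [exact: cst_continuous|exact: cvg_id].
have mm : measurable_fun [set: G] (SU2_mul h).
  apply: (@measurability _ _ _ _ _ _ (@open G)) => //.
  by move=> _ [U oU <-]; rewrite setTI; apply: open_meas; move/continuousP: cm; exact.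
move=> kc; have ki := cont_ri kc; rewrite /RI /Rintegral; congr fine.
  have kk : continuous (k \o SU2_mul h).
    by move=> x; apply: continuous_comp; [exact: cm|exact: kc].
  have kki : ri (k \o SU2_mul h) by exact: cont_ri.
  have ek : measurable_fun [set: G] (fun x => (k x)%:E).
    by apply/measurable_EFinP; exact: cont_meas.
  have := @integral_pushforward _ _ _ _ R _ mm mu setT (fun x => (k x)%:E) ek.
  rewrite preimage_setT => /(_ kki measurableT) <-.
  apply: eq_measure_integral => A mA _ /=.
  rewrite /pushforward /=.
  have -> : SU2_mul h @^-1` A = SU2_mul (SU2_inv h) @` A.
    apply/seteqP; split=> x /=.
      by move=> Ax; exists (SU2_mul h x) => //; rewrite SU2_mulKV.
    by move=> [y Ay <-]; rewrite SU2_mulVK.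
  exact: haar.
Qed.

Lemma haar_left f h : contC f -> cI (fun x => f (SU2_mul h x)) = cI f.
Proof.
move=> [cr cm].
by rewrite /cI (RI_left h (k := fun x => complex.Re (f x))) // (RI_left h (k := fun x => complex.Im (f x))).
Qed.

End integral.

(** * Approximate identities *)

Section approximate_identity.
Variable R : realType.
Local Notation C := R[i].
Local Notation G := (SU2 R).
Local Notation M2 := 'M[C]_2.
Variable mu : probability G R.
Hypothesis haar : is_haar mu.
Local Notation RI := (RI mu).
Local Notation cI := (cI mu).
Local Notation ci := (ci mu).

(** A polynomial with values in [0, 1] that equals 1 only at the unit, so that its
    powers concentrate there. *)
Definition peak (k : G) : R := (2 + complex.Re (\tr k)) / 4.

Lemma peak_bounds k : 0 <= peak k <= 1.
Proof.
have h (i j : 'I_2) : `|complex.Re (k i j)| <= 1.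
  exact: le_trans (ler_Re_nm _) (SU2_entry_le1 k i j).
have := h 0 0; have := h 1 1; rewrite !ler_norml => /andP[a b] /andP[c d].
by rewrite /peak tr2E Re_add; apply/andP; split; lra.
Qed.

Lemma peak_ge0 k : 0 <= peak k. Proof. by have /andP[] := peak_bounds k. Qed.
Lemma peak_le1 k : peak k <= 1. Proof. by have /andP[] := peak_bounds k. Qed.

Lemma peak_one : peak (SU2_one R) = 1.
Proof. by rewrite /peak mxtrace1 /=; field. Qed.

Lemma peak_eq1 k : peak k = 1 -> k = SU2_one R.
Proof.
move=> E; have x1 : complex.Re (\tr k) / 2 = 1 by move: E; rewrite /peak; lra.
have := sdot_traceless k; rewrite x1 expr1n subrr => /sdot_eq0 S0.
apply: SU2_eq; move: S0; rewrite /= /traceless_mx x1 => /eqP; rewrite subr_eq0 => /eqP ->.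
by [].
Qed.

Lemma peak_inv k : peak (SU2_inv k) = peak k.
Proof. by rewrite /peak SU2_tr_inv. Qed.

Lemma peak_cont (T : topologicalType) (a : T -> G) : continuous a ->
  continuous (fun t => peak (a t)).
Proof.
move=> ac; have [h _] := contC_tr 1%:M ac.
have -> : (fun t => peak (a t)) =
    (fun t => 2^-1 + 4^-1 * complex.Re (\tr (1%:M *m (a t : M2)))).
  by apply/funext => t; rewrite mul1mx /peak; field.
apply: contD; first by move=> x; exact: cst_continuous.
by apply: contM => //; move=> x; exact: cst_continuous.
Qed.

Lemma pol_peak n : pol (fun k : G => ((peak k) ^+ n)%:C).
Proof.
elim: n => [|n IH]; first by rewrite (_ : (fun k => _) = fun=> 1%:C) //; exact: pol_cst.
have -> : (fun k : G => (peak k ^+ n.+1)%:C) =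
    (fun k : G => (2^-1%:C + (4^-1)%:C * \tr (1%:M *m (k : M2))) * (peak k ^+ n)%:C).
  apply/funext => k; rewrite exprS rmorphM mul1mx SU2_tr_real; congr (_ * _).
  by apply: complexP; rewrite /= /peak; field.
apply: polM => //; apply: polD; first exact: pol_cst.
by apply: polZ; exact: pol_tr.
Qed.

Lemma RI_sum_seq (I : choiceType) (s : seq I) (F : I -> G -> R) :
  (forall i, ri mu (F i)) ->
  ri mu (fun x => \sum_(i <- s) F i x) /\
  RI (fun x => \sum_(i <- s) F i x) = \sum_(i <- s) RI (F i).
Proof.
move=> H; elim: s => [|i s [IH1 IH2]].
  have -> : (fun x => \sum_(i <- [::]) F i x) = fun=> 0.
    by apply/funext => x; rewrite big_nil.
  by rewrite big_nil RI_cst; split=> //; exact: ri_cst.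
have -> : (fun x => \sum_(j <- i :: s) F j x) = fun x => F i x + \sum_(j <- s) F j x.
  by apply/funext => x; rewrite big_cons.
by rewrite big_cons RI_add // IH2; split=> //; exact: ri_add.
Qed.

Lemma peak_exp_cont n (h : G) : continuous (fun x => peak (SU2_mul h x) ^+ n).
Proof.
have hc : continuous (SU2_mul h).
  by apply: continuous_mul => [|x]; [exact: cst_continuous|exact: cvg_id].
elim: n => [|n IH]; first by move=> x; exact: cst_continuous.
have -> : (fun x => peak (SU2_mul h x) ^+ n.+1) =
    (fun x => peak (SU2_mul h x) * peak (SU2_mul h x) ^+ n).
  by apply/funext => x; rewrite exprS.
by apply: contM => //; exact: peak_cont.
Qed.

(** Finitely many translates of the set where the peak exceeds c cover the group,
    and the translates of a power of the peak have equal integrals. *)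
Lemma peak_mass (c : R) : 0 <= c -> c < 1 ->
  exists2 N : R, 0 < N & forall n, c ^+ n <= N * RI (fun k => peak k ^+ n).
Proof.
move=> c0 c1; pose V (g : G) := [set x : G | c < peak (SU2_mul (SU2_inv g) x)].
have oV (g : G) : [set: G] g -> open (V g).
  move=> _; have := @peak_exp_cont 1 (SU2_inv g) => /continuousP.
  move=> /(_ [set y | c < y] (@open_gt _ c)).
  by rewrite (_ : _ @^-1` _ = V g).
have : cover_compact [set: G] by rewrite -compact_cover; exact: SU2_compact.
move=> /(_ G setT V oV) [x _|D' _ DV].
  by exists x => //; rewrite /V /= SU2_Vmul peak_one.
pose D : seq G := finmap.enum_fset D'.
have E n (g : G) : RI (fun x => peak (SU2_mul g x) ^+ n) = RI (fun k => peak k ^+ n).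
  have cc : continuous (fun x : G => peak x ^+ n).
    rewrite (_ : (fun x => _) = fun x => peak (SU2_mul (SU2_one R) x) ^+ n).
      exact: peak_exp_cont.
    by apply/funext => x; rewrite SU2_1mul.
  exact: (RI_left haar g cc).
have H n : c ^+ n <= (size D)%:R * RI (fun k => peak k ^+ n).
  have [i1 i2] := @RI_sum_seq G D (fun g x => peak (SU2_mul (SU2_inv g) x) ^+ n)
    (fun g => cont_ri mu (@peak_exp_cont n (SU2_inv g))).
  rewrite mulr_natl -[X in _ <= X](_ : \sum_(g <- D) RI (fun x => peak (SU2_mul (SU2_inv g) x) ^+ n) = _).
    rewrite -i2 -[X in X <= _](RI_cst mu); apply: RI_le => // [|x]; first exact: ri_cst.
    have [g gD gx] := DV x I; rewrite /= in gD.
    rewrite (big_rem g) //=; apply: ler_wpDr.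
      by apply: sumr_ge0 => i _; rewrite exprn_ge0 // peak_ge0.
    by rewrite lerXn2r ?nnegrE ?peak_ge0 // ltW.
  by rewrite (eq_bigr _ (fun g _ => E n (SU2_inv g))) big_const_seq count_predT iter_addr_0.
exists ((size D)%:R + 1); first by rewrite ltr_wpDl.
move=> n; apply: (le_trans (H n)); rewrite mulrDl mul1r lerDl.
by apply: RI_ge0 => x; rewrite exprn_ge0 // peak_ge0.
Qed.

Lemma peak_ri n : ri mu (fun k => peak k ^+ n).
Proof.
have := cont_ri mu (@peak_exp_cont n (SU2_one R)).
by congr ri; apply/funext => x; rewrite SU2_1mul.
Qed.

(** Otherwise the integrals of the powers would decrease at a geometric rate faster
    than [peak_mass] permits. *)
Lemma peak_conc (d : R) : 0 < d -> exists n, 0 < RI (fun k => peak k ^+ n) /\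
  RI (fun k => peak k ^+ n * (1 - peak k)) <= d * RI (fun k => peak k ^+ n).
Proof.
move=> d0; pose a n := RI (fun k => peak k ^+ n).
pose e := Num.min d (2^-1); have e0 : 0 < e by rewrite /e lt_min d0 /=; lra.
have e1 : e <= 2^-1 by rewrite /e ge_min lexx orbT.
have ed : e <= d by rewrite /e ge_min lexx.
have [N N0 HN] := @peak_mass (1 - e / 2) ltac:(lra) ltac:(lra).
have ap n : 0 < a n.
  have : 0 < N * a n by apply: lt_le_trans (HN n); rewrite exprn_gt0 //; lra.
  by rewrite pmulr_rgt0.
have aE n : RI (fun k => peak k ^+ n * (1 - peak k)) = a n - a n.+1.
  rewrite /a -RI_sub; try exact: peak_ri.
  by congr RI; apply/funext => k; rewrite exprSr; ring.
apply: contrapT => no.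
have step n : a n.+1 <= (1 - e) * a n.
  rewrite leNgt; apply/negP => h; apply: no; exists n; split; first exact: ap.
  rewrite aE -/(a n); apply: (@le_trans _ _ (e * a n)); first by lra.
  by rewrite ler_wpM2r // ltW.
have an n : a n <= (1 - e) ^+ n.
  elim: n => [|n IH]; first by rewrite /a expr0 (_ : (fun k => _) = fun=> 1) ?RI_cst.
  rewrite exprS; apply: le_trans (step n) _; rewrite ler_wpM2l //; lra.
(* The upper bound (1 - e)^n against the lower bound (1 - e / 2)^n / N. *)
pose r : R := (1 - e) / (1 - e / 2).
have cp : 0 < 1 - e / 2 by lra.
have r0 : 0 <= r by rewrite divr_ge0 //; lra.
have r1 : r < 1 by rewrite ltr_pdivrMr //; lra.
have Hr n : 1 <= N * r ^+ n.
  rewrite expr_div_n mulrA ler_pdivlMr ?exprn_gt0 // mul1r.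
  by apply: le_trans (HN n) _; rewrite ler_pM2l //; exact: an.
have : (N * r ^+ n) @[n --> \oo] --> N * 0.
  by apply: cvgMl_tmp; apply: cvg_expr; rewrite ger0_norm.
rewrite mulr0 => /cvgrPdist_lt /(_ 1 ltr01) [n _ /(_ n (leqnn n))] /=.
rewrite sub0r normrN ger0_norm; last by rewrite mulr_ge0 ?exprn_ge0 // ltW.
by rewrite ltNge Hr.
Qed.

(** A nonnegative polynomial of integral one that is concentrated near 1. *)
Definition bump (d : R) (q : G -> R) : Prop :=
  [/\ pol (fun k => (q k)%:C), (forall k, 0 <= q k), RI q = 1,
      RI (fun k => q k * (1 - peak k)) <= d & forall k, q (SU2_inv k) = q k].

Lemma bump_exists (d : R) : 0 < d -> exists q, bump d q.
Proof.
move=> /peak_conc[n [a0 H]]; set a := RI _ in a0 H.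
exists (fun k => a^-1 * peak k ^+ n); split.
- rewrite (_ : (fun k => _) = fun k => (a^-1)%:C * (peak k ^+ n)%:C).
    by apply: polZ; exact: pol_peak.
  by apply/funext => k; rewrite rmorphM.
- by move=> k; rewrite mulr_ge0 ?invr_ge0 ?exprn_ge0 ?peak_ge0 // ltW.
- by rewrite RI_scale ?mulVf ?gt_eqF //; exact: peak_ri.
- rewrite (_ : (fun k => _) = fun k => a^-1 * (peak k ^+ n * (1 - peak k))).
    rewrite RI_scale; first by rewrite mulrC ler_pdivrMr.
    rewrite (_ : (fun k => _) = fun k => peak k ^+ n - peak k ^+ n.+1).
      by apply: ri_sub; exact: peak_ri.
    by apply/funext => k; rewrite exprSr; ring.
  by apply/funext => k; rewrite mulrA.
- by move=> k; rewrite peak_inv.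
Qed.

Lemma bump_contC d q : bump d q -> contC (fun k => (q k)%:C).
Proof. by case=> pq _ _ _ _; exact: pol_contC pq. Qed.

Lemma bump_ri d q : bump d q -> ri mu q.
Proof. by move=> /bump_contC/(contC_ci mu)[]. Qed.

(** By compactness: the function is below e near the points with k = 1, and
    1 - peak k is bounded below elsewhere. *)
Lemma peak_modulus (a : G * G -> C) (e : R) : contC a ->
  (forall g, a (SU2_one R, g) = 0) -> 0 < e ->
  exists K : R, 0 <= K /\ forall k g, nm (a (k, g)) <= e + K * (1 - peak k).
Proof.
move=> ac a1 e0.
have cp : compact [set: G * G].
  have -> : [set: G * G] = [set: G] `*` [set: G] by apply/seteqP; split=> // -[].
  by apply: compact_setX; exact: SU2_compact.
have pc : continuous (fun x : G * G => peak x.1) by apply: peak_cont => x; exact: cvg_fst.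
have ncov := (compact_near_coveringP _).1 cp nat \oo
  (fun n x => nm (a x) < e + n%:R * (1 - peak x.1)).
have [|n _ H] := ncov _; last first.
  exists n%:R; split=> // k g; apply: ltW; exact: (H n (leqnn n) (k, g)).
move=> [k g] _.
have [n Hn] : exists n : nat, nm (a (k, g)) < e + n%:R * (1 - peak k).
  have [k1|k1] := eqVneq (peak k) 1.
    by exists 0%N; rewrite (peak_eq1 k1) a1 nm0 mul0r addr0.
  have pk : 0 < 1 - peak k by rewrite subr_gt0 lt_neqAle k1 peak_le1.
  exists (Num.truncn (nm (a (k, g)) / (1 - peak k))).+1.
  have := truncnS_gt (nm (a (k, g)) / (1 - peak k)); rewrite ltr_pdivrMr // => h.
  by apply: lt_le_trans h _; rewrite lerDr ltW.
have c1 : continuous (fun x : G * G => e + n%:R * (1 - peak x.1) - nm (a x)).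
  apply: contD; last by apply: contN; exact: contC_nm.
  apply: contD; first by move=> x; exact: cst_continuous.
  apply: contM; first by move=> x; exact: cst_continuous.
  by apply: contD; [move=> x; exact: cst_continuous|exact: contN].
have /= h0 := cvgr_gt _ (c1 (k, g)) 0.
have pos : 0 < e + n%:R * (1 - peak k) - nm (a (k, g)) by lra.
have h := h0 _ pos.
exists ([set x | 0 < e + n%:R * (1 - peak x.1) - nm (a x)], [set m | (n <= m)%N]).
  by split; [exact: h|exists n].
move=> [x m] [/= hx nm_]; rewrite subr_gt0 in hx; apply: lt_le_trans hx _.
by rewrite lerD2l ler_wpM2r ?ler_nat // subr_ge0 peak_le1.
Qed.

Lemma bump_approx (a : G * G -> C) (e : R) : contC a ->
  (forall g, a (SU2_one R, g) = 0) -> 0 < e ->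
  exists2 d : R, 0 < d & forall q, bump d q -> forall g,
    nm (cI (fun k => (q k)%:C * a (k, g))) <= e.
Proof.
move=> ac a1 e0; have e2 : 0 < e / 2 by rewrite divr_gt0.
have [K [K0 HK]] := peak_modulus ac a1 e2.
have K1 : 0 < K + 1 by rewrite ltr_wpDl.
exists (e / 2 / (K + 1)); first by rewrite divr_gt0.
move=> q bq g; have [pq q0 q1 qd _] := bq; have qi := bump_ri bq.
have qc := bump_contC bq; have [qr _] := qc.
have agc : contC (fun k => a (k, g)).
  apply: (@contC_comp R G _ a (fun k => (k, g))) => // k.
  exact: (cvg_pair (@cvg_id _ (nbhs k)) (@cvg_cst _ g _ (nbhs k) _)).
have pr : ri mu (fun k => q k * (1 - peak k)).
  apply: cont_ri; apply: contM => //; apply: contD; first by move=> x; exact: cst_continuous.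
  by apply: contN; apply: peak_cont => x; exact: cvg_id.
apply: (le_trans (cI_bound (B := fun k => e / 2 * q k + K * (q k * (1 - peak k))) _ _ _)).
- by apply: contC_ci; apply: contCM.
- by apply: ri_add; apply: ri_scale.
- move=> k; rewrite nmM nm_real ger0_norm //.
  rewrite (_ : _ + _ = q k * (e / 2 + K * (1 - peak k))); last by ring.
  by rewrite ler_wpM2l.
rewrite RI_add; try exact: ri_scale.
rewrite !RI_scale // q1 mulr1.
have h : K * RI (fun k => q k * (1 - peak k)) <= e / 2.
  have h1 : K * RI (fun k => q k * (1 - peak k)) <= K * (e / 2 / (K + 1)) by rewrite ler_wpM2l.
  apply: le_trans h1 _; rewrite mulrA ler_pdivrMr // mulrC ler_wpM2l ?lerDl //.
  exact: ltW.
by lra.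
Qed.

End approximate_identity.

(** * Density of polynomials and unimodularity *)

Section unimodular.
Variable R : realType.
Local Notation C := R[i].
Local Notation G := (SU2 R).
Local Notation M2 := 'M[C]_2.
Variable mu : probability G R.
Hypothesis haar : is_haar mu.
Local Notation RI := (RI mu).
Local Notation cI := (cI mu).
Local Notation ci := (ci mu).

Lemma contC_mx_entry (a b : G -> G) (M : M2) i j : continuous a -> continuous b ->
  contC (fun k => ((b k : M2) *m M *m (a k : M2)) i j).
Proof.
move=> ac bc.
have -> : (fun k => ((b k : M2) *m M *m (a k : M2)) i j) = fun k =>
    (b k i 0 * M 0 0 + b k i 1 * M 1 0) * a k 0 j +
    (b k i 0 * M 0 1 + b k i 1 * M 1 1) * a k 1 j.
  by apply/funext => k; rewrite !mulmx2E.
have h l c : contC (fun k => b k i l * c) by apply: contCM; [exact: contC_SU2|exact: contC_cst].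
by apply: contCD; apply: contCM; [exact: contCD|exact: contC_SU2|exact: contCD|exact: contC_SU2].
Qed.

Lemma tr_entries (N M : M2) : \tr (N *m M) = \sum_(p : 'I_2 * 'I_2) N p.1 p.2 * M p.2 p.1.
Proof.
rewrite /mxtrace -(pair_bigA _ (fun i j => N i j * M j i)) /=.
by apply: eq_bigr => i _; rewrite mxE.
Qed.

Lemma pol_entry (i j : 'I_2) : pol (fun g : G => g i j).
Proof.
have -> : (fun g : G => g i j) = fun g : G => \tr (delta_mx j i *m (g : M2)).
  by apply/funext => g; rewrite mxtrace_mulC /mxtrace (bigD1 i) //= big1 ?addr0 => [|l li];
    rewrite mxE (bigD1 j) //= big1 ?addr0 => [|l' l'j]; rewrite mxE ?eqxx ?mulr1 ?(negbTE li) ?(negbTE l'j) ?andbF ?mulr0 //.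
exact: pol_tr.
Qed.

(** Averaging a polynomial over translates gives a polynomial, since the
    translates stay in a space spanned by finitely many polynomials. *)
Lemma pol_average (a b : G -> G) (f phi : G -> C) : continuous a -> continuous b ->
  pol f -> contC phi ->
  pol (fun g => cI (fun k => f (SU2_mul (a k) (SU2_mul g (b k))) * phi k)).
Proof.
move=> ac bc [n pf]; elim: pf phi => {n f} [n c|n M f pf IH|n f h pf IHf ph IHh] phi phic.
- exact: pol_cst.
- have fc (g : G) : contC (fun k => f (SU2_mul (a k) (SU2_mul g (b k)))).
    apply: contC_comp; first exact: polyfun_contC pf.
    by apply: continuous_mul => //; apply: continuous_mul => // x; exact: cst_continuous.
  pose m (p : 'I_2 * 'I_2) k := ((b k : M2) *m M *m (a k : M2)) p.1 p.2.
  have mc p : contC (m p) by exact: contC_mx_entry.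
  rewrite (_ : (fun g => _) = fun g : G => \sum_p (g p.2 p.1 *
      cI (fun k => f (SU2_mul (a k) (SU2_mul g (b k))) * (m p k * phi k)))).
    apply: pol_sum => p; apply: polM; first exact: pol_entry.
    by apply: IH; exact: contCM.
  apply/funext => g.
  have i1 p : ci (fun k => f (SU2_mul (a k) (SU2_mul g (b k))) * (m p k * phi k)).
    by apply: contC_ci; apply: contCM => //; exact: contCM.
  have i2 p : ci (fun k => g p.2 p.1 *
      (f (SU2_mul (a k) (SU2_mul g (b k))) * (m p k * phi k))) by exact: ci_scale.
  rewrite -(eq_bigr _ (fun p _ => cI_scale _ (i1 p))) -(ci_sum i2).2.
  congr (cI _); apply/funext => k /=.
  rewrite (_ : \tr _ = \tr ((b k : M2) *m M *m (a k : M2) *m (g : M2))).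
    rewrite tr_entries !mulr_suml; apply: eq_bigr => p _.
    by rewrite -/(m p k); move: (m p k) (f _) => x y; ring.
  by rewrite !mulmxA mxtrace_mulC !mulmxA.
- have fc (f' : G -> C) (g : G) : contC f' -> contC (fun k => f' (SU2_mul (a k) (SU2_mul g (b k))) * phi k).
    move=> cf; apply: contCM => //; apply: contC_comp => //.
    by apply: continuous_mul => //; apply: continuous_mul => // x; exact: cst_continuous.
  rewrite (_ : (fun g => _) = fun g =>
      cI (fun k => f (SU2_mul (a k) (SU2_mul g (b k))) * phi k) +
      cI (fun k => h (SU2_mul (a k) (SU2_mul g (b k))) * phi k)).
    by apply: polD; [exact: IHf|exact: IHh].
  apply/funext => g; rewrite -cI_add.
  + by congr (cI _); apply/funext => k; rewrite mulrDl.
  + by apply: contC_ci; apply: fc; exact: polyfun_contC pf.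
  + by apply: contC_ci; apply: fc; exact: polyfun_contC ph.
Qed.

Lemma continuous_idG : continuous (fun g : G => g). Proof. by move=> x; exact: cvg_id. Qed.
Lemma continuous_invG : continuous (@SU2_inv R).
Proof. by apply: continuous_inv; exact: continuous_idG. Qed.
Lemma continuous_cstG (g : G) : continuous (fun _ : G => g).
Proof. by move=> x; exact: cst_continuous. Qed.
Lemma continuous_mull (h : G) : continuous (fun g : G => SU2_mul h g).
Proof. by apply: continuous_mul; [exact: continuous_cstG|exact: continuous_idG]. Qed.
Lemma continuous_mulr (h : G) : continuous (fun g : G => SU2_mul g h).
Proof. by apply: continuous_mul; [exact: continuous_idG|exact: continuous_cstG]. Qed.

Lemma contC_pair (f : G -> C) : contC f ->
  contC (fun x : G * G => f (SU2_mul x.1 x.2)) /\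
  contC (fun x : G * G => f (SU2_mul x.2 x.1)) /\ contC (fun x : G * G => f x.2).
Proof.
have c1 : continuous (fun x : G * G => x.1) by move=> x; exact: cvg_fst.
have c2 : continuous (fun x : G * G => x.2) by move=> x; exact: cvg_snd.
move=> fc; split; first by apply: contC_comp => //; exact: continuous_mul.
by split; apply: contC_comp => //; exact: continuous_mul.
Qed.

Lemma contC_sub (T : topologicalType) (f h : T -> C) : contC f -> contC h ->
  contC (fun x => f x - h x).
Proof.
move=> fc hc; rewrite (_ : (fun x => _) = fun x => f x + (-1) * h x).
  by apply: contCD => //; apply: contCM => //; exact: contC_cst.
by apply/funext => x; rewrite mulN1r.
Qed.

(** Stone-Weierstrass for SU(2), by convolution with a bump. *)
Lemma pol_dense (phi : G -> C) (e : R) : contC phi -> 0 < e ->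
  exists2 p, pol p & forall g, nm (phi g - p g) <= e.
Proof.
move=> pc e0; have [c1 [c2 c3]] := contC_pair pc.
have [||d d0 Hd] := bump_approx mu (a := fun x => phi x.2 - phi (SU2_mul x.2 x.1)) _ _ e0.
- exact: contC_sub.
- by move=> g; rewrite /= SU2_mul1 subrr.
have [q bq] := bump_exists haar d0; have [pq _ q1 _ qV] := bq.
have qc := pol_contC pq.
exists (fun g => cI (fun k => (q (SU2_mul (SU2_inv k) (SU2_mul g (SU2_one R))))%:C * phi k)).
  apply: (pol_average (a := @SU2_inv R) (b := fun=> SU2_one R)
    (f := fun k => (q k)%:C)) => //; [exact: continuous_invG|exact: continuous_cstG].
move=> g; apply: le_trans (Hd _ bq g).
rewrite (_ : phi g - _ = cI (fun k => (q k)%:C * (phi g - phi (SU2_mul g k)))) //.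
have pgc : contC (fun k => phi (SU2_mul g k)).
  by apply: contC_comp => //; exact: continuous_mull.
have -> : (fun k => (q k)%:C * (phi g - phi (SU2_mul g k))) =
    (fun k => phi g * (q k)%:C - (q k)%:C * phi (SU2_mul g k)).
  by apply/funext => k; ring.
have iq : ci (fun k => (q k)%:C) by exact: contC_ci.
rewrite cI_sub ?cI_scale; try by [|apply: contC_ci; apply: contCM|apply: ci_scale].
have -> : cI (fun k => (q k)%:C) = 1.
  by rewrite cIE /= q1; congr (_ +i* _); exact: RI_cst.
rewrite mulr1; congr (_ - _).
have hc : contC (fun k => (q (SU2_mul (SU2_inv k) (SU2_mul g (SU2_one R))))%:C * phi k).
  apply: contCM => //; apply: (contC_comp (f := fun k => (q k)%:C)) => //.
  by apply: continuous_mul; [exact: continuous_invG|exact: continuous_cstG].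
rewrite -(haar_left haar g hc); congr (cI _); apply/funext => k.
congr (_%:C * _); rewrite SU2_mul1 SU2_invM -SU2_mulA SU2_Vmul SU2_mul1.
exact: qV.
Qed.

(** Separation of variables: with it, double integrals of f (k^-1 h) are finite sums
    of products of integrals, which can be computed in either order. *)
Lemma finite_rank n (f : G -> C) : polyfun n f ->
  exists (I : finType) (a b : I -> G -> C), [/\ forall i, contC (a i), forall i, contC (b i) &
    forall k h, f (SU2_mul (SU2_inv k) h) = \sum_i a i k * b i h].
Proof.
elim=> {n f} [n c|n M f pf [I [a [b [ac bc E]]]]|n f h pf [I [a [b [ac bc E]]]] ph [J [a' [b' [ac' bc' E']]]]].
- exists unit, (fun _ _ => c), (fun _ _ => 1); split=> [i|i|k h]; try exact: contC_cst.
  by rewrite big_const card_unit /= addr0 mulr1.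
- exists [the finType of ('I_2 * 'I_2 * I)%type],
    (fun p (k : G) => (M *m (SU2_inv k : M2)) p.1.1 p.1.2 * a p.2 k),
    (fun p (h : G) => h p.1.2 p.1.1 * b p.2 h); split=> [p|p|k h].
  + apply: contCM => //.
    have := contC_mx_entry M p.1.1 p.1.2 continuous_invG (@continuous_cstG (SU2_one R)).
    have -> // : (fun k : G => (M *m (SU2_inv k : M2)) p.1.1 p.1.2) =
        (fun k : G => ((SU2_one R : M2) *m M *m (SU2_inv k : M2)) p.1.1 p.1.2).
    by apply/funext => k; rewrite mul1mx.
  + by apply: contCM => //; exact: pol_contC (pol_entry _ _).
  + rewrite E /= mulmxA tr_entries big_distrlr /= pair_bigA /=; apply: eq_bigr => p _.
    by rewrite mulrACA.
- exists [the finType of (I + J)%type],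
    (fun s => match s with inl i => a i | inr j => a' j end),
    (fun s => match s with inl i => b i | inr j => b' j end); split=> [[]|[]|k x] //.
  by rewrite E E' big_sumType.
Qed.

(** Both sides are the double integral of f (k^-1 h), by left invariance in k and
    in h respectively. *)
Lemma haar_inv_pol f : pol f -> cI (fun k => f (SU2_inv k)) = cI f.
Proof.
move=> pf; have fc := pol_contC pf; have [n /finite_rank[I [a [b [ac bc E]]]]] := pf.
have fic : contC (fun k => f (SU2_inv k)) by apply: contC_comp => //; exact: continuous_invG.
have E1 k : \sum_i cI (b i) * a i k = cI f.
  rewrite -(haar_left haar (SU2_inv k) fc).
  have -> : (fun h => f (SU2_mul (SU2_inv k) h)) = (fun h => \sum_i a i k * b i h).
    by apply/funext => h; rewrite E.
  rewrite (ci_sum _).2 => [|i]; last by apply: ci_scale; exact: contC_ci.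
  by apply: eq_bigr => i _; rewrite cI_scale 1?mulrC //; exact: contC_ci.
have E2 h : \sum_i cI (a i) * b i h = cI (fun k => f (SU2_inv k)).
  rewrite -(haar_left haar (SU2_inv h) fic).
  have -> : (fun k => f (SU2_inv (SU2_mul (SU2_inv h) k))) = (fun k => \sum_i b i h * a i k).
    apply/funext => k; rewrite SU2_invM SU2_invK E.
    by apply: eq_bigr => i _; rewrite mulrC.
  rewrite (ci_sum _).2 => [|i]; last by apply: ci_scale; exact: contC_ci.
  by apply: eq_bigr => i _; rewrite cI_scale 1?mulrC //; exact: contC_ci.
have F (a' b' : I -> G -> C) (c : C) : (forall i, contC (a' i)) ->
    (forall k, \sum_i cI (b' i) * a' i k = c) -> \sum_i cI (b' i) * cI (a' i) = c.
  move=> ac' H; rewrite -[RHS](cI_cst mu) -(_ : (fun k => \sum_i cI (b' i) * a' i k) = fun=> c).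
    rewrite (ci_sum _).2 => [|i]; last by apply: ci_scale; exact: contC_ci.
    by apply: eq_bigr => i _; rewrite cI_scale //; exact: contC_ci.
  exact/funext.
rewrite -(F b a _ bc E2) -(F a b _ ac E1).
by apply: eq_bigr => i _; rewrite mulrC.
Qed.

Lemma nm_small (z : C) : (forall e : R, 0 < e -> nm z <= e) -> z = 0.
Proof.
move=> H; apply: nm_eq0; apply/eqP; rewrite eq_le nm_ge0 andbT.
by apply/ler_addgt0Pr => e e0; rewrite add0r; exact: H.
Qed.

Lemma haar_inv f : contC f -> cI (fun k => f (SU2_inv k)) = cI f.
Proof.
move=> fc; apply/eqP; rewrite -subr_eq0; apply/eqP/nm_small => e e0.
have e2 : 0 < e / 2 by rewrite divr_gt0.
have [p pp Hp] := pol_dense fc e2; have pc := pol_contC pp.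
have inv (h : G -> C) : contC h -> contC (fun k => h (SU2_inv k)).
  by move=> hc; apply: contC_comp => //; exact: continuous_invG.
rewrite (_ : _ - _ = cI (fun k => f (SU2_inv k) - p (SU2_inv k)) - cI (fun k => f k - p k)).
  have -> : e = e / 2 + e / 2 by field.
  rewrite (le_trans (nmB _ _)) // lerD //; apply: cI_bound_cst => //;
    by apply: contC_ci; apply: contC_sub => //; exact: inv.
rewrite !cI_sub ?(haar_inv_pol pp) //; try by apply: contC_ci => //; exact: inv.
by ring.
Qed.

(** Inversion exchanges left and right translations. *)
Lemma haar_right f h : contC f -> cI (fun k => f (SU2_mul k h)) = cI f.
Proof.
move=> fc; have inv (k : G -> C) : contC k -> contC (fun x => k (SU2_inv x)).
  by move=> hc; apply: contC_comp => //; exact: continuous_invG.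
have c1 : contC (fun k => f (SU2_mul k h)) by apply: contC_comp => //; exact: continuous_mulr.
rewrite -(haar_inv c1) -(haar_inv fc) -(haar_left haar (SU2_inv h) (inv _ fc)).
by congr (cI _); apply/funext => k; rewrite SU2_invM SU2_invK.
Qed.

End unimodular.

(** * Integration of left-invariant derivatives *)

Section differentiation_under_integral.
Variable R : realType.
Local Notation C := R[i].
Local Notation G := (SU2 R).
Local Notation M2 := 'M[C]_2.

Lemma is_derive_small (f : R -> R) (l : R) :
  (forall e : R, 0 < e -> exists2 d : R, 0 < d &
    forall t : R, `|t| < d -> `|f t - f 0 - t * l| <= e * `|t|) -> is_derive (0 : R) 1 f l.
Proof.
move=> H.
have h : (fun t : R => t^-1 *: ((f \o shift 0) (t *: 1) - f 0)) @ 0^' --> l.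
  apply/cvgrPdist_le => e e0; have [d d0 Hd] := H e e0.
  exists d => // t /=; rewrite sub0r normrN => td t0.
  rewrite /shift /= addr0 scaler1.
  have -> : l - t^-1 *: (f t - f 0) = - (t^-1 * (f t - f 0 - t * l)).
    by rewrite /GRing.scale /=; field.
  by rewrite normrN normrM normfV ler_pdivrMl ?normr_gt0 // [leRHS]mulrC; exact: Hd.
by apply: DeriveDef; [apply/cvg_ex; exists l|exact: cvg_lim h].
Qed.

Lemma isCd_small (f : R -> C) (l : C) :
  (forall e : R, 0 < e -> exists2 d : R, 0 < d &
    forall t : R, `|t| < d -> nm (f t - f 0 - t%:C * l) <= e * `|t|) -> isCd f 0 l.
Proof.
move=> H; split; apply: is_derive_small => e e0; have [d d0 Hd] := H e e0; exists d => // t td;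
  apply: le_trans (Hd t td).
  have := ler_Re_nm (f t - f 0 - t%:C * l); congr (`|_| <= _).
  by move: (f t) (f 0) (l) => [a b] [c c'] [x y] /=; ring.
have := ler_Im_nm (f t - f 0 - t%:C * l); congr (`|_| <= _).
by move: (f t) (f 0) (l) => [a b] [c c'] [x y] /=; ring.
Qed.

Lemma translate_uniform A (h : G -> C) (e : R) : contC h -> 0 < e ->
  exists2 d : R, 0 < d & forall (t : R) g, `|t| < d -> nm (h (translate A g t) - h g) < e.
Proof.
move=> hc e0.
have ncov := (compact_near_coveringP _).1 (@SU2_compact R) R (nbhs (0 : R))
  (fun t g => nm (h (translate A g t) - h g) < e) _.
have [|d /= d0 H] := ncov _; last first.
  by exists d => // t g td; apply: (H t _ g) => //=; rewrite sub0r normrN.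
move=> g _.
have cc : contC (fun x : G * R => h (translate A x.1 x.2) - h x.1).
  apply: contC_sub; apply: contC_comp => //; last by move=> x; exact: cvg_fst.
  by apply: continuous_translate => x; [exact: cvg_fst|exact: cvg_snd].
have cn : continuous (fun x : G * R => e - nm (h (translate A x.1 x.2) - h x.1)).
  apply: contD; first by move=> x; exact: cst_continuous.
  by apply: contN; exact: contC_nm.
have /= h0 := cvgr_gt _ (cn (g, 0)) 0.
have pos : 0 < e - nm (h (translate A g 0) - h g).
  by rewrite translate0 subrr nm0 subr0.
have nb : \forall x \near (g, (0 : R)), 0 < e - nm (h (translate A x.1 x.2) - h x.1).
  exact: h0.
by apply: (@filterS _ (nbhs (g, (0 : R))) _ _ _ _ nb) => x /= hx; rewrite -subr_gt0.
Qed.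

(** The mean value inequality and uniform continuity of the derivative along the
    orbits, by compactness. *)
Lemma lie_uniform A (f : G -> C) (e : R) : lie_diff f -> contC (lie_derive A f) -> 0 < e ->
  exists2 d : R, 0 < d & forall (t : R) g, `|t| < d ->
    nm (f (translate A g t) - f g - t%:C * lie_derive A f g) <= e * `|t|.
Proof.
move=> df cf e0.
have [d d0 Hd] := translate_uniform A cf e0.
exists d => // t g td.
pose F (s : R) := f (translate A g s) - s%:C * lie_derive A f g.
have FE : f (translate A g t) - f g - t%:C * lie_derive A f g = F t - F 0.
  by rewrite /F translate0 mul0r subr0 addrAC.
have dF (s : R) : isCd F s (lie_derive A f (translate A g s) - lie_derive A f g).
  apply: isCdD; first exact: lie_diff_at.
  have h : isCd (fun s : R => - (s%:C)) s (-1).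
    split=> /=; first exact: is_deriveNE (is_derive_id _ _).
    by rewrite oppr0; exact: is_derive_cst.
  have := isCdM h (isCd_cst (lie_derive A f g) s); rewrite mulr0 addr0 mulN1r.
  by rewrite (_ : (fun s0 => _) = fun s : R => - (s%:C * lie_derive A f g)) //;
    apply/funext => x; rewrite mulNr.
rewrite FE; have [t0|t0] := leP 0 t.
  rewrite ger0_norm // -[X in e * X]subr0.
  apply: (isCd_mvt t0 (ltW e0)) => s /andP[s0 st]; split; first exact: dF.
  by apply/ltW/Hd; rewrite ger0_norm //; rewrite ger0_norm // in td; exact: le_lt_trans td.
rewrite ltr0_norm // nm_distC -[X in e * X]add0r.
apply: (isCd_mvt (ltW t0) (ltW e0)) => s /andP[s0 st]; split; first exact: dF.
apply/ltW/Hd; rewrite ler0_norm //; rewrite ltr0_norm // in td.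
by apply: le_lt_trans td; rewrite lerN2.
Qed.

Variable mu : probability G R.
Hypothesis haar : is_haar mu.
Local Notation RI := (RI mu).
Local Notation cI := (cI mu).
Local Notation ci := (ci mu).

Lemma isCd_integral A (q f : G -> C) g : contC q -> contC f -> lie_diff f ->
  contC (lie_derive A f) ->
  isCd (fun t => cI (fun k => q k * f (SU2_mul k (translate A g t)))) 0
    (cI (fun k => q k * lie_derive A f (SU2_mul k g))).
Proof.
move=> qc fc df cf; apply: isCd_small => e e0.
have [K [K0 HK]] := SU2_bounded qc.
have K1 : 0 < K + 1 by rewrite ltr_wpDl.
have [d d0 Hd] := lie_uniform df cf (divr_gt0 e0 K1).
exists d => // t td.
have tr (h : G -> C) (x : G) : contC h -> contC (fun k => q k * h (SU2_mul k x)).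
  by move=> hc; apply: contCM => //; apply: contC_comp => //; exact: continuous_mulr.
rewrite -cI_scale; last by apply: contC_ci; exact: tr.
rewrite -!cI_sub; try by [do ?apply: ci_sub; try apply: ci_scale; apply: contC_ci; exact: tr].
apply: cI_bound_cst => [|k].
  by do ?apply: ci_sub; try apply: ci_scale; apply: contC_ci; exact: tr.
rewrite (_ : _ - _ = q k * (f (translate A (SU2_mul k g) t) - f (SU2_mul k g) -
  t%:C * lie_derive A f (SU2_mul k g))); last first.
  by rewrite translate_mul translate0; ring.
rewrite nmM; apply: (@le_trans _ _ ((K + 1) * (e / (K + 1) * `|t|))).
  apply: ler_pM; rewrite ?nm_ge0 ?Hd //.
  by apply: le_trans (HK k) _; rewrite lerDl.
by rewrite mulrA mulrCA mulfV ?gt_eqF // mulr1.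
Qed.

(** The integral of f (g exp (t A)) over g does not depend on t, by right invariance. *)
Lemma int_lie0 A f : contC f -> lie_diff f -> contC (lie_derive A f) ->
  cI (lie_derive A f) = 0.
Proof.
move=> fc df cf.
have h := isCd_integral (SU2_one R) (@contC_cst R G 1) fc df cf.
have E : (fun t : R => cI (fun k => 1 * f (SU2_mul k (translate A (SU2_one R) t)))) = fun=> cI f.
  apply/funext => t; rewrite -[RHS](haar_right haar (translate A (SU2_one R) t) fc).
  by congr (cI _); apply/funext => k; rewrite mul1r.
rewrite E in h; have [[_ hr] [_ hi]] := h; have [[_ kr] [_ ki]] := isCd_cst (cI f) 0.
rewrite (_ : cI (lie_derive A f) = cI (fun k => 1 * lie_derive A f (SU2_mul k (SU2_one R)))).
  by apply: complexP; rewrite -?hr -?hi ?kr ?ki.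
by congr (cI _); apply/funext => k; rewrite mul1r SU2_mul1.
Qed.

(** Left convolution, which commutes with left-invariant vector fields. *)
Definition mollify (q : G -> R) (f : G -> C) : G -> C :=
  fun g => cI (fun k => (q k)%:C * f (SU2_mul k g)).

Lemma mollify_lie d q f s : bump mu d q -> is_smooth f ->
  iter_lie s (mollify q f) = mollify q (iter_lie s f).
Proof.
move=> bq sf; have qc := bump_contC bq; elim: s => //= A s ->.
apply/funext => g; apply: lie_derive_val.
apply: isCd_integral => //; [exact: smooth_contC|exact: smooth_diff|].
exact: (smooth_contC (A :: s)).
Qed.

Lemma mollify_pol d q f : bump mu d q -> contC f -> pol (mollify q f).
Proof.
move=> bq fc; have [pq _ _ _ qV] := bq; have qc := bump_contC bq.
have := pol_average mu (@continuous_cstG R (SU2_one R)) (@continuous_invG R) pq fc.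
rewrite (_ : (fun g : G => _) = mollify q f) //; apply/funext => g.
rewrite /mollify.
have h : contC (fun k => (q k)%:C * f (SU2_mul k g)).
  by apply: contCM => //; apply: contC_comp => //; exact: continuous_mulr.
rewrite -(haar_right haar (SU2_inv g) h); congr (cI _); apply/funext => k.
rewrite -SU2_mulA SU2_Vmul SU2_mul1 SU2_1mul; congr (_%:C * _).
by rewrite -qV SU2_invM SU2_invK.
Qed.

Lemma bump_sub (d e : R) q : d <= e -> bump mu d q -> bump mu e q.
Proof. by move=> de [a b c h k]; split=> //; exact: le_trans de. Qed.

Lemma mollify_approx f (e : R) : contC f -> 0 < e -> exists2 d : R, 0 < d &
  forall q, bump mu d q -> forall g, nm (mollify q f g - f g) <= e.
Proof.
move=> fc e0; have [c1 [c2 c3]] := contC_pair fc.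
have [||d d0 Hd] := bump_approx mu (a := fun x => f (SU2_mul x.1 x.2) - f x.2) _ _ e0.
- exact: contC_sub.
- by move=> g; rewrite /= SU2_1mul subrr.
exists d => // q bq g; apply: le_trans (Hd _ bq g).
have [pq _ q1 _ qV] := bq; have qc := bump_contC bq.
rewrite /mollify /= (_ : _ - f g = cI (fun k => (q k)%:C * (f (SU2_mul k g) - f g))) //.
have -> : (fun k => (q k)%:C * (f (SU2_mul k g) - f g)) =
    (fun k => (q k)%:C * f (SU2_mul k g) - f g * (q k)%:C).
  by apply/funext => k; ring.
have h : contC (fun k => (q k)%:C * f (SU2_mul k g)).
  by apply: contCM => //; apply: contC_comp => //; exact: continuous_mulr.
have iq : ci (fun k => (q k)%:C) by exact: contC_ci.
rewrite cI_sub ?cI_scale //; try by [exact: contC_ci|exact: ci_scale].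
have -> : cI (fun k => (q k)%:C) = 1.
  by rewrite cIE /= q1; congr (_ +i* _); exact: RI_cst.
by rewrite mulr1.
Qed.

(** Convolution with bumps gives polynomial approximations that commute with the
    derivations, hence converge together with all derivatives. *)
Lemma mollifiers : exists Q : nat -> (G -> C) -> G -> C,
  [/\ forall n f, contC f -> pol (Q n f),
      forall n s f, is_smooth f -> iter_lie s (Q n f) = Q n (iter_lie s f),
      forall n c f h, contC f -> contC h ->
        Q n (fun g => c * f g + h g) = fun g => c * Q n f g + Q n h g &
      forall f (e : R), contC f -> 0 < e -> exists N, forall n, (N <= n)%N ->
        forall g, nm (Q n f g - f g) <= e].
Proof.
have ex n : exists q, bump mu (n.+1%:R^-1) q by apply: bump_exists.
have [q Hq] := choice ex; exists (fun n => mollify (q n)); split.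
- by move=> n f fc; exact: mollify_pol (Hq n) fc.
- by move=> n s f sf; exact: mollify_lie (Hq n) sf.
- move=> n c f h fc hc; apply/funext => g.
  have i (k : G -> C) : contC k -> ci (fun x => (q n x)%:C * k (SU2_mul x g)).
    move=> kc; apply: contC_ci; apply: contCM; first exact: bump_contC (Hq n).
    by apply: contC_comp => //; exact: continuous_mulr.
  rewrite /mollify -cI_scale -?cI_add; try by [exact: i|apply: ci_scale; exact: i].
  by congr (cI _); apply/funext => k; ring.
move=> f e fc e0; have [d d0 Hd] := mollify_approx fc e0.
exists (Num.truncn d^-1) => n Nn g; apply: (Hd (q n)).
apply: bump_sub (Hq n); rewrite invf_ple ?posrE //; apply: ltW.
apply: lt_le_trans (truncnS_gt _) _; rewrite ler_nat ltnS; exact: Nn.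
Qed.

End differentiation_under_integral.

(** * The hypoelliptic estimate in the maximum norm *)

Lemma scaled_ge0 (R : realType) (n : nat) (s K : R) : 0 <= s -> 0 <= K ->
  0 <= (2 + (2 + n%:R * s)) * K.
Proof.
by move=> s0 K0; have := mulr_ge0 (ler0n R n) s0 => h; apply: mulr_ge0 => //; lra.
Qed.

Section estimate.
Variable R : realType.
Local Notation C := R[i].
Local Notation G := (SU2 R).
Local Notation D := (@dl R).
Variable mu : probability G R.
Hypothesis haar : is_haar mu.
Local Notation cI := (cI mu).
Variables X Y Z : su2 R.
Hypothesis XYZ : su2_frame X Y Z.
Local Notation Lap := (Lap X Y Z).

Lemma int_D0 A f : pol f -> cI (D A f) = 0.
Proof.
move=> pf; rewrite dlE; apply: int_lie0 => //; [exact: pol_contC|exact: pol_diff|].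
by rewrite -dlE; apply: pol_contC; exact: pol_lie.
Qed.

Lemma pol_ci f : pol f -> ci mu f. Proof. by move=> /pol_contC/contC_ci; apply. Qed.

Lemma int_Lap0 f : pol f -> cI (Lap f) = 0.
Proof.
move=> pf; have pD A : pol (D A (D A f)) by apply: pol_lie; exact: pol_lie.
have h A : cI (D A (D A f)) = 0 by apply: int_D0; exact: pol_lie.
have -> : Lap f = fun g => (-1) * (D X (D X f) g + D Y (D Y f) g + D Z (D Z f) g).
  by apply/funext => g; rewrite /Lap; ring.
have i1 : ci mu (fun g => D X (D X f) g + D Y (D Y f) g) by apply: pol_ci; exact: polD.
rewrite cI_scale; last by apply: pol_ci; apply: polD => //; exact: polD.
by rewrite cI_add ?cI_add ?h ?addr0 ?mulr0 //; exact: pol_ci.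
Qed.

Lemma eig_mean0 (l : R) f : eigL X Y Z l f -> l != 0 -> cI f = 0.
Proof.
move=> [pf E] l0; have := int_Lap0 pf; rewrite E cI_scale; last exact: pol_ci.
move/eqP; rewrite mulf_eq0 => /orP[/eqP h|/eqP //].
by move: l0; rewrite (_ : l = 0) ?eqxx //; move/(congr1 (@complex.Re _)): h.
Qed.

Lemma root_sqr k (x : R) : root k.+1 x ^+ 2 = root k x.
Proof.
rewrite /root -powR_mulrn ?powR_ge0 // -powRrM; congr (_ `^ _).
by rewrite exprSr invfM -mulrA mulVf ?mulr1.
Qed.

Lemma root0 (x : R) : 0 <= x -> root 0 x = 1 + x.
Proof. by move=> x0; rewrite /root expr0 invr1 powRr1 // addr_ge0. Qed.

Variable ka : R.

Section family.
Variables (I : finType) (l m : I -> R) (F : I -> G -> C).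
Hypothesis EF : jointfam X Y Z l m F.
Hypothesis l_neq0 : forall i, l i != 0.
Local Notation flow := (flow ka l m F).
Local Notation sym := (sym ka).

Lemma lc_mean0 c : cI (lc c F) = 0.
Proof.
have pF i : pol (F i) := eigfam_pol EF.1 i.
rewrite /lc (ci_sum _).2 => [|i]; last by apply: ci_scale; exact: pol_ci.
rewrite big1 // => i _; rewrite cI_scale; last exact: pol_ci.
by rewrite (eig_mean0 (EF.1 i).1) ?mulr0.
Qed.

(** For f of mean zero, f g is the mean of f g - f h over h. *)
Lemma mean0_osc f (B : R) : pol f -> cI f = 0 ->
  (forall g h, nm (f g - f h) <= B) -> forall g, nm (f g) <= B.
Proof.
move=> pf f0 H g.
have -> : f g = cI (fun h => f g - f h).
  rewrite cI_sub ?cI_cst ?f0 ?subr0 //; last exact: pol_ci.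
  by apply: contC_ci; exact: contC_cst.
by apply: cI_bound_cst => // ; apply: pol_ci; apply: polB => //; exact: pol_cst.
Qed.

(** At this time the gradient bounds reduce all first derivatives to 1 / (12 pi) of
    the norm of the initial function, and [osc_bound] turns this into 1/2. *)
Definition poincare_time : R := 3 * (12 * pi) ^+ 2.

(** After a fixed time the flow halves the norm of functions of mean zero, by
    the gradient bounds; and it moves p by at most that time times T p. *)
Lemma poincare c (K : R) : (forall g, nm (lc (fun i => sym (l i) (m i) * c i) F g) <= K) ->
  forall g, nm (lc c F g) <= 2 * poincare_time * K.
Proof.
move=> HK g; have pi0 := pi_gt0 R.
have K0 : 0 <= K by apply: le_trans (HK g); exact: nm_ge0.
have pc := lc_pol EF.1 c.
have [g0 Hg0] := SU2_max (contC_nm (pol_contC pc)).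
set B := nm (lc c F g0) in Hg0.
have B0 : 0 <= B by exact: nm_ge0.
pose e : R := (12 * pi)^-1; pose t : R := poincare_time.
have e0 : 0 < e by rewrite invr_gt0 mulr_gt0.
have tE : 3 / t = e ^+ 2 by rewrite /t /poincare_time invfM mulrA divff ?mul1r ?exprVn.
have t0 : 0 < t by rewrite /t /poincare_time mulr_gt0 // exprn_gt0 // mulr_gt0.
have e1 : e <= 1.
  rewrite invf_le1 ?mulr_gt0 //; have := pi_ge2 R => h; lra.
have grad h A : A = X \/ A = Y \/ A = Z -> nm (D A (flow c t) h) <= e * B.
  have XY : A = X \/ A = Y -> nm (D A (flow c t) h) <= e * B.
    move=> hA; have := flow_XY_le XYZ ka EF Hg0 h t0 hA.
    rewrite mulrAC tE -exprMn => hh.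
    by rewrite -(ler_pXn2r (n := 2)) ?nnegrE ?nm_ge0 ?mulr_ge0 // ltW.
  case=> [hA|[hA|->]]; [by apply: XY; left|by apply: XY; right|].
  have := flow_Z_le XYZ ka EF Hg0 h t0; rewrite mulrAC tE => hh.
  apply: le_trans hh _; rewrite ler_wpM2r // expr2 ger_pMl //.
have half h : nm (flow c t h) <= B / 2.
  apply: mean0_osc; [exact: flow_pol EF c t|exact: lc_mean0|].
  move=> x y; have := osc_bound XYZ (flow_pol ka EF c t) (fun g A hA => grad g A hA) x y.
  have e12 : 12 * pi * e = 1 by rewrite mulfV // gt_eqF // mulr_gt0.
  have eB : 6 * pi * (e * B) = B / 2.
    have -> : 6 * pi * (e * B) = 12 * pi * e * B / 2.
      by move: (pi : R) (e) (B : R) => a b d; field.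
    by rewrite e12 mul1r.
  by rewrite eB.
have := flow_diff_le XYZ EF HK (s := 0) (t := t) g0; rewrite lexx (ltW t0) flow0 subr0 => /(_ isT) hd.
have h1 : B <= K * t + B / 2.
  rewrite {1}/B -[X in nm X](subKr (flow c t g0) (lc c F g0)).
  by rewrite (le_trans (nmB _ _)) // addrC lerD.
by apply: le_trans (Hg0 g) _; rewrite -/t; lra.
Qed.

(** In [smoothing], 37 collects one copy of the function and 36 = 3 * 3 * 2 * 2 from
    two derivatives along Z, each over half of the time. *)
Definition smooth_const : R := 37 * (2 * poincare_time) + 3 * `|ka| * (2 * poincare_time) + 1.

Lemma cexpD z (s t : R) : cexp z (s + t) = cexp z s * cexp z t.
Proof.
by rewrite /cexp !mulrDl expRD cosD sinD; apply: complexP;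
  rewrite ?Re_mul ?Im_mul /= /GRing.scale /=; ring.
Qed.

(** Since L = - X^2 - Y^2 - Z^2, one has 1 + L = 1 + T - Z^2 - ka Z with
    T = - X^2 - Y^2 + ka Z; each derivative along Z costs a factor 1 / t. *)
Lemma smoothing c (K : R) : (forall g, nm (lc (fun i => sym (l i) (m i) * c i) F g) <= K) ->
  forall (t : R) g, 0 < t <= 1 ->
  nm (lc (fun i => (1 + l i)%:C * (cexp (- sym (l i) (m i)) t * c i)) F g) <=
    smooth_const * K / t ^+ 2.
Proof.
move=> HK t g /andP[t0 t1]; have HB := poincare HK; set B := _ * K in HB.
have K0 : 0 <= K by apply: le_trans (HK g); exact: nm_ge0.
have B0 : 0 <= B by apply: le_trans (HB g); exact: nm_ge0.
have t0' := ltW t0; have t2 : 0 < t / 2 by rewrite divr_gt0.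
pose z i : C := 0 +i* m i.
have DZ d s : D Z (flow d s) = flow (fun i => z i * d i) s.
  rewrite (D_lc EF.1); apply/funext => h; apply: eq_bigr => i _.
  by rewrite EF.2 /z; move: (cexp _ _) (0 +i* m i) => x y; ring.
have b1 := flow_le XYZ ka EF HB g t0'.
have b2 := flow_le XYZ ka EF HK g t0'.
have b3 h (s : R) : 0 < s -> nm (flow (fun i => z i * c i) s h) <= 3 * B / s.
  by move=> s0; rewrite -DZ; exact: (flow_Z_le XYZ ka EF HB h s0).
have b4 : nm (flow (fun i => z i * (z i * c i)) t g) <= 3 * (3 * B / (t / 2)) / (t / 2).
  pose d i := cexp (- sym (l i) (m i)) (t / 2) * (z i * c i).
  have -> : flow (fun i => z i * (z i * c i)) t = D Z (flow d (t / 2)).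
    rewrite DZ; apply/funext => h; apply: lc_eq => i; rewrite {1}(_ : t = t / 2 + t / 2); last by field.
    by rewrite cexpD /d; ring.
  by apply: (flow_Z_le XYZ ka EF) => // h; exact: b3.
have E : lc (fun i => (1 + l i)%:C * (cexp (- sym (l i) (m i)) t * c i)) F g =
    flow c t g + flow (fun i => sym (l i) (m i) * c i) t g
    + (-1) * flow (fun i => z i * (z i * c i)) t g
    + (- ka%:C) * flow (fun i => z i * c i) t g.
  rewrite -!lc_scale -!lc_add; apply: lc_eq => i.
  have -> : (1 + l i)%:C = 1 + sym (l i) (m i) - z i * z i - ka%:C * z i.
    by apply: complexP; rewrite /z /sym /=; ring.
  by ring.
rewrite E; apply: (le_trans (nmD _ _)); rewrite nmM nmN nm_real.
apply: (@le_trans _ _ (B + K + 36 * B / t ^+ 2 + `|ka| * (3 * B / t))).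
  apply: lerD; last by rewrite ler_wpM2l // b3.
  apply: (le_trans (nmD _ _)); apply: lerD.
    by apply: (le_trans (nmD _ _)); exact: lerD.
  rewrite nmM nmN (_ : 1 = 1%:C) // nm_real normr1 mul1r.
  by apply: le_trans b4 _; rewrite le_eqVlt; apply/orP; left; apply/eqP; field; rewrite gt_eqF.
have s1 : 1 <= t ^- 2 by rewrite -[1]invr1 lef_pV2 ?posrE ?exprn_gt0 // expr_le1.
have s2 : t^-1 <= t ^- 2 by rewrite lef_pV2 ?posrE ?exprn_gt0 // expr2 ler_piMl.
have k0 := normr_ge0 ka.
have h1 : B <= B * t ^- 2 by rewrite ler_peMr.
have h2 : K <= K * t ^- 2 by rewrite ler_peMr.
have h3 : `|ka| * (3 * B / t) <= `|ka| * (3 * B * t ^- 2) by rewrite ler_wpM2l // ler_wpM2l // mulr_ge0.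
rewrite /smooth_const.
have -> : (37 * (2 * poincare_time) + 3 * `|ka| * (2 * poincare_time) + 1) * K / t ^+ 2 =
    B * t ^- 2 + K * t ^- 2 + 36 * B / t ^+ 2 + `|ka| * (3 * B * t ^- 2) by rewrite /B; ring.
by lra.
Qed.

Lemma lc_sub (c d : I -> C) g : lc c F g - lc d F g = lc (fun i => c i - d i) F g.
Proof. by rewrite -mulN1r -lc_scale -lc_add; apply: lc_eq => i; ring. Qed.

(** Interpolation from W = 1 + L to W^(1/2) with parameter s1, and from W^(1/2) to
    W^(1/4) with parameter s2. *)
Lemma two_step c (s1 s2 B0 B2 : R) : 0 < s1 -> 0 < s2 ->
  (forall g, nm (lc c F g) <= B0) ->
  (forall g, nm (lc (fun i => (1 + l i)%:C * c i) F g) <= B2) ->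
  forall g, nm (lc (fun i => (root 2 (l i))%:C * c i) F g) <=
    2 * s2 * B0 + (2 * s1 * B0 + B2 / s1) / s2.
Proof.
move=> p1 p2 H0 H2.
have ge1 k (x : R) : 0 <= x -> 1 <= root k x by exact: root_ge1.
have st := landau_kolmogorov (@accretive_root R X Y Z 1) (ge1 1%N) EF.1 p1 H0.
have H1 : forall g, nm (lc (fun i => (root 1 (l i))%:C * c i) F g) <= 2 * s1 * B0 + B2 / s1.
  apply: st => g; move: (H2 g); congr (nm _ <= _); apply: lc_eq => i.
  by rewrite root_sqr root0 // (EF.1 i).2.
apply: (landau_kolmogorov (@accretive_root R X Y Z 2) (ge1 2%N) EF.1 p2 H0) => g.
by move: (H1 g); congr (nm _ <= _); apply: lc_eq => i; rewrite root_sqr.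
Qed.

(** 257 = 256 + 1 comes from two consecutive dyadic times; the last bracket is the
    contribution of the flow at time 1. *)
Definition quarter_const : R :=
  2 * (2 + (2 + 257 * smooth_const)) + (4 * (2 * poincare_time) + 2 * (2 * poincare_time) + smooth_const).

(** Let q_j be the flow at the time 16^-j. The norm of q_(j+1) - q_j is of the order
    of 16^-j and becomes 256^j when W = 1 + L is applied, so that by interpolation
    it is 2^-j for W^(1/4). The sum of these increments bounds the limit of W^(1/4) q_j. *)
Lemma quarter_bound c (K : R) : (forall g, nm (lc (fun i => sym (l i) (m i) * c i) F g) <= K) ->
  forall g, nm (lc (fun i => (root 2 (l i))%:C * c i) F g) <= quarter_const * K.
Proof.
move=> HK g; have HB := poincare HK; have HS := smoothing HK.
have K0 : 0 <= K by apply: le_trans (HK g); exact: nm_ge0.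
pose t j : R := 16 ^- j.
have t0 j : 0 < t j by rewrite invr_gt0 exprn_gt0.
have t1 j : t j <= 1 by rewrite invf_le1 ?exprn_gt0 // exprn_ege1 // ler1n.
have pt0 : 0 <= poincare_time by rewrite /poincare_time mulr_ge0 // sqr_ge0.
have S0 : 0 <= smooth_const.
  by rewrite /smooth_const; have := mulr_ge0 (normr_ge0 ka) pt0; lra.
pose e i j := cexp (- sym (l i) (m i)) (t j).
pose w j h := lc (fun i => (root 2 (l i))%:C * (e i j * c i)) F h.
have base h : nm (w 0%N h) <= (4 * (2 * poincare_time) + 2 * (2 * poincare_time) + smooth_const) * K.
  have h0 x : nm (lc (fun i => e i 0%N * c i) F x) <= 2 * poincare_time * K.
    exact: (flow_le XYZ ka EF HB x (ltW (t0 0%N))).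
  have h1 x : nm (lc (fun i => (1 + l i)%:C * (e i 0%N * c i)) F x) <= smooth_const * K.
    have := HS (t 0%N) x; rewrite t0 t1 => /(_ isT).
    by rewrite {2}/t expr0 invr1 expr1n divr1.
  apply: le_trans (two_step ltr01 ltr01 h0 h1 h) _.
  by have := mulr_ge0 pt0 K0; rewrite !mulr1 !divr1; lra.
have diff j h : nm (w j.+1 h - w j h) <= (2 + (2 + 257 * smooth_const)) * K * 2 ^- j.
  have -> : w j.+1 h - w j h =
      lc (fun i => (root 2 (l i))%:C * ((e i j.+1 - e i j) * c i)) F h.
    by rewrite /w lc_sub; apply: lc_eq => i; ring.
  have b0 x : nm (lc (fun i => (e i j.+1 - e i j) * c i) F x) <= K * t j.
    have -> : lc (fun i => (e i j.+1 - e i j) * c i) F x = - (flow c (t j) x - flow c (t j.+1) x).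
      by rewrite lc_sub -mulN1r -lc_scale; apply: lc_eq => i; rewrite /e; ring.
    rewrite nmN; have tt : t j.+1 <= t j.
      by rewrite /t lef_pV2 ?posrE ?exprn_gt0 // exprS ler_peMl // ?exprn_ge0 // ler1n.
    have := flow_diff_le XYZ EF HK (s := t j.+1) (t := t j) x; rewrite tt ltW // => /(_ isT) hd.
    by apply: le_trans hd _; rewrite ler_wpM2l // gerBl ltW.
  have b2 x : nm (lc (fun i => (1 + l i)%:C * ((e i j.+1 - e i j) * c i)) F x) <=
      257 * smooth_const * K * 256 ^+ j.
    have -> : lc (fun i => (1 + l i)%:C * ((e i j.+1 - e i j) * c i)) F x =
        lc (fun i => (1 + l i)%:C * (e i j.+1 * c i)) F x +
        (-1) * lc (fun i => (1 + l i)%:C * (e i j * c i)) F x.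
      by rewrite -lc_scale -lc_add; apply: lc_eq => i; ring.
    have h1 := HS (t j.+1) x; have h2 := HS (t j) x; rewrite !t0 !t1 in h1 h2.
    have E k : (t k ^+ 2)^-1 = 256 ^+ k by rewrite /t exprVn invrK -exprM mulnC exprM; congr (_ ^+ _); rewrite -natrX.
    rewrite !E in h1 h2; apply: (le_trans (nmD _ _)).
    rewrite nmM nmN (_ : 1 = 1%:C) // nm_real normr1 mul1r.
    have := h1 isT; have := h2 isT; rewrite exprS => {}h1 {}h2.
    apply: le_trans (lerD h2 h1) _; rewrite le_eqVlt; apply/orP; left; apply/eqP; ring.
  have p64 : (0 : R) < 64 ^+ j by rewrite exprn_gt0.
  have p8 : (0 : R) < 8 ^+ j by rewrite exprn_gt0.
  (* This choice balances the terms: with y = 2 ^ j, each of y^3 / y^4,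
     (y^6 / y^4) / y^3 and (y^8 / y^6) / y^3 is 1 / y. *)
  apply: le_trans (two_step p64 p8 b0 b2 h) _; rewrite /t.
  have p2 : (0 : R) < 2 ^+ j by rewrite exprn_gt0.
  have e8 : (8 : R) ^+ j = (2 ^+ j) ^+ 3 by rewrite -exprM mulnC exprM; congr (_ ^+ _); rewrite -natrX.
  have e64 : (64 : R) ^+ j = (2 ^+ j) ^+ 6 by rewrite -exprM mulnC exprM; congr (_ ^+ _); rewrite -natrX.
  have e16 : (16 : R) ^+ j = (2 ^+ j) ^+ 4 by rewrite -exprM mulnC exprM; congr (_ ^+ _); rewrite -natrX.
  have e256 : (256 : R) ^+ j = (2 ^+ j) ^+ 8 by rewrite -exprM mulnC exprM; congr (_ ^+ _); rewrite -natrX.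
  rewrite e8 e64 e16 e256; move: (2 ^+ j) p2 => y y0.
  by rewrite le_eqVlt; apply/orP; left; apply/eqP; field; rewrite gt_eqF.
pose Q : R := (2 + (2 + 257 * smooth_const)) * K.
have Q0 : 0 <= Q by exact: scaled_ge0.
pose B1 : R := (4 * (2 * poincare_time) + 2 * (2 * poincare_time) + smooth_const) * K.
have part j h : nm (w j h) <= B1 + Q * (2 - 2 * 2 ^- j).
  elim: j => [|j IH]; first by rewrite expr0 invr1 mulr1 subrr mulr0 addr0; exact: base.
  rewrite -[w j.+1 h](subrK (w j h)) (le_trans (nmD _ _)) //.
  apply: le_trans (lerD (diff j h) IH) _; rewrite -/Q exprS invfM.
  by rewrite le_eqVlt; apply/orP; left; apply/eqP; field.
have lim j h : nm (w j h) <= quarter_const * K.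
  have qE : quarter_const * K = B1 + Q * 2 by rewrite /quarter_const /B1 /Q; ring.
  apply: le_trans (part j h) _; rewrite qE lerD2l ler_wpM2l //.
  have : (0 : R) <= 2 ^- j by rewrite invr_ge0 exprn_ge0.
  by move: (2 ^- j) => y; lra.
pose c' i := (root 2 (l i))%:C * c i.
have [K' [K'0 HK']] := SU2_bounded (pol_contC (lc_pol EF.1 (fun i => sym (l i) (m i) * c' i))).
apply/ler_addgt0Pr => d d0.
have [j jd] : exists j : nat, K' * t j <= d.
  exists (Num.truncn (K' / d)); rewrite /t ler_pdivrMr ?exprn_gt0 //.
  rewrite mulrC -ler_pdivrMr //; apply/ltW; apply: lt_le_trans (truncnS_gt _) _.
  by rewrite -natrX ler_nat; exact: ltn_expl.
have := flow_diff_le XYZ EF HK' (s := 0) (t := t j) g; rewrite lexx ltW // => /(_ isT).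
rewrite flow0 subr0 => hd.
have wE : w j g = flow c' (t j) g by apply: lc_eq => i; rewrite /e /c'; ring.
have -> : lc (fun i => (root 2 (l i))%:C * c i) F g =
    w j g - (flow c' (t j) g - lc c' F g) by rewrite wE /c'; ring.
apply: (le_trans (nmB _ _)); apply: lerD; first exact: lim.
exact: le_trans hd jd.
Qed.

(** Accretivity of W^(1/8) bounds W^(1/8) p by W^(1/8) W^(1/8) p. *)
Lemma eighth_bound c (K : R) : (forall g, nm (lc (fun i => sym (l i) (m i) * c i) F g) <= K) ->
  forall g, nm (lc (fun i => ((1 + l i) `^ (8^-1))%:C * c i) F g) <= quarter_const * K.
Proof.
move=> /quarter_bound HQ.
have r3 (x : R) : (1 + x) `^ (8^-1) = root 3 x by rewrite /root; congr (_ `^ _); rewrite -natrX.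
have -> : (fun i => ((1 + l i) `^ (8^-1))%:C * c i) = (fun i => (root 3 (l i))%:C * c i).
  by apply/funext => i; rewrite r3.
apply: (accretive_le (@accretive_root R X Y Z 3) EF.1) => g.
move: (HQ g); congr (nm _ <= _); apply: lc_eq => i.
by rewrite mulrA -rmorphM -expr2 root_sqr.
Qed.

End family.
End estimate.

(** * Bessel potentials of distributions *)

Section bessel_potential.
Variable R : realType.
Local Notation C := R[i].
Local Notation G := (SU2 R).
Local Notation D := (@dl R).
Variables X Y Z : su2 R.
Hypothesis XYZ : su2_frame X Y Z.
Local Notation Lap := (Lap X Y Z).
Local Notation eigfam := (eigfam X Y Z).

(** The relation q = (1 + L)^(-a) p; by [bessel_rel_uniq] it does not depend on
    the decomposition of p. *)
Definition bessel_rel (a : R) (p q : G -> C) : Prop :=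
  exists (I : finType) (l : I -> R) (F : I -> G -> C), eigfam l F /\
    p = lc (fun=> 1) F /\ q = lc (fun i => ((1 + l i) `^ (- a))%:C) F.

Lemma bessel_rel_pol a p q : bessel_rel a p q -> pol p /\ pol q.
Proof. by move=> [I [l [F [EF [-> ->]]]]]; split; exact: lc_pol EF _. Qed.

Lemma bessel_rel_exists a p : pol p -> exists q, bessel_rel a p q.
Proof.
move=> /(pol_decomposition XYZ)[I [l [m [F [H E]]]]].
exists (lc (fun i => ((1 + l i) `^ (- a))%:C) F), I, l, F; split.
  by move=> i; have [h1 _ h2 _] := H i.
by split=> //; rewrite E; apply/funext => g; apply: eq_bigr => i _; rewrite mul1r.
Qed.

Lemma bessel_rel_linear a c p q p' q' : bessel_rel a p q -> bessel_rel a p' q' ->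
  bessel_rel a (fun g => c * p g + p' g) (fun g => c * q g + q' g).
Proof.
move=> [I [l [F [EF [-> ->]]]]] [J [l' [F' [EF' [-> ->]]]]].
exists [the finType of (I + J)%type], (fun s => match s with inl i => l i | inr j => l' j end),
  (fun s => match s with inl i => fun g => c * F i g | inr j => F' j end); split.
  by case=> [i|j]; [exact: (eigfam_scale EF (fun=> c) i)|exact: EF'].
by split; apply/funext => g; rewrite /lc big_sumType /= mulr_sumr; congr (_ + _);
  apply: eq_bigr => i _; ring.
Qed.

Lemma bessel_rel_lie a A p q : bessel_rel a p q -> bessel_rel a (D A p) (D A q).
Proof.
move=> [I [l [F [EF [-> ->]]]]]; exists I, l, (fun i => D A (F i)); split.
  exact: (eigfam_D XYZ).
by rewrite !(D_lc EF).
Qed.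

Lemma bessel_rel_iter_lie a s p q : bessel_rel a p q ->
  bessel_rel a (iter_lie s p) (iter_lie s q).
Proof. by move=> h; elim: s => //= A s; rewrite -dlE; exact: bessel_rel_lie. Qed.

Lemma bessel_rel_le a p q (B : R) : 0 <= a -> bessel_rel a p q ->
  (forall g, nm (p g) <= B) -> forall g, nm (q g) <= B.
Proof.
move=> a0 [I [l [F [EF [-> ->]]]]] H g; have := bessel_contraction EF a0 H g.
by congr (nm _ <= _); apply: lc_eq => i; rewrite mulr1.
Qed.

Lemma bessel_rel_uniq a p q q' : 0 <= a -> bessel_rel a p q -> bessel_rel a p q' -> q = q'.
Proof.
move=> a0 h h'; apply/funext => g; apply/esym/eqP; rewrite -subr_eq0; apply/eqP/nm_eq0.
apply/eqP; rewrite eq_le nm_ge0 andbT.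
have := bessel_rel_le a0 (bessel_rel_linear (-1) h h') (B := 0) _ g.
by rewrite mulN1r addrC; apply => x; rewrite mulN1r addNr nm0.
Qed.

Lemma bessel_rel_eig a l p : eigL X Y Z l p -> 0 <= l ->
  bessel_rel a p (fun g => ((1 + l) `^ (- a))%:C * p g).
Proof.
move=> ep l0; exists unit, (fun=> l), (fun=> p); split=> //.
by split; apply/funext => g; rewrite /lc big_const card_unit /= addr0 ?mul1r.
Qed.

(** The maximum principle [dot_Lap_ge0] excludes negative eigenvalues. *)
Lemma eig_neg0 (l : R) p : eigL X Y Z l p -> l < 0 -> p = fun=> 0.
Proof.
move=> [pp E] l0; have [g0 Hg0] := SU2_max (contC_nm (pol_contC pp)).
have := dot_Lap_ge0 X Y Z pp Hg0; rewrite E dotZr dotxx => h.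
have p0 : nm (p g0) = 0.
  apply/eqP; rewrite -sqrf_eq0 eq_le sqr_ge0 andbT.
  by rewrite -(nmulr_rge0 _ l0).
by apply/funext => g; apply: nm_eq0; apply/eqP; rewrite eq_le nm_ge0 andbT -p0; exact: Hg0.
Qed.

(** Zero unless f is smooth; it lets a distribution be applied to an expression. *)
Definition mksm (f : G -> C) : SU2_smooth R := insubd 0 f.

Lemma mksmE f : is_smooth f -> mksm f = f :> (G -> C).
Proof. by move=> sf; rewrite /mksm insubdK //; apply/asboolP. Qed.

Lemma mksm_val (f : SU2_smooth R) : mksm f = f.
Proof. by apply: val_inj; exact: mksmE (smoothP f). Qed.

Lemma smooth_lin c f h : is_smooth f -> is_smooth h ->
  is_smooth (fun g => c * f g + h g) /\
  mksm (fun g => c * f g + h g) = c *: mksm f + mksm h.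
Proof.
move=> sf sh.
have E : (fun g => c * f g + h g) = c *: (mksm f : G -> C) + (mksm h : G -> C).
  exact: (f_equal2 (fun a b : G -> C => c *: a + b) (esym (mksmE sf)) (esym (mksmE sh))).
have sE : is_smooth (fun g => c * f g + h g).
  rewrite E; exact: (smoothP (c *: mksm f + mksm h)).
by split=> //; apply: val_inj; rewrite [LHS](mksmE sE) E.
Qed.

(** Continuity of a functional, with real bounds in place of suprema. *)
Lemma distribution_bound (u : SU2_smooth R -> C) : is_distribution u ->
  exists (S : seq (seq (su2 R))) (K : R), 0 <= K /\
  forall (f : SU2_smooth R) (M : seq (su2 R) -> R),
    (forall s g, nm (iter_lie s f g) <= M s) -> nm (u f) <= K * \sum_(s <- S) M s.
Proof.
move=> [_ [S [K [K0 H]]]]; exists S, K; split=> // f M HM.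
rewrite -lee_fin; apply: le_trans (H f) _; rewrite EFinM lee_wpmul2l ?lee_fin //.
rewrite -sumEFin; apply: lee_sum => s _.
by apply: ge_ereal_sup => _ [g _ <-]; rewrite lee_fin.
Qed.

Lemma distribution_intro (u : SU2_smooth R -> C) (S : seq (seq (su2 R))) (K : R) :
  scalar u -> 0 <= K ->
  (forall (f : SU2_smooth R) (M : seq (su2 R) -> R),
    (forall s g, nm (iter_lie s f g) <= M s) -> nm (u f) <= K * \sum_(s <- S) M s) ->
  is_distribution u.
Proof.
move=> lu K0 H; split=> //; exists S, K; split=> // f.
have fin s : smooth_seminorm s f \is a fin_num.
  have [B [B0 HB]] := SU2_bounded (smooth_contC s (smoothP f)).
  rewrite ge0_fin_numE; last exact: smooth_seminorm_ge0.
  apply: (@le_lt_trans _ _ B%:E); last exact: ltry.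
  by apply: ge_ereal_sup => _ [g _ <-]; rewrite lee_fin.
rewrite (eq_bigr (fun s => (fine (smooth_seminorm s f))%:E)) => [|s _]; last by rewrite fineK.
rewrite sumEFin -EFinM lee_fin; apply: H => s g.
by rewrite -lee_fin fineK //; apply: ereal_sup_ubound; exists g.
Qed.

(** A complex sequence with |z_n - z_m| <= e_n + e_m, where e_n tends to 0,
    converges, and e_n bounds the distance to the limit. *)
Lemma cauchy_limit (z : nat -> C) (e : nat -> R) :
  (forall d : R, 0 < d -> exists N, forall n, (N <= n)%N -> e n <= d) ->
  (forall n m, nm (z n - z m) <= e n + e m) ->
  exists w, forall n, nm (z n - w) <= e n.
Proof.
move=> e_to0 Hz.
have real (x : nat -> R) : (forall n m, `|x n - x m| <= e n + e m) ->
    exists y : R, x @ \oo --> y.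
  move=> Hx; apply/cvg_ex/cauchy_cvgP; apply: cauchy_exP => d /= d0.
  have [N HN] := e_to0 (d / 4) ltac:(lra).
  exists (x N); exists N => // n /= Nn; rewrite /ball /=.
  have := Hx N n; have := HN n Nn; have := HN N (leqnn N).
  by move: `|_| (e n) (e N) => *; lra.
have ReB (a b : C) : complex.Re (a - b) = complex.Re a - complex.Re b.
  by case: a b => ? ? [].
have ImB (a b : C) : complex.Im (a - b) = complex.Im a - complex.Im b.
  by case: a b => ? ? [].
have [x xl] : exists x : R, (fun n => complex.Re (z n)) @ \oo --> x.
  apply: real => n m; rewrite -ReB; apply: le_trans (ler_Re_nm _) (Hz n m).
have [y yl] : exists y : R, (fun n => complex.Im (z n)) @ \oo --> y.
  apply: real => n m; rewrite -ImB; apply: le_trans (ler_Im_nm _) (Hz n m).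
exists (x +i* y) => n; apply/ler_addgt0Pr => d d0.
have d4 : 0 < d / 3 by lra.
have [N1 _ H1] := (cvgrPdist_lt _ _).1 xl _ d4.
have [N2 _ H2] := (cvgrPdist_lt _ _).1 yl _ d4.
have [N3 H3] := e_to0 _ d4.
pose m := maxn N1 (maxn N2 N3).
have m1 : (N1 <= m)%N by exact: leq_maxl.
have m2 : (N2 <= m)%N by rewrite /m maxnCA leq_maxl.
have m3 : (N3 <= m)%N by rewrite /m maxnA leq_maxr.
have := H1 m m1; have := H2 m m2; have := H3 m m3 => /= h3 h2 h1.
have hw : nm (z m - (x +i* y)) <= `|x - complex.Re (z m)| + `|y - complex.Im (z m)|.
  by apply: le_trans (ler_nm_ReIm _) _; rewrite ReB ImB /= distrC [X in _ + X <= _]distrC.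
have -> : z n - (x +i* y) = (z n - z m) + (z m - (x +i* y)) by ring.
apply: le_trans (nmD _ _) _; have := Hz n m; move: hw h1 h2 h3.
move: (nm _) (nm _) `|_| `|_| (e n) (e m) => *; lra.
Qed.

Section existence.
Variable mu : probability G R.
Hypothesis haar : is_haar mu.
Variable Q : nat -> (G -> C) -> G -> C.
Hypothesis Q_pol : forall n f, contC f -> pol (Q n f).
Hypothesis Q_lie : forall n s f, is_smooth f -> iter_lie s (Q n f) = Q n (iter_lie s f).
Hypothesis Q_lin : forall n c f h, contC f -> contC h ->
  Q n (fun g => c * f g + h g) = fun g => c * Q n f g + Q n h g.
Hypothesis Q_cvg : forall f (e : R), contC f -> 0 < e -> exists N, forall n, (N <= n)%N ->
  forall g, nm (Q n f g - f g) <= e.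

Lemma smooth_cont (f : G -> C) : is_smooth f -> contC f.
Proof. by move=> sf; exact: (smooth_contC [::] sf). Qed.

(** Q commutes with the derivations, so that it approximates in every seminorm. *)
Lemma approx_errors (f : G -> C) : is_smooth f -> exists E : nat -> seq (su2 R) -> R,
  (forall n s g, nm (iter_lie s (Q n f) g - iter_lie s f g) <= E n s) /\
  forall (S : seq (seq (su2 R))) (K d : R), 0 < d ->
    exists N, forall n, (N <= n)%N -> K * \sum_(s <- S) E n s <= d.
Proof.
move=> sf.
have ex (p : nat * seq (su2 R)) : exists g0, forall g,
    nm (iter_lie p.2 (Q p.1 f) g - iter_lie p.2 f g) <=
    nm (iter_lie p.2 (Q p.1 f) g0 - iter_lie p.2 f g0).
  apply: SU2_max; apply: contC_nm; apply: contC_sub; last exact: smooth_contC.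
  by apply: smooth_contC; apply: pol_smooth; apply: Q_pol; exact: smooth_cont.
have [g0 Hg0] := choice ex.
pose E n s := nm (iter_lie s (Q n f) (g0 (n, s)) - iter_lie s f (g0 (n, s))).
have E0 n s : 0 <= E n s by exact: nm_ge0.
exists E; split=> [n s g|S K d d0]; first exact: (Hg0 (n, s)).
have H (S' : seq (seq (su2 R))) : forall d : R, 0 < d ->
    exists N, forall n, (N <= n)%N -> \sum_(s <- S') E n s <= d.
  elim: S' => [|s S' IH] e e0; first by exists 0%N => n _; rewrite big_nil ltW.
  have e2 : 0 < e / 2 by lra.
  have [N1 H1] := IH _ e2; have [N2 H2] := Q_cvg (smooth_contC s sf) e2.
  exists (maxn N1 N2) => n; rewrite geq_max => /andP[n1 n2]; rewrite big_cons.
  have := H1 n n1; have := H2 n n2 (g0 (n, s)); rewrite /E Q_lie //.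
  by move: (nm _) (\sum_(_ <- _) _) => x y; lra.
have K1 : 0 < `|K| + 1 by rewrite ltr_wpDl.
have [N HN] := H S _ (divr_gt0 d0 K1); exists N => n Nn.
have := HN n Nn; rewrite ler_pdivlMr // => h; apply: le_trans h.
have S0 : 0 <= \sum_(s <- S) E n s by apply: sumr_ge0.
rewrite mulrC ler_wpM2l //; apply: le_trans (ler_norm K) _; by rewrite lerDl.
Qed.

Lemma mollified_eig n (l : R) (f : G -> C) : is_smooth f ->
  (forall g, - iter_lie [:: X; X] f g - iter_lie [:: Y; Y] f g - iter_lie [:: Z; Z] f g =
    l%:C * f g) -> eigL X Y Z l (Q n f).
Proof.
move=> sf LE; have cf := smooth_cont sf; split; first exact: Q_pol.
have [k [i2 [DD kE]]] : exists k : su2 R -> G -> C, (forall A, contC (k A)) /\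
    (forall A, D A (D A (Q n f)) = Q n (k A)) /\
    forall g, - k X g - k Y g - k Z g = l%:C * f g.
  exists (fun A => iter_lie [:: A; A] f); split=> [A|]; first exact: smooth_contC sf.
  by split=> // A; rewrite dlE -(Q_lie n [:: A; A] sf).
clear LE.
have i0 : contC (fun _ : G => 0 : C) by exact: contC_cst.
have Q0 : Q n (fun=> 0) = fun=> 0.
  have := Q_lin n (-1) i0 i0; rewrite (_ : (fun g => _) = fun=> 0) => [E0|].
    by apply/funext => g; rewrite E0 mulN1r addNr.
  by apply/funext => g; rewrite mulr0 addr0.
have c0 : contC (fun g => l%:C * f g + 0).
  by apply: contCD => //; apply: contCM => //; exact: contC_cst.
have c1 A (h : G -> C) : contC h -> contC (fun g => 1 * k A g + h g).
  by move=> hc; apply: contCD => //; apply: contCM => //; exact: contC_cst.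
have E1 := Q_lin n 1 (i2 X) (c1 Y _ (c1 Z _ c0)).
rewrite (Q_lin n 1 (i2 Y) (c1 Z _ c0)) (Q_lin n 1 (i2 Z) c0) (Q_lin n l%:C cf i0) Q0 in E1.
apply/funext => g; have := congr1 (fun h => h g) E1.
rewrite (_ : (fun g => _) = fun=> 0); last first.
  apply/funext => x; move: (kE x).
  by move: (k X x) (k Y x) (k Z x) (f x) => x1 x2 x3 y e; rewrite addr0 -e; ring.
rewrite Q0 /Lap !DD.
move: (Q n (k X) g) (Q n (k Y) g) (Q n (k Z) g) (Q n f g) => x y w t h.
by rewrite -[LHS]addr0 h; ring.
Qed.

Lemma mksm0 : mksm (fun=> 0) = 0.
Proof. by apply: val_inj; rewrite [LHS]mksmE //; apply: pol_smooth; exact: pol_cst. Qed.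

(** The Bessel potential of u is the limit of u tested against the Bessel
    potentials of the polynomial approximations of the test function. It exists
    because Bessel potentials are contractions that commute with the derivations. *)
Lemma bessel_exists (a : R) (u : SU2_distribution R) : 0 <= a ->
  exists v : SU2_distribution R, forall (l : R) (f : SU2_smooth R),
    laplacian X Y Z f = l%:C *: f -> v f = ((1 + l) `^ (- a))%:C * u f.
Proof.
move=> a0; have du := distributionP u; have lu := du.1.
have u_lin c f h : u (c *: f + h) = c * u f + u h by exact: lu.
have u0 : u 0 = 0.
  by have := u_lin (-1) 0 0; rewrite scaler0 addr0 mulN1r addNr.
have [S [K [K0 HK]]] := distribution_bound du.
have ex p : exists q, pol p -> bessel_rel a p q.
  have [pp|np] := pselect (pol p); last by exists p.
  by have [q qp] := bessel_rel_exists a pp; exists q.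
have [J HJ] := choice ex.
have pQ n (f : SU2_smooth R) : pol (Q n f) by apply: Q_pol; exact: smooth_cont (smoothP f).
have JQ n (f : SU2_smooth R) : bessel_rel a (Q n f) (J (Q n f)) := HJ _ (pQ n f).
pose z n (f : SU2_smooth R) := u (mksm (J (Q n f))).
have sJ n (f : SU2_smooth R) : is_smooth (J (Q n f)).
  exact: pol_smooth (bessel_rel_pol (JQ n f)).2.
have zE (p q : G -> C) (M : seq (su2 R) -> R) : bessel_rel a p q ->
    (forall s g, nm (iter_lie s p g) <= M s) -> nm (u (mksm q)) <= K * \sum_(s <- S) M s.
  move=> pq HM; apply: HK => s g; rewrite mksmE; last exact: pol_smooth (bessel_rel_pol pq).2.
  exact: (bessel_rel_le a0 (bessel_rel_iter_lie s pq) (HM s)).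
have iter_sub s c (p q : G -> C) : is_smooth p -> is_smooth q ->
    iter_lie s (fun g => c * p g + q g) = fun g => c * iter_lie s p g + iter_lie s q g.
  by move=> sp sq; exact: (iter_lie_linear s c sp sq).
have errs (f : SU2_smooth R) := approx_errors (smoothP f).
have [E HE] := choice errs.
have lim (f : SU2_smooth R) : exists w, forall n, nm (z n f - w) <= K * \sum_(s <- S) E f n s.
  apply: cauchy_limit => [d d0|n m]; first exact: (HE f).2.
  have rel := bessel_rel_linear (-1) (JQ m f) (JQ n f).
  have -> : z n f - z m f = u (mksm (fun g => -1 * J (Q m f) g + J (Q n f) g)).
    by rewrite (smooth_lin (-1) (sJ m f) (sJ n f)).2 u_lin mulN1r addrC.
  rewrite -mulrDr -big_split /=; apply: (zE _ _ _ rel) => s g.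
  rewrite iter_sub; try exact: pol_smooth.
  have -> : -1 * iter_lie s (Q m f) g + iter_lie s (Q n f) g =
    (iter_lie s (Q n f) g - iter_lie s f g) - (iter_lie s (Q m f) g - iter_lie s f g) by ring.
  by apply: le_trans (nmB _ _) _; apply: lerD; exact: (HE f).1.
have [v Hv] := choice lim.
have small (f : SU2_smooth R) (w : C) (B : R) : (forall n, nm (z n f - w) <= B * \sum_(s <- S) E f n s) -> v f = w.
  move=> Hw; apply/eqP; rewrite -subr_eq0; apply/eqP/nm_small => d d0.
  have [N HN] := (HE f).2 S (K + B) _ d0.
  apply: le_trans (HN N (leqnn N)); rewrite mulrDl.
  have -> : v f - w = (z N f - w) - (z N f - v f) by ring.
  by apply: le_trans (nmB _ _) _; rewrite addrC lerD.
have v_lin : scalar v.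
  move=> c f h; apply/eqP; rewrite -subr_eq0; apply/eqP/nm_small => d d0.
  have d3 : 0 < d / 3 by lra.
  have [N1 H1] := (HE (c *: f + h)).2 S K _ d3.
  have [N2 H2] := (HE f).2 S (nm c * K) _ d3.
  have [N3 H3] := (HE h).2 S K _ d3.
  pose n := maxn N1 (maxn N2 N3).
  have n1 : (N1 <= n)%N by exact: leq_maxl.
  have n2 : (N2 <= n)%N by rewrite /n maxnCA leq_maxl.
  have n3 : (N3 <= n)%N by rewrite /n maxnA leq_maxr.
  have zl : z n (c *: f + h) = c * z n f + z n h.
    have QE : Q n (c *: f + h) = fun g => c * Q n f g + Q n h g.
      by apply: Q_lin; exact: smooth_cont (smoothP _).
    have rel := bessel_rel_linear c (JQ n f) (JQ n h).
    have := JQ n (c *: f + h); rewrite /z QE => rel'.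
    by rewrite (bessel_rel_uniq a0 rel' rel) (smooth_lin c (sJ n f) (sJ n h)).2 u_lin.
  have -> : v (c *: f + h) - (c * v f + v h) = - (z n (c *: f + h) - v (c *: f + h)) +
    (c * (z n f - v f) + (z n h - v h)).
    rewrite zl; move: (v (c *: f + h)) (v f) (v h) (z n f) (z n h) => w1 w2 w3 w4 w5.
    by move: (c : C) => c'; ring.
  apply: le_trans (nmD _ _) _; rewrite nmN.
  have k1 := le_trans (Hv (c *: f + h) n) (H1 n n1).
  have k2 : nm (c * (z n f - v f)) <= d / 3.
    rewrite nmM; apply: le_trans (H2 n n2); rewrite -mulrA ler_wpM2l ?nm_ge0 //; exact: Hv.
  have k3 := le_trans (Hv h n) (H3 n n3).
  have k4 := nmD (c * (z n f - v f)) (z n h - v h).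
  by move: k1 k2 k3 k4; move: (nm _) (nm _) (nm _) (nm _) => *; lra.
have v_dist : is_distribution v.
  apply: (distribution_intro (S := S) (K := K)) => // f M HM.
  apply/ler_addgt0Pr => d d0; have [N HN] := (HE f).2 S (2 * K) _ d0.
  have -> : v f = z N f - (z N f - v f) by ring.
  apply: le_trans (nmB _ _) _.
  have k1 : nm (z N f) <= K * \sum_(s <- S) (M s + E f N s).
    apply: (zE _ _ _ (JQ N f)) => s g.
    rewrite -[iter_lie s (Q N f) g](subrK (iter_lie s f g)) addrC.
    by apply: le_trans (nmD _ _) _; apply: lerD; [exact: HM|exact: (HE f).1].
  have k2 := Hv f N; have k3 := HN N (leqnn N).
  move: k1 k2 k3; rewrite big_split /= mulrDr.
  by move: (nm _) (nm _) (\sum_(_ <- _) _) (\sum_(_ <- _) _) => x y A B; lra.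
have dv : v \in @distribution_pred R by apply/asboolP.
exists (MkDistribution dv) => l f Lf /=.
have LE g : - iter_lie [:: X; X] f g - iter_lie [:: Y; Y] f g - iter_lie [:: Z; Z] f g =
    l%:C * f g by have := congr1 (fun h : SU2_smooth R => h g) Lf.
have LQ n : eigL X Y Z l (Q n f) := mollified_eig n (smoothP f) LE.
have [l0|l0] := leP 0 l; last first.
  have f0 : f = 0.
    apply: val_inj; apply/funext => g /=; apply: nm_small => d d0.
    have [N HN] := Q_cvg (smooth_cont (smoothP f)) d0.
    have := HN N (leqnn N) g; rewrite (eig_neg0 (LQ N) l0) sub0r nmN.
    exact.
  rewrite f0 u0 mulr0; have := v_lin (-1) 0 0.
  by rewrite scaler0 addr0 mulN1r addNr.
apply: (small f _ (nm ((1 + l) `^ (- a))%:C * K)) => n.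
have sQ : is_smooth (Q n f) by exact: pol_smooth.
have zn : z n f = ((1 + l) `^ (- a))%:C * u (mksm (Q n f)).
  rewrite /z (bessel_rel_uniq a0 (JQ n f) (bessel_rel_eig a (LQ n) l0)).
  have s0 : is_smooth (fun=> 0 : C) by apply: pol_smooth; exact: pol_cst.
  have := (smooth_lin (((1 + l) `^ (- a))%:C) sQ s0).2.
  rewrite mksm0 => E1; rewrite (_ : (fun g => _) = fun g => ((1 + l) `^ (- a))%:C * Q n f g + 0).
    by rewrite E1 u_lin u0 addr0.
  by apply/funext => g; rewrite addr0.
rewrite zn -mulrBr nmM -mulrA ler_wpM2l ?nm_ge0 //.
have -> : u (mksm (Q n f)) - u f = u (mksm (fun g => -1 * f g + Q n f g)).
  by rewrite (smooth_lin (-1) (smoothP f) sQ).2 u_lin mksm_val mulN1r addrC.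
apply: HK => s g; rewrite mksmE; last by have [] := smooth_lin (-1) (smoothP f) sQ.
rewrite iter_sub //; last exact: smoothP.
by rewrite mulN1r addrC; exact: (HE f).1.
Qed.

End existence.

End bessel_potential.

(** * Approximation and completeness in the mean *)

Import HBSimple.

Section mean_convergence.
Variable R : realType.
Local Notation C := R[i].
Local Notation G := (SU2 R).
Variable mu : probability G R.
Local Notation RI := (RI mu).
Local Notation ri := (ri mu).
Local Notation ci := (ci mu).

Lemma fine_small (u : nat -> \bar R) (e : R) : u @ \oo --> 0%E -> 0 < e ->
  exists N, forall n, (N <= n)%N -> fine (u n) <= e.
Proof.
move=> h e0; have h' : fine \o u @ \oo --> (0 : R) by exact: fine_cvg.
have [N _ HN] := (cvgrPdist_le _ _).1 h' _ e0; exists N => n Nn.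
have := HN n Nn; rewrite sub0r normrN; apply: le_trans; exact: ler_norm.
Qed.

Lemma RI_dominated_ae (f_ : nat -> G -> R) (f B : G -> R) :
  (forall n, ri (f_ n)) -> measurable_fun [set: G] f ->
  {ae mu, forall x, f_ n x @[n --> \oo] --> f x} ->
  ri B -> {ae mu, forall x n, `|f_ n x| <= B x} ->
  ri f /\ forall e : R, 0 < e -> exists N, forall n, (N <= n)%N ->
    RI (fun x => `|f_ n x - f x|) <= e.
Proof.
move=> fi mf fl Bi fB.
have [] := @dominated_convergence _ _ _ mu setT measurableT
  (fun n x => (f_ n x)%:E) (fun x => (f x)%:E) (fun x => (B x)%:E) _ _ _ Bi _.
- by move=> n; apply/measurable_EFinP; exact: ri_meas.
- exact/measurable_EFinP.
- move: fl; apply: filterS => x h _; apply: cvg_EFin => //; exact: nearW.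
- by move: fB; apply: filterS => x h n _; rewrite lee_fin.
move=> f_i h _; split=> // e e0.
exact: (fine_small h e0).
Qed.

Lemma RI_dominated (f_ : nat -> G -> R) (f B : G -> R) :
  (forall n, ri (f_ n)) -> (forall x, f_ n x @[n --> \oo] --> f x) ->
  ri B -> (forall n x, `|f_ n x| <= B x) ->
  ri f /\ forall e : R, 0 < e -> exists N, forall n, (N <= n)%N ->
    RI (fun x => `|f_ n x - f x|) <= e.
Proof.
move=> fi fl Bi fB; apply: RI_dominated_ae Bi _ => //.
- apply: (measurable_fun_cvg (h := f_)) => [n|x _]; [exact: ri_meas|exact: fl].
- exact: aeW.
- by apply: aeW => x n; exact: fB.
Qed.

Hypothesis haar : is_haar mu.

Definition approximable (f : G -> R) : Prop := ri f /\
  forall e : R, 0 < e -> exists2 p, pol p & RI (fun x => nm ((f x)%:C - p x)) <= e.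

Lemma ci_real (f : G -> R) : ri f -> ci (fun x => (f x)%:C).
Proof. by move=> fi; split=> //=; exact: ri_cst. Qed.

Lemma RI_nm_triangle (f h k : G -> C) : ci f -> ci h -> ci k ->
  RI (fun x => nm (f x - k x)) <=
  RI (fun x => nm (f x - h x)) + RI (fun x => nm (h x - k x)).
Proof.
move=> fi hi ki; rewrite -RI_add; try by apply: ri_nm; exact: ci_sub.
apply: RI_le => [||x]; try by [apply: ri_nm; exact: ci_sub|apply: ri_add; apply: ri_nm; exact: ci_sub].
have -> : f x - k x = (f x - h x) + (h x - k x) by ring.
exact: nmD.
Qed.

Lemma approximable_cont f : continuous f -> approximable f.
Proof.
move=> fc; split=> [|e e0]; first exact: cont_ri.
have [p pp Hp] := pol_dense haar (contC_real fc) e0; exists p => //.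
rewrite -[leRHS](RI_cst mu); apply: RI_le => //; last exact: ri_cst.
by apply: ri_nm; apply: ci_sub; [apply: ci_real; exact: cont_ri|exact/contC_ci/pol_contC].
Qed.

Lemma approximable_linear c f h : approximable f -> approximable h ->
  approximable (fun x => c * f x + h x).
Proof.
move=> [fi Hf] [hi Hh]; split=> [|e e0]; first by apply: ri_add => //; exact: ri_scale.
have c0 : 0 < `|c| + 1 by rewrite ltr_wpDl.
have [p pp Hp] := Hf (e / 2 / (`|c| + 1)) ltac:(by rewrite !divr_gt0).
have [q pq Hq] := Hh (e / 2) ltac:(by rewrite divr_gt0).
have pi := contC_ci mu (pol_contC pp); have qi := contC_ci mu (pol_contC pq).
exists (fun g => c%:C * p g + q g); first by apply: polD => //; exact: polZ.
have fpi : ri (fun x => nm ((f x)%:C - p x)) by apply: ri_nm; apply: ci_sub => //; exact: ci_real.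
have hqi : ri (fun x => nm ((h x)%:C - q x)) by apply: ri_nm; apply: ci_sub => //; exact: ci_real.
apply: (@le_trans _ _ (RI (fun x => `|c| * nm ((f x)%:C - p x) + nm ((h x)%:C - q x)))).
  apply: RI_le => [||x].
  - apply: ri_nm; apply: ci_sub; last by apply: ci_add => //; exact: ci_scale.
    by apply: ci_real; apply: ri_add => //; exact: ri_scale.
  - by apply: ri_add => //; exact: ri_scale.
  - have -> : (c * f x + h x)%:C - (c%:C * p x + q x) =
        c%:C * ((f x)%:C - p x) + ((h x)%:C - q x) by rewrite rmorphD rmorphM; ring.
    by apply: le_trans (nmD _ _) _; rewrite nmM nm_real.
rewrite RI_add ?RI_scale //; last exact: ri_scale.
have h1 : `|c| * RI (fun x => nm ((f x)%:C - p x)) <= e / 2.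
  apply: (@le_trans _ _ ((`|c| + 1) * (e / 2 / (`|c| + 1)))).
    by apply: ler_pM => //; [apply: RI_ge0 => x; exact: nm_ge0|rewrite lerDl].
  by rewrite mulrC divfK // gt_eqF.
by apply: le_trans (lerD h1 Hq) _; rewrite -splitr.
Qed.

Lemma approximable_limit f : ri f ->
  (forall e : R, 0 < e -> exists2 h, approximable h & RI (fun x => `|h x - f x|) <= e) ->
  approximable f.
Proof.
move=> fi H; split=> // e e0; have e2 : 0 < e / 2 by rewrite divr_gt0.
have [h [hi /(_ _ e2)[p pp Hp]] Hh] := H _ e2; exists p => //.
apply: le_trans (RI_nm_triangle (ci_real fi) (ci_real hi) (contC_ci mu (pol_contC pp))) _.
rewrite (_ : (fun x => nm ((f x)%:C - (h x)%:C)) = (fun x => `|h x - f x|)).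
  by apply: le_trans (lerD Hh Hp) _; rewrite -splitr.
by apply/funext => x; rewrite -rmorphB nm_real distrC.
Qed.

Lemma approximable_sum_nat (n : nat) (f : nat -> G -> R) : (forall i, approximable (f i)) ->
  approximable (fun x => \sum_(i < n) f i x).
Proof.
move=> H; elim: n => [|n IH].
  rewrite (_ : (fun x => _) = fun=> 0); last by apply/funext => x; rewrite big_ord0.
  by apply: approximable_cont => x; exact: cst_continuous.
rewrite (_ : (fun x => _) = fun x => 1 * f n x + \sum_(i < n) f i x).
  exact: approximable_linear.
by apply/funext => x; rewrite big_ord_recr /= mul1r addrC.
Qed.

(** A metric for the topology of the group. *)
Definition entry_dist (g h : G) : R := \sum_(p : 'I_2 * 'I_2) nm (g p.1 p.2 - h p.1 p.2).

Lemma entry_dist_cont (h : G) : continuous (fun g => entry_dist g h).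
Proof.
have c1 (p : 'I_2 * 'I_2) : continuous (fun g : G => nm (g p.1 p.2 - h p.1 p.2)).
  apply: contC_nm; apply: contC_sub; [exact: contC_entry|exact: contC_cst].
rewrite /entry_dist /index_enum; elim: (Finite.enum _) => [|p r IH].
  rewrite (_ : (fun g => _) = fun=> 0); first by move=> x; exact: cst_continuous.
  by apply/funext => g; rewrite big_nil.
rewrite (_ : (fun g => _) = fun g : G => nm (g p.1 p.2 - h p.1 p.2) +
    \sum_(p <- r) nm (g p.1 p.2 - h p.1 p.2)); first exact: contD.
by apply/funext => g; rewrite big_cons.
Qed.

Lemma entry_dist_triangle g h k : entry_dist g k <= entry_dist g h + entry_dist h k.
Proof.
rewrite /entry_dist -big_split /=; apply: ler_sum => p _.
have -> : g p.1 p.2 - k p.1 p.2 = (g p.1 p.2 - h p.1 p.2) + (h p.1 p.2 - k p.1 p.2) by ring.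
exact: nmD.
Qed.

Lemma entry_dist_ge0 g h : 0 <= entry_dist g h.
Proof. by apply: sumr_ge0 => p _; exact: nm_ge0. Qed.

Lemma entry_distC g h : entry_dist g h = entry_dist h g.
Proof. by apply: eq_bigr => p _; rewrite nm_distC. Qed.

Lemma entry_dist_eq0 g h : entry_dist g h = 0 -> g = h.
Proof.
move=> /eqP; rewrite psumr_eq0 => [/allP H|p _]; last exact: nm_ge0.
apply: SU2_eq; apply/matrixP => i j; apply/eqP; rewrite -subr_eq0; apply/eqP/nm_eq0/eqP.
exact: (H (i, j) (mem_index_enum _)).
Qed.

(** The distance to the complement is continuous. *)
Lemma open_cozero (U : set G) : open U ->
  exists2 f : G -> R, continuous f & (forall g, 0 <= f g) /\ forall g, (0 < f g) <-> U g.
Proof.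
move=> oU; have [U0|] := eqVneq (~` U) set0.
  exists (fun=> 1); first by move=> x; exact: cst_continuous.
  split=> // g; split=> // _; apply: contrapT => nU.
  by have : (~` U) g by []; rewrite U0.
move=> /set0P F0; have cF : compact (~` U).
  apply: (subclosed_compact _ (@SU2_compact R)) => //; exact: open_closedC.
have ex (g : G) : exists h, (~` U) h /\ forall k, (~` U) k -> entry_dist g h <= entry_dist g k.
  have cc : {within ~` U, continuous (entry_dist g)}.
    apply: continuous_subspaceT => x; rewrite (_ : entry_dist g = fun h => entry_dist h g).
      exact: entry_dist_cont.
    by apply/funext => h; rewrite entry_distC.
  by have [h hF Hh] := compact_EVT_min F0 cF cc; rewrite inE in hF; exists h; split=> // k kF; apply: Hh; rewrite inE.
have [near Hn] := choice ex.
exists (fun g => entry_dist g (near g)).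
  move=> g; apply: (@cvgrPdist_lt R R^o G (nbhs g) _ _ _).2 => e e0.
  have hg : entry_dist g g = 0 by apply: big1 => p _; rewrite subrr nm0.
  have nb : \forall t \near nbhs g, `|entry_dist g g - entry_dist t g| < e.
    exact: ((@cvgrPdist_lt R R^o G (nbhs g) _ _ _).1 (@entry_dist_cont g g) e e0).
  apply: (@filterS _ (nbhs g) _ _ _ _ nb) => h; rewrite hg sub0r normrN (ger0_norm (entry_dist_ge0 _ _)) => he.
  apply: le_lt_trans he; rewrite ler_norml; apply/andP; split.
    have := (Hn h).2 _ (Hn g).1; have := entry_dist_triangle h g (near g).
    by move: (entry_dist h g) (entry_dist g _) (entry_dist h _) (entry_dist h _) => *; lra.
  have := (Hn g).2 _ (Hn h).1; have := entry_dist_triangle g h (near h).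
  rewrite (entry_distC g h).
  by move: (entry_dist h g) (entry_dist g _) (entry_dist g _) (entry_dist h _) => *; lra.
split=> g; first exact: entry_dist_ge0.
split=> [dp|Ug].
  apply: contrapT => nU; have := (Hn g).2 g nU.
  rewrite [X in _ <= X](_ : _ = 0) ?leNgt ?dp //.
  by apply: big1 => p _; rewrite subrr nm0.
rewrite lt_def entry_dist_ge0 andbT; apply/eqP => /entry_dist_eq0 E.
by apply: (Hn g).1; rewrite -E.
Qed.

Lemma ri_indic (A : set G) : measurable A -> ri (\1_A : G -> R).
Proof. exact: integrable_indic. Qed.

Lemma approximable_open (U : set G) : open U -> approximable (\1_U : G -> R).
Proof.
move=> oU; have [f fc [f0 fU]] := open_cozero oU.
have mc n : continuous (fun g => Num.min 1 (n%:R * f g)).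
  move=> x; apply: (@continuous_min R G (fun=> 1) (fun g => n%:R * f g)).
    exact: cst_continuous.
  have := @contM R G (fun=> n%:R) f; apply => //; by move=> y; exact: cst_continuous.
have nf n g : 0 <= n%:R * f g by rewrite mulr_ge0.
have bd n g : `|Num.min 1 (n%:R * f g)| <= 1.
  by rewrite ger0_norm ?le_min ?ler01 ?nf // ge_min lexx.
have [|] := @RI_dominated (fun n g => Num.min 1 (n%:R * f g)) (\1_U) (fun=> 1)
  (fun n => cont_ri mu (mc n)) _ (ri_cst mu 1) bd.
  move=> g; rewrite indicE; have [Ug|nU] := boolP (g \in U).
    have fg : 0 < f g by apply/fU; rewrite inE in Ug.
    apply/cvgrPdist_lt => e e0; exists (Num.truncn (f g)^-1).+1 => // n /= Nn.
    have -> : Num.min 1 (n%:R * f g) = 1; last by rewrite subrr normr0.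
    apply/min_idPl; rewrite -ler_pdivrMr // mul1r; apply: ltW.
    by apply: lt_le_trans (truncnS_gt _) _; rewrite ler_nat.
  have -> : f g = 0.
    apply/eqP; rewrite eq_le f0 andbT leNgt; apply/negP => /fU Ug.
    by move: nU; rewrite notin_setE.
  rewrite (_ : (fun n => _) = fun=> 0); first exact: cvg_cst.
  by apply/funext => n; rewrite mulr0; apply/min_idPr.
move=> Ui H; apply: approximable_limit => // e e0; have [N HN] := H e e0.
by exists (fun g => Num.min 1 (N%:R * f g)); [exact: approximable_cont|exact: HN].
Qed.

(** Monotone class argument: the sets with approximable indicators form a
    Dynkin class containing the open sets. *)
Lemma approximable_indic (A : set G) : measurable A -> approximable (\1_A : G -> R).
Proof.
move=> mA; apply: (@dynkin_induction _ G (@open G) (fun A => approximable (\1_A : G -> R))) => //.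
- by move=> U V oU oV; exact: openI.
- by apply: approximable_open; exact: openT.
- by move=> U oU; exact: approximable_open.
- move=> S mS aS; rewrite indicC.
  rewrite (_ : (fun x => _) = fun x => -1 * (\1_S x : R) + 1).
    apply: approximable_linear => //; apply: approximable_cont => x; exact: cst_continuous.
  by apply/funext => x; rewrite indicE; case: (x \in S) => /=; ring.
- move=> F mF tF aF.
  have mU : measurable (\bigcup_k F k) by exact: bigcupT_measurable.
  have sum_le n x : `|\sum_(i < n) (\1_(F i) x : R)| <= 1.
    rewrite ger0_norm ?sumr_ge0 // -lee_fin -sumEFin.
    have := @nneseries_lim_ge R (fun i => ((\1_(F i) x : R)%:E)) xpredT 0 n _.
    rewrite -indic_bigcup // big_mkord => h; apply: le_trans (h _) _.
      by move=> i _ _; rewrite lee_fin.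
    by rewrite lee_fin indicE lern1 leq_b1.
  have [|] := @RI_dominated (fun n x => \sum_(i < n) \1_(F i) x) (\1_(\bigcup_k F k)) (fun=> 1)
    (fun n => (approximable_sum_nat n aF).1) _ (ri_cst mu 1) sum_le.
    move=> x; have := @is_cvg_nneseries R (fun i => ((\1_(F i) x : R)%:E)) xpredT 0%N.
    move=> h; have hc : cvgn (fun n => (\sum_(0 <= i < n) (\1_(F i) x : R)%:E)%E).
      by apply: h => i _ _; rewrite lee_fin.
    have E := @indic_bigcup _ R F x tF.
    have hl : (fun n => (\sum_(0 <= i < n) (\1_(F i) x : R)%:E)%E) @ \oo --> (\1_(\bigcup_k F k) x : R)%:E.
      by rewrite E; exact: hc.
    have hf : fine \o (fun n => (\sum_(0 <= i < n) (\1_(F i) x : R)%:E)%E) @ \oo -->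
        (\1_(\bigcup_k F k) x : R) by exact: fine_cvg.
    rewrite (_ : (fun n => _) = fine \o (fun n => (\sum_(0 <= i < n) (\1_(F i) x : R)%:E)%E)) //.
    by apply/funext => n /=; rewrite sumEFin /= big_mkord.
  move=> Ui H; apply: approximable_limit => // e e0; have [N HN] := H e e0.
  by exists (fun x => \sum_(i < N) (\1_(F i) x : R)); [exact: (approximable_sum_nat N aF)|exact: HN].
Qed.

(** Integrable functions are limits of simple functions. *)
Lemma approximable_ri (f : G -> R) : ri f -> approximable f.
Proof.
move=> fi; apply: approximable_limit => // e e0.
have [h [hi hl h0]] := approximation_sfun_integrable measurableT fi.
have [N /(_ N (leqnn N)) HN] := fine_small h0 e0; exists (h N).
  pose s : seq R := finmap.enum_fset (fset_set (range (h N))).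
  have E : (h N : G -> R) = fun x => \sum_(i < size s) s`_i * \1_(h N @^-1` [set s`_i]) x.
    by apply/funext => x; exact: fimfunEord.
  rewrite E; apply: (approximable_sum_nat (size s)
    (f := fun i x => s`_i * \1_(h N @^-1` [set s`_i]) x)) => i.
  have -> : (fun x => s`_i * \1_(h N @^-1` [set s`_i]) x) =
      (fun x => s`_i * \1_(h N @^-1` [set s`_i]) x + 0).
    by apply/funext => x; rewrite addr0.
  apply: approximable_linear; first by apply: approximable_indic; exact: measurable_sfunP.
  by apply: approximable_cont => x; exact: cst_continuous.
move: HN; congr (_ <= _); rewrite RIE /Rintegral; congr fine.
by apply: eq_integral => x _; rewrite distrC.
Qed.

(** Completeness, in the form of convergence of absolutely summable series. *)
Lemma mean_series_real (d : nat -> G -> R) (S : R) : (forall n, ri (d n)) ->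
  (forall n, \sum_(i < n) RI (fun x => `|d i x|) <= S) ->
  exists2 k : G -> R, ri k & forall e : R, 0 < e -> exists N, forall n, (N <= n)%N ->
    RI (fun x => `|\sum_(i < n) d i x - k x|) <= e.
Proof.
move=> di HS.
pose A x := (\sum_(n <oo) (`|d n x|)%:E)%E.
have ai n : ri (fun x => `|d n x|) by exact: ri_abs.
have mA : measurable_fun [set: G] A.
  apply: ge0_emeasurable_sum => // n _; apply/measurable_EFinP; exact: ri_meas.
have A0 x : (0 <= A x)%E by apply: nneseries_ge0 => n _ _; rewrite lee_fin.
have Ai : mu.-integrable setT A.
  apply/integrableP; split=> //.
  rewrite (eq_integral A) => [|x _]; last by rewrite gee0_abs.
  rewrite /A integral_nneseries //; last by move=> n; apply/measurable_EFinP; exact: ri_meas.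
  apply: (@le_lt_trans _ _ S%:E); last exact: ltry.
  apply: lime_le; first by apply: is_cvg_nneseries => n _ _; exact: integral_ge0.
  apply: nearW => n; rewrite big_mkord.
  have -> : (\sum_(i < n) \int[mu]_x (`|d i x|)%:E)%E = (\sum_(i < n) RI (fun x => `|d i x|))%:E.
    rewrite -sumEFin; apply: eq_bigr => i _; rewrite RIE /Rintegral fineK //.
    exact: integrable_fin_num (ai i).
  by rewrite lee_fin.
have Bi : ri (fun x => fine (A x)).
  apply: (le_integrable _ _ _ Ai) => //.
    by apply/measurable_EFinP; apply: (measurableT_comp (f := fine)) => //; exact: fine_measurable.
  move=> x _ /=; rewrite (gee0_abs (A0 x)) ger0_norm ?fine_ge0 //.
  by have := A0 x; case: (A x) => //= r; rewrite leey.
pose Sn n x := \sum_(i < n) d i x.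
have Sni n : ri (Sn n).
  rewrite /Sn; elim: n => [|n IH].
    by rewrite (_ : (fun x => _) = fun=> 0); [exact: ri_cst|apply/funext => x; rewrite big_ord0].
  rewrite (_ : (fun x => _) = fun x => \sum_(i < n) d i x + d n x); first exact: ri_add.
  by apply/funext => x; rewrite big_ord_recr.
(* The upper limit is measurable, and it is the sum wherever the series converges. *)
pose k x := fine (limn_esup (fun n => (Sn n x)%:E)).
have mk : measurable_fun [set: G] k.
  apply: (measurableT_comp (f := fine)); first exact: fine_measurable.
  by apply: measurable_fun_limn_esup => n; apply/measurable_EFinP; exact: ri_meas.
have part n x : A x \is a fin_num -> \sum_(i < n) `|d i x| <= fine (A x).
  move=> Ax; rewrite -lee_fin fineK // -sumEFin.
  rewrite -(big_mkord xpredT (fun i => (`|d i x|)%:E)); apply: nneseries_lim_ge => i _ _.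
  by rewrite lee_fin.
have Afin := integrable_ae measurableT Ai.
have [||ki H] := @RI_dominated_ae Sn k (fun x => fine (A x)) Sni mk _ Bi _.
- move: Afin; apply: filterS => x /(_ I) Ax.
  have cs : cvgn (series (fun n => d n x)).
    apply: (@normed_cvg R R^o); apply: nondecreasing_is_cvgn.
      by apply: nondecreasing_series => i _ _; exact: normr_ge0.
    exists (fine (A x)) => _ [n _ <-]; rewrite /= seriesEord; exact: part.
  have cs' : Sn ^~ x @ \oo --> limn (series (fun n => d n x)).
    rewrite (_ : Sn ^~ x = series (fun n => d n x)) //.
    by apply/funext => n; rewrite seriesEord.
  have ce : (fun n => (Sn n x)%:E) @ \oo --> (limn (series (fun n => d n x)))%:E.
    by apply: cvg_EFin => //; exact: nearW.
  by rewrite /k (cvg_limn_einf_sup ce).2 /=.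
- move: Afin; apply: filterS => x /(_ I) Ax n.
  by apply: le_trans (ler_norm_sum _ _ _) _; exact: part.
by exists k.
Qed.

Lemma mean_series (d : nat -> G -> C) (S : R) : (forall n, ci (d n)) ->
  (forall n, \sum_(i < n) RI (fun x => nm (d i x)) <= S) ->
  exists2 k : G -> C, ci k & forall e : R, 0 < e -> exists N, forall n, (N <= n)%N ->
    RI (fun x => nm (\sum_(i < n) d i x - k x)) <= e.
Proof.
move=> di HS.
have le n : RI (fun x => `|complex.Re (d n x)|) <= RI (fun x => nm (d n x)) /\
    RI (fun x => `|complex.Im (d n x)|) <= RI (fun x => nm (d n x)).
  have [a b] := di n; split; apply: RI_le => [||x]; try exact: ri_abs;
    by [exact: ri_nm|exact: ler_Re_nm|exact: ler_Im_nm].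
have [n|k1 k1i H1] := mean_series_real (fun n => (di n).1) (S := S).
  by apply: le_trans (HS n); apply: ler_sum => i _; exact: (le i).1.
have [n|k2 k2i H2] := mean_series_real (fun n => (di n).2) (S := S).
  by apply: le_trans (HS n); apply: ler_sum => i _; exact: (le i).2.
exists (fun x => k1 x +i* k2 x) => // e e0.
have e2 : 0 < e / 2 by rewrite divr_gt0.
have [N1 h1] := H1 _ e2; have [N2 h2] := H2 _ e2.
exists (maxn N1 N2) => n; rewrite geq_max => /andP[n1 n2].
have [si _] := ci_sum (fun i : 'I_n => di i).
have r1 : ri (fun x => \sum_(i < n) complex.Re (d i x)).
  by have [r _] := si; move: r; congr (ri _); apply/funext => x; rewrite Re_sum.
have r2 : ri (fun x => \sum_(i < n) complex.Im (d i x)).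
  by have [_ r] := si; move: r; congr (ri _); apply/funext => x; rewrite Im_sum.
have i1 : ri (fun x => `|\sum_(i < n) complex.Re (d i x) - k1 x|) by apply: ri_abs; exact: ri_sub.
have i2 : ri (fun x => `|\sum_(i < n) complex.Im (d i x) - k2 x|) by apply: ri_abs; exact: ri_sub.
apply: (@le_trans _ _ (RI (fun x => `|\sum_(i < n) complex.Re (d i x) - k1 x| +
    `|\sum_(i < n) complex.Im (d i x) - k2 x|))).
  apply: RI_le => [||x]; [|exact: ri_add|].
    by apply: ri_nm; apply: ci_sub => //; split.
  apply: le_trans (ler_nm_ReIm _) _; rewrite -Re_sum -Im_sum.
  have alg (z : C) (p q : R) : `|complex.Re (z - (p +i* q))| + `|complex.Im (z - (p +i* q))| <=
      `|complex.Re z - p| + `|complex.Im z - q| by case: z.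
  exact: alg.
by rewrite RI_add //; apply: le_trans (lerD (h1 n n1) (h2 n n2)) _; rewrite -splitr.
Qed.

Lemma pol_dense_mean (f : G -> C) (e : R) : ci f -> 0 < e ->
  exists2 p, pol p & RI (fun x => nm (f x - p x)) <= e.
Proof.
move=> [fr fi] e0; have e2 : 0 < e / 2 by rewrite divr_gt0.
have [_ /(_ _ e2)[p pp Hp]] := approximable_ri fr.
have [_ /(_ _ e2)[q pq Hq]] := approximable_ri fi.
exists (fun g => p g + (0 +i* 1) * q g); first by apply: polD => //; exact: polZ.
have ip : ri (fun x => nm ((complex.Re (f x))%:C - p x)).
  by apply: ri_nm; apply: ci_sub; [exact: ci_real|exact/contC_ci/pol_contC].
have iq : ri (fun x => nm ((complex.Im (f x))%:C - q x)).
  by apply: ri_nm; apply: ci_sub; [exact: ci_real|exact/contC_ci/pol_contC].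
apply: (@le_trans _ _ (RI (fun x => nm ((complex.Re (f x))%:C - p x) +
    nm ((complex.Im (f x))%:C - q x)))).
  apply: RI_le => [||x]; [|exact: ri_add|].
    apply: ri_nm; apply: ci_sub => //; apply: contC_ci; apply: pol_contC.
    by apply: polD => //; exact: polZ.
  have -> : f x - (p x + (0 +i* 1) * q x) =
      ((complex.Re (f x))%:C - p x) + (0 +i* 1) * ((complex.Im (f x))%:C - q x).
    by case: (f x) (p x) (q x) => [a b] [a' b'] [a'' b'']; apply: complexP => /=; ring.
  apply: le_trans (nmD _ _) _; rewrite nmM.
  have -> : nm (0 +i* 1) = 1 :> R by rewrite /= expr0n expr1n add0r sqrtr1.
  by rewrite mul1r.
by rewrite RI_add //; apply: le_trans (lerD Hp Hq) _; rewrite -splitr.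
Qed.

End mean_convergence.

(** * The inverse operator on integrable functions *)

Section inverse.
Variable R : realType.
Local Notation C := R[i].
Local Notation G := (SU2 R).
Local Notation D := (@dl R).
Variable mu : probability G R.
Hypothesis haar : is_haar mu.
Local Notation cI := (cI mu).
Local Notation RI := (RI mu).
Local Notation ri := (ri mu).
Local Notation ci := (ci mu).
Variables X Y Z : su2 R.
Hypothesis XYZ : su2_frame X Y Z.
Local Notation Lap := (Lap X Y Z).
Local Notation joint_eig := (joint_eig X Y Z).
Variable ka : R.
Local Notation sym := (sym ka).

(** The symbol of W^(1/8) T^(-1) on functions of mean zero, extended by 0 to the
    constants; here T = - X^2 - Y^2 + ka Z. *)
Definition mult (l m : R) : C :=
  if l == 0 then 0 else ((1 + l) `^ (8^-1))%:C * (sym l m)^-1.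

Definition mult_rel (p q : G -> C) : Prop :=
  exists (I : finType) (l m : I -> R) (F : I -> G -> C),
    (forall i, joint_eig (l i) (m i) (F i)) /\
    p = (fun g => \sum_i F i g) /\ q = lc (fun i => mult (l i) (m i)) F.

(** The inequality of [poincare] shows that T has no kernel on functions of mean
    zero, so that the division by [sym] in [mult] is harmless. *)
Lemma joint_eig_sym0 (l m : R) f : joint_eig l m f -> l != 0 -> sym l m = 0 -> f = fun=> 0.
Proof.
move=> [ef zf l0 _] ln s0; have EF : jointfam X Y Z (fun _ : unit => l) (fun=> m) (fun=> f).
  by split.
apply/funext => g; apply: nm_eq0; apply/eqP; rewrite eq_le nm_ge0 andbT.
have := poincare haar XYZ (ka := ka) EF (fun=> ln) (c := fun=> 1) (K := 0) _ g.
rewrite mulr0 => h.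
rewrite (_ : f g = lc (fun=> 1) (fun _ : unit => f) g).
  by apply: h => x; rewrite /lc big1 ?nm0 // => i _; rewrite s0 mul0r mul0r.
by rewrite /lc big_const card_unit /= addr0 mul1r.
Qed.

Lemma joint_eig_pol (l m : R) f : joint_eig l m f -> pol f.
Proof. by move=> [[]]. Qed.

Lemma int_joint_eig (l m : R) f : joint_eig l m f -> l != 0 -> cI f = 0.
Proof. by move=> [ef _ _ _]; exact: (eig_mean0 haar ef). Qed.

Definition mult_norm : R := 2 * quarter_const ka.

(** Removing the mean at most doubles the maximum norm; on functions of mean
    zero the multiplier is controlled by the hypoelliptic estimate. *)
Lemma mult_bound p q (B : R) : mult_rel p q -> (forall g, nm (p g) <= B) ->
  forall g, nm (q g) <= mult_norm * B.
Proof.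
move=> [I [l [m [F [HF [-> ->]]]]]] HB g.
have B0 : 0 <= B by apply: le_trans (nm_ge0 _) (HB g).
(* The constants among the F i are replaced by the zero function, which belongs to
   every eigenspace. *)
pose l' i := if l i == 0 then 1 else l i.
pose F' i := if l i == 0 then (fun=> 0 : C) else F i.
pose m' i := if l i == 0 then 0 else m i.
have EF : jointfam X Y Z l' m' F'.
  split=> i; rewrite /l' /F' /m'; have [ef zf l0 _] := HF i.
    case: eqP => // _; split=> //; split; first exact: pol_cst.
    apply/funext => x; rewrite /Lap !D_cst; ring.
  case: eqP => // _; rewrite /eigZ D_cst; apply/funext => x; by rewrite mulr0.
have ln i : l' i != 0 by rewrite /l'; have [_|//] := eqVneq (l i) 0; rewrite oner_neq0.
have pF i : pol (F i) := joint_eig_pol (HF i).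
have iF i : ci (F i) := pol_ci mu (pF i).
pose c i := (sym (l' i) (m' i))^-1.
have r x : lc (fun i => sym (l' i) (m' i) * c i) F' x =
    \sum_i F i x - cI (fun g => \sum_i F i g).
  rewrite (ci_sum iF).2 -sumrB; apply: eq_bigr => i _.
  rewrite /F' /c /l' /m'; case: eqP => [E|/eqP E].
    have [_ _ _ /(_ E)[k ->]] := HF i; by rewrite mulr0 cI_cst subrr.
  rewrite (int_joint_eig (HF i) E) subr0; have [s0|s0] := eqVneq (sym (l i) (m i)) 0.
    by rewrite (joint_eig_sym0 (HF i) E s0) mulr0.
  by rewrite mulfV // mul1r.
have HK x : nm (lc (fun i => sym (l' i) (m' i) * c i) F' x) <= 2 * B.
  rewrite r (_ : 2 * B = B + B); last by ring.
  apply: le_trans (nmB _ _) _; apply: lerD; first exact: HB.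
  by apply: cI_bound_cst => //; exact: (ci_sum iF).1.
have := eighth_bound haar XYZ EF ln HK g.
rewrite (_ : quarter_const ka * (2 * B) = mult_norm * B); last by rewrite /mult_norm; ring.
congr (nm _ <= _); apply: eq_bigr => i _; rewrite /mult /c /F' /l' /m'.
by case: eqP => _; rewrite ?mulr0 ?mul0r.
Qed.

Lemma mult_rel_exists p : pol p -> exists q, mult_rel p q.
Proof.
move=> /(pol_decomposition XYZ)[I [l [m [F [H E]]]]].
by exists (lc (fun i => mult (l i) (m i)) F), I, l, m, F.
Qed.

Lemma mult_rel_pol p q : mult_rel p q -> pol p /\ pol q.
Proof.
move=> [I [l [m [F [HF [-> ->]]]]]]; have pF i : pol (F i) := joint_eig_pol (HF i).
by split; apply: pol_sum => // i; exact: polZ.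
Qed.

Lemma int_parts A f h : pol f -> pol h ->
  cI (fun g => D A f g * h g) = - cI (fun g => f g * D A h g).
Proof.
move=> pf ph; have pDf := pol_lie A pf; have pDh := pol_lie A ph.
have := int_D0 haar A (polM pf ph); rewrite (D_mul A pf ph) cI_add.
- by move=> h0; apply/eqP; rewrite -addr_eq0 h0.
- by apply: pol_ci; exact: polM.
- by apply: pol_ci; exact: polM.
Qed.

Lemma int_Lap_sym f h : pol f -> pol h ->
  cI (fun g => Lap f g * h g) = cI (fun g => f g * Lap h g).
Proof.
move=> pf ph; have pD A k : pol k -> pol (D A (D A k)) by move=> pk; do 2 apply: pol_lie.
have h2 A : cI (fun g => D A (D A f) g * h g) = cI (fun g => f g * D A (D A h) g).
  by rewrite int_parts ?int_parts ?opprK //; exact: pol_lie.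
have iM k k' : pol k -> pol k' -> ci (fun g => k g * k' g).
  by move=> pk pk'; apply: pol_ci; exact: polM.
have E (k k' : G -> C) : pol k -> pol k' -> cI (fun g => Lap k g * k' g) =
    - cI (fun g => D X (D X k) g * k' g) - cI (fun g => D Y (D Y k) g * k' g)
    - cI (fun g => D Z (D Z k) g * k' g).
  move=> pk pk'; rewrite -cI_opp; last by apply: iM => //; exact: pD.
  rewrite -!cI_sub; try by [do ?apply: ci_sub; try apply: ci_opp; apply: iM => //; exact: pD].
  by congr (cI _); apply/funext => g; rewrite /Lap; ring.
have comm k k' : cI (fun g => k g * k' g) = cI (fun g => k' g * k g).
  by congr (cI _); apply/funext => g; rewrite mulrC.
by rewrite E // !h2 [RHS]comm E // !(comm f).
Qed.

(** Joint eigenfunctions are orthogonal for the bilinear pairing unless the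
    eigenvalues of L agree and those of Z are opposite. *)
Lemma mult_orthogonal (l m l' m' : R) f h : joint_eig l m f -> joint_eig l' m' h ->
  mult l m * cI (fun g => f g * h g) = mult l' (- m') * cI (fun g => f g * h g).
Proof.
move=> [[pf Lf] Zf _ _] [[ph Lh] Zh _ _].
have ifh : ci (fun g => f g * h g) by apply: pol_ci; exact: polM.
have [->|fh] := eqVneq (cI (fun g => f g * h g)) 0; first by rewrite !mulr0.
have ll : l = l'.
  have := int_Lap_sym pf ph; rewrite Lf Lh.
  have -> : (fun g => l%:C * f g * h g) = (fun g => l%:C * (f g * h g)).
    by apply/funext => g; rewrite mulrA.
  have -> : (fun g => f g * (l'%:C * h g)) = (fun g => l'%:C * (f g * h g)).
    by apply/funext => g; rewrite mulrCA.
  rewrite !cI_scale // => /(mulIf fh) E; exact: (congr1 (@complex.Re R) E).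
have mm : m = - m'.
  have := int_parts Z pf ph; rewrite Zf Zh.
  have -> : (fun g => (0 +i* m) * f g * h g) = (fun g => (0 +i* m) * (f g * h g)).
    by apply/funext => g; rewrite mulrA.
  have -> : (fun g => f g * ((0 +i* m') * h g)) = (fun g => (0 +i* m') * (f g * h g)).
    by apply/funext => g; rewrite mulrCA.
  rewrite !cI_scale // -mulNr => /(mulIf fh) E; exact: (congr1 (@complex.Im R) E).
by rewrite ll mm.
Qed.

(** By [mult_orthogonal] the transpose of the multiplier has the symbol
    mult l (- m). *)
Lemma transpose_exists h : pol h -> exists2 k, pol k &
  forall p q, mult_rel p q -> cI (fun g => h g * q g) = cI (fun g => k g * p g).
Proof.
move=> /(pol_decomposition XYZ)[J [l' [m' [H [EH ->]]]]].
have pH j : pol (H j) := joint_eig_pol (EH j).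
exists (fun g => \sum_j mult (l' j) (- m' j) * H j g).
  by apply: pol_sum => j; exact: polZ.
move=> _ _ [I [l [m [F [HF [-> ->]]]]]].
have pF i : pol (F i) := joint_eig_pol (HF i).
have iFH (p : J * I) : ci (fun g => F p.2 g * H p.1 g) by apply: pol_ci; exact: polM.
have sw (a : J * I -> C) : cI (fun g => \sum_p a p * (F p.2 g * H p.1 g)) =
    \sum_p a p * cI (fun g => F p.2 g * H p.1 g).
  rewrite (ci_sum _).2 => [|p]; last exact: ci_scale.
  by apply: eq_bigr => p _; rewrite cI_scale.
transitivity (cI (fun g => \sum_(p : J * I) mult (l p.2) (m p.2) * (F p.2 g * H p.1 g))).
  congr (cI _); apply/funext => g; rewrite /lc big_distrlr /= pair_bigA /=.
  by apply: eq_bigr => p _; ring.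
transitivity (cI (fun g => \sum_(p : J * I) mult (l' p.1) (- m' p.1) * (F p.2 g * H p.1 g))).
  by rewrite !sw; apply: eq_bigr => p _; exact: mult_orthogonal.
congr (cI _); apply/funext => g; rewrite big_distrlr /= pair_bigA /=.
by apply: eq_bigr => p _; ring.
Qed.

Lemma RI_mul_le f h (B : R) : ci f -> contC h -> (forall g, nm (h g) <= B) ->
  nm (cI (fun g => f g * h g)) <= RI (fun g => nm (f g)) * B.
Proof.
move=> fi hc HB; rewrite mulrC -RI_scale; last exact: ri_nm.
apply: cI_bound; [exact: ci_mul|by apply: ri_scale; exact: ri_nm|] => g.
by rewrite nmM mulrC ler_wpM2r // nm_ge0.
Qed.

(** The L^1 norm of a continuous function is detected by polynomials: test with
    a regularisation of its conjugate phase. *)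
Lemma RI_duality k (B : R) : contC k ->
  (forall p, pol p -> (forall g, nm (p g) <= 1) -> nm (cI (fun g => k g * p g)) <= B) ->
  RI (fun g => nm (k g)) <= B.
Proof.
move=> kc HB; have ki := contC_ci mu kc; have ni : ri (fun g => nm (k g)) := ri_nm ki.
have n0 : 0 <= RI (fun g => nm (k g)) by apply: RI_ge0 => g; exact: nm_ge0.
have B0 : 0 <= B.
  apply: le_trans (HB (fun=> 0) (pol_cst 0) _); first exact: nm_ge0.
  by move=> g; rewrite nm0 ler01.
have key (e : R) : 0 < e ->
    RI (fun g => nm (k g)) <= e + e * RI (fun g => nm (k g)) + (1 + e) * B.
  move=> e0; have pos g : 0 < nm (k g) + e by rewrite ltr_wpDl // nm_ge0.
  pose phi g := ((nm (k g) + e)^-1)%:C * (k g)^*.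
  have phic : contC phi.
    apply: contCM; last exact: conj_contC.
    apply: (contC_real (f := fun g => (nm (k g) + e)^-1)) => x.
    have h : continuous (fun g : G => nm (k g) + e).
      by apply: contD; [exact: contC_nm|move=> y; exact: cst_continuous].
    exact: (cvgV (lt0r_neq0 (pos x)) (h x)).
  have conj_nm (z : C) : nm z^* = nm z by case: z => a b; rewrite /= sqrrN.
  have phi1 g : nm (phi g) <= 1.
    rewrite nmM nm_real conj_nm ger0_norm ?invr_ge0 ?(ltW (pos g)) //.
    by rewrite ler_pdivrMl // mulr1 lerDl ltW.
  have kphi g : k g * phi g = (nm (k g) ^+ 2 / (nm (k g) + e))%:C.
    rewrite /phi mulrCA (_ : k g * (k g)^* = (nm (k g) ^+ 2)%:C) -?rmorphM 1?mulrC //.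
    by rewrite nm_sqr; case: (k g) => a b; apply: complexP => /=; ring.
  have [p pp Hp] := pol_dense haar phic e0.
  have e1 : 0 < 1 + e by lra.
  have p1 g : nm (((1 + e)^-1)%:C * p g) <= 1.
    rewrite nmM nm_real ger0_norm ?invr_ge0 ?(ltW e1) // ler_pdivrMl // mulr1.
    rewrite (_ : p g = phi g - (phi g - p g)); last by ring.
    by apply: le_trans (nmB _ _) _; apply: lerD.
  have pc := pol_contC pp.
  have b1 : nm (cI (fun g => k g * p g)) <= (1 + e) * B.
    have := HB _ (polZ ((1 + e)^-1)%:C pp) p1.
    have -> : (fun g => k g * (((1 + e)^-1)%:C * p g)) = (fun g => ((1 + e)^-1)%:C * (k g * p g)).
      by apply/funext => g; rewrite mulrCA.
    rewrite cI_scale; last exact: ci_mul.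
    by rewrite nmM nm_real ger0_norm ?invr_ge0 ?(ltW e1) // ler_pdivrMl.
  have b2 : nm (cI (fun g => k g * (phi g - p g))) <= e * RI (fun g => nm (k g)).
    by rewrite mulrC; apply: RI_mul_le => //; exact: contC_sub.
  have b3 : RI (fun g => nm (k g)) - e <= nm (cI (fun g => k g * phi g)).
    apply: le_trans (le_trans (ler_norm _) (ler_Re_nm _)); rewrite cIE /=.
    have ir : ri (fun g => complex.Re (k g * phi g)).
      by have [] : ci (fun g => k g * phi g) by exact: ci_mul.
    rewrite -{1}(RI_cst mu e) -RI_sub //; last exact: ri_cst.
    apply: RI_le => [||g]; [by apply: ri_sub => //; exact: ri_cst|exact: ir|].
    (* y^2 / (y + e) >= y - e. *)
    rewrite kphi /= ler_pdivlMr //; have := sqr_ge0 e.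
    by move: (nm (k g)) => y; rewrite expr2 [X in _ -> _ <= X]expr2; nra.
  have E : cI (fun g => k g * phi g) =
      cI (fun g => k g * (phi g - p g)) + cI (fun g => k g * p g).
    rewrite -cI_add; [|by apply: ci_mul => //; exact: contC_sub|exact: ci_mul].
    by congr (cI _); apply/funext => g; ring.
  have b4 := nmD (cI (fun g => k g * (phi g - p g))) (cI (fun g => k g * p g)).
  rewrite -E in b4; move: b1 b2 b3 b4.
  by move: (RI _) (nm _) (nm _) (nm _) ((1 + e) * B) => r x y w s; move: (e * r) => er *; lra.
apply/ler_addgt0Pr => d d0.
set r := RI _ in key n0 *; have S0 : 0 < 1 + r + B by lra.
have := key (d / (1 + r + B)) (divr_gt0 d0 S0).
have : d / (1 + r + B) * (1 + r + B) = d by rewrite divfK // gt_eqF.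
move: (d / (1 + r + B)) => e E h; apply: le_trans h _.
by rewrite -[X in _ <= _ + X]E le_eqVlt; apply/orP; left; apply/eqP; ring.
Qed.

(** The transpose of the multiplier is bounded in mean on polynomials, so that
    it extends to integrable functions. *)
Lemma transpose_mean f : ci f -> exists2 k, ci k &
  RI (fun g => nm (k g)) <= mult_norm * RI (fun g => nm (f g)) /\
  forall p q, mult_rel p q -> cI (fun g => f g * q g) = cI (fun g => k g * p g).
Proof.
move=> fi; have M0 : 0 <= mult_norm.
  have [q pq] := mult_rel_exists (pol_cst 1).
  have := mult_bound (B := 1) pq _ (SU2_one R).
  rewrite mulr1 => h; apply: le_trans (nm_ge0 _) (h _) => g.
  by rewrite (_ : 1 = 1%:C) // nm_real normr1.
have ex n : exists h, pol h /\ RI (fun g => nm (f g - h g)) <= 2 ^- n.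
  have [|h ph Hh] := pol_dense_mean haar fi (e := 2 ^- n); first by rewrite invr_gt0 exprn_gt0.
  by exists h.
have [h Hh] := choice ex.
have exk n : exists k, pol k /\ forall p q, mult_rel p q ->
    cI (fun g => h n g * q g) = cI (fun g => k g * p g).
  by have [k pk Hk] := transpose_exists (Hh n).1; exists k.
have [k Hk] := choice exk.
have hi n : ci (h n) by apply: pol_ci; exact: (Hh n).1.
have ki n : ci (k n) by apply: pol_ci; exact: (Hk n).1.
have bound (h' k' : G -> C) : pol h' -> pol k' -> (forall p q, mult_rel p q ->
    cI (fun g => h' g * q g) = cI (fun g => k' g * p g)) ->
    RI (fun g => nm (k' g)) <= mult_norm * RI (fun g => nm (h' g)).
  move=> ph pk Hhk; apply: RI_duality; first exact: pol_contC.
  move=> p pp p1; have [q pq] := mult_rel_exists pp; rewrite -(Hhk _ _ pq) mulrC.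
  apply: RI_mul_le; [exact: pol_ci|exact: pol_contC (mult_rel_pol pq).2|] => g.
  by have := mult_bound pq p1 g; rewrite mulr1.
(* The transposes of approximations within 2 ^ - n of f have summable differences. *)
pose d n := if n is n'.+1 then (fun g => k n'.+1 g - k n' g) else k 0%N.
have di n : ci (d n) by case: n => [|n] //=; exact: ci_sub.
have dsum n g : \sum_(i < n.+1) d i g = k n g.
  elim: n => [|n IH]; first by rewrite big_ord_recr big_ord0 /= add0r.
  by rewrite big_ord_recr IH /=; ring.
have dS n : RI (fun g => nm (d n.+1 g)) <= mult_norm * (2 * 2 ^- n).
  have pd (a : nat -> G -> C) : (forall n, pol (a n)) -> pol (fun g => a n.+1 g - a n g).
    by move=> pa; exact: polB.
  have Hd p q : mult_rel p q -> cI (fun g => (h n.+1 g - h n g) * q g) = cI (fun g => d n.+1 g * p g).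
    move=> pq; have [pp pq'] := mult_rel_pol pq.
    have ip (a : nat -> G -> C) (b : G -> C) i : (forall n, ci (a n)) -> pol b -> ci (fun g => a i g * b g).
      by move=> ai pb; apply: ci_mul => //; exact: pol_contC.
    have sp (a : nat -> G -> C) (b : G -> C) : (forall n, ci (a n)) -> pol b ->
        cI (fun g => (a n.+1 g - a n g) * b g) = cI (fun g => a n.+1 g * b g) - cI (fun g => a n g * b g).
      move=> ai pb; rewrite -cI_sub; try exact: ip.
      by congr (cI _); apply/funext => g; rewrite mulrBl.
    by rewrite sp // ((Hk n.+1).2 _ _ pq) ((Hk n).2 _ _ pq) -sp.
  apply: le_trans (bound _ _ (pd h (fun n => (Hh n).1)) (pd k (fun n => (Hk n).1)) Hd) _.
  rewrite ler_wpM2l //.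
  apply: le_trans (RI_nm_triangle (hi n.+1) fi (hi n)) _.
  have h1 := (Hh n).2; have := (Hh n.+1).2; rewrite exprS invfM.
  have -> : (fun g => nm (f g - h n.+1 g)) = (fun g => nm (h n.+1 g - f g)).
    by apply/funext => g; rewrite nm_distC.
  have p2 : (0 : R) <= 2 ^- n by rewrite invr_ge0 exprn_ge0.
  by move: h1 p2; move: (RI _) (RI _) (2 ^- n) => *; lra.
pose S := RI (fun g => nm (k 0%N g)) + 4 * mult_norm.
have sumS n : \sum_(i < n) RI (fun g => nm (d i g)) <= S.
  case: n => [|n].
    rewrite big_ord0; apply: addr_ge0; last exact: mulr_ge0.
    by apply: RI_ge0 => g; exact: nm_ge0.
  rewrite big_ord_recl /= /S lerD2l.
  apply: (@le_trans _ _ (mult_norm * (4 - 4 * 2 ^- n))).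
    elim: n => [|n IH]; first by rewrite big_ord0 expr0 invr1 mulr1 subrr mulr0.
    rewrite big_ord_recr /=; apply: le_trans (lerD IH (dS n)) _.
    by rewrite -mulrDr exprS invfM ler_wpM2l //; move: (2 ^- n) => y; lra.
  rewrite mulrC ler_wpM2r //.
  have p2 : (0 : R) <= 2 ^- n by rewrite invr_ge0 exprn_ge0.
  by move: (2 ^- n) p2 => y; lra.
have [kk kki Hkk] := mean_series di sumS.
have small (e : R) : 0 < e -> exists n, RI (fun g => nm (k n g - kk g)) <= e /\ 2 ^- n <= e.
  move=> e0; have [N HN] := Hkk e e0; pose n := maxn N (Num.truncn e^-1).
  exists n; split.
    have -> : (fun g => nm (k n g - kk g)) = (fun g => nm (\sum_(i < n.+1) d i g - kk g)).
      by apply/funext => g; rewrite dsum.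
    by apply: HN; exact: leq_trans (leq_maxl N _) (leqnSn _).
  rewrite invf_ple ?posrE ?exprn_gt0 //; apply/ltW; apply: lt_le_trans (truncnS_gt _) _.
  rewrite -natrX ler_nat; apply: (@leq_ltn_trans n); [exact: leq_maxr|exact: ltn_expl].
exists kk => //; split.
  apply/ler_addgt0Pr => e e0; have M1 : 0 < 1 + mult_norm by rewrite ltr_pwDl.
  have [n [n1 n2]] := small _ (divr_gt0 e0 M1).
  have b := bound _ _ (Hh n).1 (Hk n).1 (Hk n).2.
  have t1 : RI (fun g => nm (kk g)) <= RI (fun g => nm (k n g - kk g)) + RI (fun g => nm (k n g)).
    rewrite -RI_add; [|by apply: ri_nm; exact: ci_sub|exact: ri_nm].
    apply: RI_le => [||g]; [exact: ri_nm|by apply: ri_add; apply: ri_nm => //; exact: ci_sub|].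
    by rewrite addrC -{1}[kk g](subKr (k n g)) nmB.
  have t2 : RI (fun g => nm (h n g)) <= RI (fun g => nm (f g - h n g)) + RI (fun g => nm (f g)).
    rewrite -RI_add; [|by apply: ri_nm; exact: ci_sub|exact: ri_nm].
    apply: RI_le => [||g]; [exact: ri_nm|by apply: ri_add; apply: ri_nm => //; exact: ci_sub|].
    by rewrite addrC -{1}[h n g](subKr (f g)) nmB.
  have t3 : RI (fun g => nm (h n g)) <= e / (1 + mult_norm) + RI (fun g => nm (f g)).
    by apply: le_trans t2 _; rewrite lerD2r; apply: le_trans (Hh n).2 n2.
  have t4 : mult_norm * RI (fun g => nm (h n g)) <=
      mult_norm * (e / (1 + mult_norm)) + mult_norm * RI (fun g => nm (f g)).
    by rewrite -mulrDr ler_wpM2l.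
  have t5 : e / (1 + mult_norm) + mult_norm * (e / (1 + mult_norm)) = e.
    by field; rewrite gt_eqF.
  move: n1 b t1 t4 t5; move: (RI _) (RI _) (RI _) => *; lra.
move=> p q pq; have [pp pq'] := mult_rel_pol pq.
have pc := pol_contC pp; have qc := pol_contC pq'.
have [P [P0 HP]] := SU2_bounded pc; have [Q [Q0 HQ]] := SU2_bounded qc.
apply/eqP; rewrite -subr_eq0; apply/eqP/nm_small => e e0.
have PQ : 0 < P + Q + 1 by rewrite ltr_wpDl // addr_ge0.
have [n [n1 n2]] := small _ (divr_gt0 e0 PQ).
have E : cI (fun g => f g * q g) - cI (fun g => kk g * p g) =
    cI (fun g => (f g - h n g) * q g) + cI (fun g => (k n g - kk g) * p g).
  have sp (a b c : G -> C) : ci a -> ci b -> contC c ->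
      cI (fun g => (a g - b g) * c g) = cI (fun g => a g * c g) - cI (fun g => b g * c g).
    move=> ai bi cc; rewrite -cI_sub; try exact: ci_mul.
    by congr (cI _); apply/funext => g; rewrite mulrBl.
  by rewrite !sp // ((Hk n).2 _ _ pq); ring.
rewrite E; apply: le_trans (nmD _ _) _.
have b1 : nm (cI (fun g => (f g - h n g) * q g)) <= e / (P + Q + 1) * Q.
  apply: le_trans (RI_mul_le (ci_sub fi (hi n)) qc HQ) _; rewrite ler_wpM2r //.
  exact: le_trans (Hh n).2 n2.
have b2 : nm (cI (fun g => (k n g - kk g) * p g)) <= e / (P + Q + 1) * P.
  by apply: le_trans (RI_mul_le (ci_sub (ki n) kki) pc HP) _; rewrite ler_wpM2r.
apply: le_trans (lerD b1 b2) _; rewrite -mulrDr [Q + P]addrC.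
have : e / (P + Q + 1) * (P + Q + 1) = e by rewrite divfK // gt_eqF.
have : 0 <= e / (P + Q + 1) by rewrite divr_ge0 // ltW.
by set a := e / (P + Q + 1) => a0 ab; rewrite -[leRHS]ab [leRHS]mulrDr mulr1 lerDl.
Qed.

End inverse.

(** * Proof of the a priori estimate *)

Section assembly.
Variable R : realType.
Local Notation C := R[i].
Local Notation G := (SU2 R).
Local Notation D := (@dl R).
Variable mu : probability G R.
Hypothesis haar : is_haar mu.
Local Notation cI := (cI mu).
Local Notation RI := (RI mu).
Local Notation ri := (ri mu).
Local Notation ci := (ci mu).
Variables X Y Z : su2 R.
Hypothesis XYZ : su2_frame X Y Z.
Local Notation Lap := (Lap X Y Z).
Local Notation joint_eig := (joint_eig X Y Z).

Local Opaque mksm.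

Lemma dist_lin (u : SU2_distribution R) c f h : is_smooth f -> is_smooth h ->
  u (mksm (fun g => c * f g + h g)) = c * u (mksm f) + u (mksm h).
Proof.
move=> sf sh; rewrite (smooth_lin c sf sh).2.
exact: (distributionP u).1.
Qed.

Lemma dist0 (u : SU2_distribution R) : u (mksm (fun=> 0)) = 0.
Proof.
have s0 : is_smooth (fun _ : G => 0 : C) by apply: pol_smooth; exact: pol_cst.
have h := dist_lin u (-1) s0 s0.
have E : (fun _ : G => -1 * 0 + 0 : C) = fun=> 0 by apply/funext => g; ring.
by rewrite E in h; rewrite h mulN1r addNr.
Qed.

Lemma dist_scale (u : SU2_distribution R) c f : is_smooth f ->
  u (mksm (fun g => c * f g)) = c * u (mksm f).
Proof.
have s0 : is_smooth (fun _ : G => 0 : C) by apply: pol_smooth; exact: pol_cst.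
move=> sf; rewrite -[RHS]addr0 -(dist0 u) -(dist_lin u c sf s0).
by congr (u (mksm _)); apply/funext => g; rewrite addr0.
Qed.

Lemma dist_sum (u : SU2_distribution R) (I : finType) (F : I -> G -> C) :
  (forall i, pol (F i)) -> u (mksm (fun g => \sum_i F i g)) = \sum_i u (mksm (F i)).
Proof.
move=> pF; rewrite /index_enum.
have H (s : seq I) : pol (fun g => \sum_(i <- s) F i g) /\
    u (mksm (fun g => \sum_(i <- s) F i g)) = \sum_(i <- s) u (mksm (F i)).
  elim: s => [|i s [IH1 IH2]].
    rewrite big_nil (_ : (fun g => _) = fun=> 0); last by apply/funext => g; rewrite big_nil.
    by split; [exact: pol_cst|exact: dist0].
  rewrite big_cons (_ : (fun g => _) = fun g => 1 * F i g + \sum_(j <- s) F j g).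
    split; first by apply: polD => //; exact: polZ.
    exact: (etrans (dist_lin u 1 (pol_smooth (pF i)) (pol_smooth IH1)) (f_equal2 +%R (mul1r _) IH2)).
  by apply/funext => g; rewrite big_cons mul1r.
exact: (H _).2.
Qed.

Lemma joint_eig_XY (l m : R) f : joint_eig l m f ->
  (fun g => D X (D X f) g + D Y (D Y f) g) = fun g => (m ^+ 2 - l)%:C * f g.
Proof.
move=> [[pf Lf] Zf _ _]; apply/funext => g; have := congr1 (fun h => h g) Lf.
have ZZ : D Z (D Z f) g = (0 +i* m) * ((0 +i* m) * f g) by rewrite Zf D_scale // Zf.
rewrite /Lap ZZ (_ : (0 +i* m) * ((0 +i* m) * f g) = - (m ^+ 2)%:C * f g); last first.
  by case: (f g) => a b; apply: complexP => /=; ring.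
have -> : (m ^+ 2 - l)%:C = (m ^+ 2)%:C - l%:C by apply: complexP => /=; ring.
rewrite mulrBl => <-.
by move: (D X _ g) (D Y _ g) (f g) (m ^+ 2)%:C => a b c d; ring.
Qed.

Lemma sub_laplacian_eig (u : SU2_distribution R) (l m : R) f : joint_eig l m f ->
  sub_laplacian X Y u (mksm f) = (m ^+ 2 - l)%:C * u (mksm f).
Proof.
move=> ef; have pf := joint_eig_pol ef; have sf := pol_smooth pf.
have lie2 A : smooth_lie A (smooth_lie A (mksm f)) = mksm (D A (D A f)).
  apply: val_inj; rewrite [RHS]mksmE; last by apply: pol_smooth; do 2 apply: pol_lie.
  by rewrite /= mksmE // dlE.
have -> : sub_laplacian X Y u (mksm f) = u (mksm (D X (D X f))) + u (mksm (D Y (D Y f))).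
  by rewrite -!lie2 /sub_laplacian /= !fctE /= !opprK.
have pDD A : pol (D A (D A f)) by do 2 apply: pol_lie.
rewrite -dist_scale // -(joint_eig_XY ef).
have := dist_lin u 1 (pol_smooth (pDD X)) (pol_smooth (pDD Y)); rewrite mul1r => <-.
by congr (u (mksm _)); apply/funext => g; rewrite mul1r.
Qed.

(** Distributions are differentiated by duality, so that the field Z in the heat
    operator acts on test functions as - Z and ka = - 1; for the sub-Laplacian
    ka = 0. *)
Lemma operator_eig (T : SU2_distribution R -> SU2_distribution R) :
  T = sub_laplacian X Y \/ T = heat_operator X Y Z ->
  exists ka s : R, s ^+ 2 = 1 /\ forall u (l m : R) f, joint_eig l m f ->
    T u (mksm f) = s%:C * sym ka l m * u (mksm f).
Proof.
case=> ->.
  exists 0, (-1); split=> [|u l m f ef]; first by rewrite sqrrN expr1n.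
  rewrite (sub_laplacian_eig u ef); congr (_ * _); apply: complexP => /=; ring.
exists (-1), 1; split=> [|u l m f ef]; first by rewrite expr1n.
have pf := joint_eig_pol ef; have sf := pol_smooth pf.
have lieZ : smooth_lie Z (mksm f) = mksm (D Z f).
  apply: val_inj; rewrite [RHS]mksmE; last by apply: pol_smooth; exact: pol_lie.
  by rewrite /= mksmE // dlE.
have -> : heat_operator X Y Z u (mksm f) = - u (mksm (D Z f)) - sub_laplacian X Y u (mksm f).
  by rewrite -lieZ.
have [_ Zf _ _] := ef.
have -> : u (mksm (D Z f)) = (0 +i* m) * u (mksm f).
  rewrite -(dist_scale u (0 +i* m) sf); apply: (congr1 (fun h => u (mksm h))); exact: Zf.
rewrite (sub_laplacian_eig u ef) -mulNr -mulrBl.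
by congr (_ * _); apply: complexP => /=; ring.
Qed.

(** The Bessel potential is defined by choice, hence satisfies its defining equation
    because some distribution does. *)
Lemma bessel_is_bessel (a : R) (u : SU2_distribution R) : 0 <= a ->
  forall (l : R) (f : SU2_smooth R), laplacian X Y Z f = l%:C *: f ->
    bessel X Y Z (- a) u f = ((1 + l) `^ (- (a / 2)))%:C * u f.
Proof.
move=> a0; have [Q [Q1 Q2 Q3 Q4]] := mollifiers haar.
have a2 : 0 <= a / 2 by rewrite divr_ge0.
have [v Hv] := bessel_exists XYZ Q1 Q2 Q3 Q4 u a2.
have bv : is_bessel X Y Z (- a) u v by move=> l f Lf; rewrite mulNr; exact: Hv.
have := xgetPex 0 (ex_intro [set v | is_bessel X Y Z (- a) u v] v bv).
by move=> H l f Lf; rewrite -mulNr; exact: H.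
Qed.

Lemma laplacian_eig (l : R) f : eigL X Y Z l f ->
  laplacian X Y Z (mksm f) = l%:C *: mksm f.
Proof.
move=> [pf Lf]; have sf := pol_smooth pf; apply: val_inj => /=.
have E := mksmE sf; rewrite E; apply/funext => g; have := congr1 (fun h => h g) Lf.
by rewrite /Lap dlE.
Qed.

Lemma bessel_eig (a : R) (u : SU2_distribution R) (l : R) f : 0 <= a -> eigL X Y Z l f ->
  bessel X Y Z (- a) u (mksm f) = ((1 + l) `^ (- (a / 2)))%:C * u (mksm f).
Proof. by move=> a0 ef; apply: bessel_is_bessel => //; exact: laplacian_eig. Qed.

Lemma pol_one : eigL X Y Z 0 (fun=> 1).
Proof. by split; [exact: pol_cst|apply/funext => g; rewrite /Lap !D_cst; ring]. Qed.

(** The spectral form of u = T^(-1) T u on a joint eigenfunction. *)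
Lemma dist_eig (ka s : R) (u Tu v : SU2_distribution R) (l m : R) f : s ^+ 2 = 1 ->
  joint_eig l m f -> Tu (mksm f) = s%:C * sym ka l m * u (mksm f) ->
  v (mksm f) = ((1 + l) `^ (- (8^-1)))%:C * Tu (mksm f) ->
  u (mksm f) = cI f * u (mksm (fun=> 1)) + s%:C * (mult ka l m * v (mksm f)).
Proof.
move=> s1 ef HT Hv; have [eL eZ l0 cst] := ef; have pf := joint_eig_pol ef.
rewrite /mult; case: eqP => [E|/eqP E].
  have [k fk] := cst E; rewrite mul0r mulr0 addr0 fk cI_cst -dist_scale.
    by congr (u (mksm _)); apply/funext => g; rewrite mulr1.
  by apply: pol_smooth; exact: pol_cst.
rewrite (int_joint_eig haar ef E) mul0r add0r Hv HT.
have [S0|S0] := eqVneq (sym ka l m) 0.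
  by rewrite (joint_eig_sym0 haar XYZ ef E S0) dist0 !mulr0.
have lp : 0 < 1 + l by rewrite ltr_wpDr.
have W1 : ((1 + l) `^ (8^-1))%:C * ((1 + l) `^ (- (8^-1)))%:C = 1 :> C.
  rewrite -rmorphM powRN mulfV // gt_eqF //; exact: powR_gt0.
have ss : s%:C * s%:C = 1 :> C by rewrite -rmorphM -expr2 s1.
move: ((1 + l) `^ (8^-1))%:C ((1 + l) `^ (- (8^-1)))%:C W1 => w w' W1.
transitivity (s%:C * s%:C * (w * w') * ((sym ka l m)^-1 * sym ka l m) * u (mksm f)).
  by rewrite ss W1 mulVf // !mul1r.
by ring.
Qed.

Lemma represents_cI f (u : SU2_distribution R) : represents mu f u <->
  ci f /\ forall phi : SU2_smooth R, u phi = cI (fun g => f g * phi g).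
Proof. by split=> [[a b c]|[[a b] c]]; split. Qed.

(** Polynomial approximations of a test function converge in every seminorm, in
    particular uniformly, so that both sides pass to the limit. *)
Lemma represents_pol f (u : SU2_distribution R) : ci f ->
  (forall p, pol p -> u (mksm p) = cI (fun g => f g * p g)) -> represents mu f u.
Proof.
move=> fi H; apply/represents_cI; split=> // phi.
have [Q [Q1 Q2 Q3 Q4]] := mollifiers haar.
have [E [HE1 HE2]] := approx_errors Q1 Q2 Q4 (smoothP phi).
have [S [K [K0 HK]]] := distribution_bound (distributionP u).
have sphi := smooth_cont (smoothP phi).
apply/eqP; rewrite -subr_eq0; apply/eqP/nm_small => e e0; have e2 : 0 < e / 2 by rewrite divr_gt0.
have [N1 H1] := HE2 S K _ e2.
have [N2 H2] := HE2 [:: [::]] (RI (fun g => nm (f g))) _ e2.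
pose n := maxn N1 N2; have pn : pol (Q n phi) by exact: Q1.
have sn := pol_smooth pn; have cn := pol_contC pn.
have b1 : nm (u (mksm (fun g => -1 * phi g + Q n phi g))) <= e / 2.
  apply: le_trans (H1 n (leq_maxl _ _)); apply: HK => s g.
  rewrite mksmE; last by have [] := smooth_lin (-1) (smoothP phi) sn.
  have -> : iter_lie s (fun g => -1 * phi g + Q n phi g) =
      fun g => -1 * iter_lie s phi g + iter_lie s (Q n phi) g.
    exact: (iter_lie_linear s (-1) (smoothP phi) sn).
  by rewrite mulN1r addrC; exact: HE1.
rewrite (dist_lin u (-1) (smoothP phi) sn) mksm_val (H _ pn) in b1.
have b2 : nm (cI (fun g => f g * (Q n phi g - phi g))) <= e / 2.
  apply: le_trans (RI_mul_le fi (contC_sub cn sphi) (HE1 n [::])) _.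
  by have := H2 n (leq_maxr _ _); rewrite big_seq1.
have E1 : cI (fun g => f g * (Q n phi g - phi g)) =
    cI (fun g => f g * Q n phi g) - cI (fun g => f g * phi g).
  rewrite -cI_sub; try exact: ci_mul.
  by congr (cI _); apply/funext => g; rewrite mulrBr.
rewrite E1 in b2.
have -> : u phi - cI (fun g => f g * phi g) = - (-1 * u phi + cI (fun g => f g * Q n phi g)) +
    (cI (fun g => f g * Q n phi g) - cI (fun g => f g * phi g)).
  by move: (u phi) (cI _) (cI _) => a b c; ring.
apply: le_trans (nmD _ _) _; rewrite nmN.
by apply: le_trans (lerD b1 b2) _; rewrite -splitr.
Qed.

Lemma Lnorm1_RI f : ci f -> Lnorm mu 1 (fun x => (nm (f x))%:E) = (RI (fun x => nm (f x)))%:E.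
Proof.
move=> fi; rewrite Lnorm1 RIE /Rintegral fineK; last exact: integrable_fin_num (ri_nm fi).
by apply: eq_integral => x _; rewrite /= ger0_norm // nm_ge0.
Qed.

(** Chebyshev's inequality for a representing function. *)
Lemma weak_le f (u : SU2_distribution R) : represents mu f u ->
  (weak_L1_norm mu u <= (RI (fun x => nm (f x)))%:E)%E.
Proof.
move=> rf; have /represents_cI[fi _] := rf.
apply: le_trans; first by apply: ereal_inf_lbound; exists f => //; exact: rf.
apply: ge_ereal_sup => _ [a a0 <-]; rewrite /= in a0.
pose A := [set x | a < nm (f x)].
have mA : measurable A.
  rewrite -[A]setTI; have := ri_meas (ri_nm fi) => /(_ measurableT _ (measurable_itv `]a, +oo[)).
  by congr measurable; apply/seteqP; split=> x /=; rewrite in_itv /= andbT.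
have fA : mu A \is a fin_num by exact: fin_num_measure.
rewrite -(fineK fA) -EFinM lee_fin.
have -> : a * fine (mu A) = RI (fun x => a * \1_A x).
  rewrite RI_scale; last exact: ri_indic.
  by rewrite RIE /Rintegral integral_indic // setIT.
apply: RI_le => [||x]; [by apply: ri_scale; exact: ri_indic|exact: ri_nm|].
rewrite indicE; have [xA|xA] := boolP (x \in A).
  by rewrite mulr1 ltW //; rewrite inE in xA.
by rewrite mulr0 nm_ge0.
Qed.

(** Let k be the image of f0 under the transposed multiplier. By [dist_eig], u is
    represented by the function u(1) + s k; and u(1) is the mean value of fN, because
    Bessel potentials fix the constants. *)
Lemma norm_bound (ka s : R) (u Tu : SU2_distribution R) (N : R) f0 fN : s ^+ 2 = 1 -> 0 < N ->
  (forall (l m : R) f, joint_eig l m f -> Tu (mksm f) = s%:C * sym ka l m * u (mksm f)) ->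
  represents mu f0 (bessel X Y Z (- 4^-1) Tu) ->
  represents mu fN (bessel X Y Z (- N) u) ->
  (weak_L1_norm mu u <= (mult_norm ka * RI (fun x => nm (f0 x)) + RI (fun x => nm (fN x)))%:E)%E.
Proof.
move=> s1 N0 HT /represents_cI[f0i Hf0] /represents_cI[fNi HfN].
have [k ki [kb Hk]] := transpose_mean haar XYZ ka f0i.
pose u1 := u (mksm (fun=> 1)).
have u1E : u1 = cI fN.
  have := bessel_eig u (ltW N0) pol_one; rewrite addr0 powR1 mul1r -/u1 => <-.
  rewrite HfN; congr (cI _); apply/funext => g.
  by rewrite mksmE ?mulr1 //; apply: pol_smooth; exact: pol_cst.
have ic : ci (fun g => u1 + s%:C * k g).
  by apply: ci_add; [apply: contC_ci; exact: contC_cst|exact: ci_scale].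
have rep : represents mu (fun g => u1 + s%:C * k g) u.
  apply: represents_pol => // p pp.
  have [I [l [m [F [HF E]]]]] := pol_decomposition XYZ pp.
  have pF i : pol (F i) := joint_eig_pol (HF i).
  pose q := lc (fun i => mult ka (l i) (m i)) F.
  have pq : mult_rel X Y Z ka p q by exists I, l, m, F.
  have qp := (mult_rel_pol pq).2; have pc := pol_contC pp.
  pose v := bessel X Y Z (- 4^-1) Tu.
  have vq : v (mksm q) = cI (fun g => k g * p g).
    rewrite Hf0 -(Hk _ _ pq); congr (cI _); apply/funext => g.
    by rewrite mksmE //; exact: pol_smooth.
  have qE (w : SU2_distribution R) :
      w (mksm q) = \sum_i mult ka (l i) (m i) * w (mksm (F i)).
    apply: etrans (dist_sum w (fun i => polZ _ (pF i))) _.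
    by apply: eq_bigr => i _; exact: dist_scale (pol_smooth (pF i)).
  have iF i : ci (F i) := pol_ci mu (pF i).
  have q0 : (0 : R) <= 4^-1 by rewrite invr_ge0.
  have uE : u (mksm p) = cI p * u1 + s%:C * v (mksm q).
    rewrite qE {1 2}E (dist_sum u pF) (ci_sum iF).2 mulr_suml mulr_sumr -big_split /=.
    apply: eq_bigr => i _; have [eL _ _ _] := HF i.
    apply: (dist_eig s1 (HF i) (HT _ _ _ (HF i))).
    rewrite /v (bessel_eig Tu q0 eL); congr ((_ `^ (- _))%:C * _); by field.
  have ikp : ci (fun g => k g * p g) by exact: ci_mul.
  rewrite uE vq [cI p * _]mulrC -(cI_scale _ (pol_ci mu pp)) -(cI_scale _ ikp).
  rewrite -cI_add; [|exact: ci_scale (pol_ci mu pp)|exact: ci_scale].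
  by congr (cI _); apply/funext => g; ring.
apply: le_trans (weak_le rep) _; rewrite lee_fin addrC.
have u1b : nm u1 <= RI (fun x => nm (fN x)).
  by rewrite u1E; apply: cI_bound => //; exact: ri_nm.
have s_1 : `|s| = 1.
  by apply/eqP; rewrite -(eqrXn2 (n := 2)) // real_normK ?num_real // s1 expr1n.
apply: (@le_trans _ _ (RI (fun g => nm u1 + nm (k g)))).
  apply: RI_le => [||g]; [exact: ri_nm|by apply: ri_add; [exact: ri_cst|exact: ri_nm]|].
  by apply: le_trans (nmD _ _) _; rewrite nmM nm_real s_1 mul1r.
rewrite RI_add ?RI_cst; [|exact: ri_cst|exact: ri_nm].
exact: lerD.
Qed.

End assembly.

Theorem theorem4p1 (R : realType) (mu : probability (SU2 R) R)
    (mu_haar : is_haar mu) (X Y Z : su2 R) (XYZ_frame : su2_frame X Y Z)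
    (T : SU2_distribution R -> SU2_distribution R)
    (T_def : T = sub_laplacian X Y \/ T = heat_operator X Y Z) :
  exists C : R, 0 < C /\
    forall N : R, 0 < N -> exists CN : R, 0 < CN /\
      forall u : SU2_distribution R,
        let rhs := (C%:E * sobolev_norm mu X Y Z 1 (- 4^-1) (T u)
                    + CN%:E * sobolev_norm mu X Y Z 1 (- N) u)%E in
        (rhs < +oo)%E -> (weak_L1_norm mu u <= rhs)%E.
Proof.
have [ka [s [s1 HT]]] := operator_eig T_def.
pose M := Num.max 1 (mult_norm ka); have M1 : 1 <= M by rewrite le_max lexx.
have M0 : 0 < M by apply: lt_le_trans M1.
exists M; split=> // N N0; exists 1; split=> // u rhs rhs_fin.
pose S1 := [set Lnorm mu 1 (fun x => (nm (f x))%:E) | f in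
  [set f | represents mu f (bessel X Y Z (- 4^-1) (T u))]].
pose S2 := [set Lnorm mu 1 (fun x => (nm (f x))%:E) | f in
  [set f | represents mu f (bessel X Y Z (- N) u)]].
have rhsE : rhs = (M%:E * ereal_inf S1 + 1%:E * ereal_inf S2)%E by [].
have S1_0 : (0 <= ereal_inf S1)%E.
  by apply: le_ereal_inf_tmp => _ [f _ <-]; exact: Lnorm_ge0.
have S2_0 : (0 <= ereal_inf S2)%E.
  by apply: le_ereal_inf_tmp => _ [f _ <-]; exact: Lnorm_ge0.
have MS1_0 : (0 <= M%:E * ereal_inf S1)%E by rewrite mule_ge0 // lee_fin ltW.
rewrite rhsE mul1e in rhs_fin *.
have [f1 f2] : (ereal_inf S1 < +oo)%E /\ (ereal_inf S2 < +oo)%E.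
  split.
    have : (M%:E * ereal_inf S1 < +oo)%E by apply: le_lt_trans rhs_fin; rewrite leeDl.
    have [//|] := ltP (ereal_inf S1) +oo%E; rewrite leye_eq => /eqP ->.
    by rewrite gt0_muley ?lte_fin.
  by apply: le_lt_trans rhs_fin; rewrite leeDr.
have n1 : ereal_inf S1 \is a fin_num by rewrite ge0_fin_numE.
have n2 : ereal_inf S2 \is a fin_num by rewrite ge0_fin_numE.
apply/lee_addgt0Pr => e e0.
have e1 : 0 < e / (M + 1) by rewrite divr_gt0 // addr_gt0.
(* The norms are infima over representing functions, hence the margin. *)
have [_ [f0 r0 <-] h0] := lb_ereal_inf_adherent e1 n1.
have [_ [fN rN <-] hN] := lb_ereal_inf_adherent e1 n2.
have /represents_cI[i0 _] := r0; have /represents_cI[iN _] := rN.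
have := norm_bound mu_haar XYZ_frame s1 N0 (HT u) r0 rN.
move: h0 hN; rewrite !Lnorm1_RI // -(fineK n1) -(fineK n2) -!EFinM -!EFinD !lte_fin => h0 hN hw.
apply: le_trans hw _; rewrite lee_fin.
set a := RI _ _ in h0 *; set b := RI _ _ in hN *.
have a0 : 0 <= a by apply: RI_ge0 => x; exact: nm_ge0.
have h1 : mult_norm ka * a <= M * a by rewrite ler_wpM2r // le_max lexx orbT.
have h2 : M * a <= M * (fine (ereal_inf S1) + e / (M + 1)) by rewrite ler_wpM2l ?(ltW M0) ?(ltW h0).
have h3 : M * (e / (M + 1)) + e / (M + 1) = e by field; rewrite gt_eqF // addr_gt0.
move: h1 h2 h3 hN; rewrite mulrDr; move: (M * (e / (M + 1))) (e / (M + 1)) => x y; lra.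
Qed.
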